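(* Let $n\in\mathbb{N}$ and $\sigma\in\mathbb{R}$ satisfy $1<\sigma<n<2\sigma$. Put $p_{\rm c}:=1+\frac{2\sigma}{n}$ and $q_{\rm c}:=1+\frac{2\sigma}{n-\sigma}$. Let $p^*,q^*>1$ lie on the critical curve $$\max\left\{\frac{2q^*+1}{p^*q^*+q^*-2},\ \frac{p^*q^*+p^*+1}{2p^*q^*-p^*-1}\right\}=\frac{n}{2\sigma}.$$ Let $u_1,v_1\in L^1(\mathbb{R}^n)$ satisfy $$\int_{\mathbb{R}^n}u_1(x)\,dx>0\quad\text{and}\quad\int_{\mathbb{R}^n}v_1(x)\,dx>0.$$ Let $\mu_1,\mu_2$ be moduli of continuity such that $s^k\mu_j^{(k)}(s)=\mathcal{O}(\mu_j(s))$ as $s\to+0$ for $j,k=1,2$. With $c>0$ a suitable small constant, suppose that one of the following holds: (i) $q^*\ge q_{\rm c}$, $p^*\le p_{\rm c}$, and $\displaystyle\int_0^c\frac1s\,(\mu_1(s))^{\frac{q^*}{q^*+1}}(\mu_2(s))^{\frac1{q^*+1}}\,ds=\infty$; (ii) $q^*\le q_{\rm c}$, $p^*\ge p_{\rm c}$, and $\displaystyle\int_0^c\frac1s\,(\mu_1(s))^{\frac1{p^*+1}}(\mu_2(s))^{\frac{p^*}{p^*+1}}\,ds=\infty$; and, when $\sigma$ is not an integer, in addition $n\ge2\lfloor\sigma\rfloor$. Then there is no global (in time) Sobolev solution $(u,v)$ (in the sense defined in the context) to $$\begin{cases}u_{tt}+(-\Delta)^\sigma u+(-\Delta)^\sigma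 u_t=|v|^{p^*}\mu_1(|v|), & x\in\mathbb{R}^n,\ t\ge0,\\ v_{tt}+(-\Delta)^\sigma v+v_t=|u|^{q^*}\mu_2(|u|), & x\in\mathbb{R}^n,\ t\ge0,\\ (u,u_t,v,v_t)(0,x)=(0,u_1,0,v_1)(x), & x\in\mathbb{R}^n.\end{cases}$$
   Context: A modulus of continuity is a function $\mu:[0,\infty)\to[0,\infty)$ that is continuous, concave and increasing; derivatives of $\mu_j$ appearing in hypotheses are assumed to exist. $\lfloor\cdot\rfloor$ is the integer part. $(-\Delta)^\sigma$ is the Fourier multiplier with symbol $|\xi|^{2\sigma}$; $H^{a}$ is the $L^2$-based Bessel potential space on $\mathbb{R}^n$. Set $\Phi_p(s):=s^{p^*}\mu_1(s)$ and $\Phi_q(s):=s^{q^*}\mu_2(s)$. A pair of functions $(u,v)$ is called a global (in time) Sobolev solution to the system if $\Phi_p(|v(t,x)|),\Phi_q(|u(t,x)|)\in L^1\big((0,\infty)\times\mathbb{R}^n\big)$ and the following identities hold: $$\int_0^\infty\!\!\int_{\mathbb{R}^n}u\,\big[\partial_t^2-\partial_t(-\Delta)^\sigma+(-\Delta)^\sigma\big]\phi_1\,dx\,dt-\int_{\mathbb{R}^n}u_1(x)\phi_1(0,x)\,dx=\int_0^\infty\!\!\int_{\mathbb{R}^n}\Phi_p(|v|)\,\phi_1\,dx\,dt,$$ $$\int_0^\infty\!\!\int_{\mathbb{R}^n}v\,\big[\partial_t^2-\partial_t+(-\Delta)^\sigma\big]\phi_2\,dx\,dt-\int_{\mathbb{R}^n}v_1(x)\phi_2(0,x)\,dx=\int_0^\infty\!\!\int_{\mathbb{R}^n}\Phi_q(|u|)\,\phi_2\,dx\,dt$$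 for all test functions of the form $\phi_i(t,x)=\eta_i(t)\varphi_i(x)$, $i=1,2$, where $\eta_i\in\mathcal{C}_0^\infty([0,\infty))$, $\eta_i\equiv1$ in a neighborhood of $0$, and $\varphi_i\in H^{2\sigma}(\mathbb{R}^n)$. *)

(* Defs.v *)
From HB Require Import structures.
From mathcomp Require Import all_boot all_order all_algebra.
From mathcomp Require Import all_classical all_reals all_analysis.

Set Implicit Arguments.
Unset Strict Implicit.
Unset Printing Implicit Defensive.

Import Order.TTheory GRing.Theory Num.Theory.
Import numFieldNormedType.Exports.

Local Open Scope classical_set_scope.
Local Open Scope ring_scope.

(* R^n is the type of n-tuples, with the product (Borel) sigma-algebra. *)
Notation euclidean R n := (n.-tuple (measurableTypeR R)).

(* Lebesgue measure on R^n is built by induction on n: the measure on R^(n+1)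
   is the image of the product measure on R x R^n under (x, t) |-> x :: t. *)
Section cons_measure.
Context (R : realType) (n : nat).
Variable m : {sigma_finite_measure set (euclidean R n) -> \bar R}.

Definition cons_pair (z : measurableTypeR R * euclidean R n) :
  euclidean R n.+1 := [the n.+1.-tuple _ of z.1 :: z.2].

Lemma measurable_cons_pair : measurable_fun [set: _] cons_pair.
Proof. exact: measurable_cons. Qed.

Definition cons_measure : set (euclidean R n.+1) -> \bar R :=
  pushforward (@lebesgue_measure R \x m)%E cons_pair.

Let cons_measure0 : cons_measure set0 = 0%E.
Proof. by rewrite /cons_measure /pushforward preimage_set0 measure0. Qed.

Let cons_measure_ge0 A : (0 <= cons_measure A)%E.
Proof. by rewrite /cons_measure /pushforward measure_ge0. Qed.

Let cons_measure_sigma_additive : semi_sigma_additive cons_measure.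
Proof.
move=> F mF tF mUF; rewrite /cons_measure /pushforward preimage_bigcup.
apply: measure_semi_sigma_additive.
- by move=> k; rewrite -[X in measurable X]setTI; exact: measurable_cons_pair.
- apply/trivIsetP => /= i j _ _ ij; rewrite -preimage_setI.
  by move/trivIsetP : tF => /(_ _ _ _ _ ij) ->//; rewrite preimage_set0.
- by rewrite -preimage_bigcup -[X in measurable X]setTI;
    exact: measurable_cons_pair.
Qed.

HB.instance Definition _ := isMeasure.Build _ _ _
  cons_measure cons_measure0 cons_measure_ge0 cons_measure_sigma_additive.

Let cons_measure_sigma_finite : sigma_finite setT cons_measure.
Proof.
have [F TF Foo] : sigma_finite setT (@lebesgue_measure R \x m)%E.
  have /sigma_finiteP[F [TF ndF Foo]] := sigma_finiteT (@lebesgue_measure R).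
  have /sigma_finiteP[G [TG ndG Goo]] := sigma_finiteT m.
  exists (fun k => F k `*` G k).
    rewrite -setXTT TF TG predeqE => -[x y]; split.
      move=> [/= [i _ Fix] [k _ Gky]]; exists (maxn i k) => //; split.
      - by move: x Fix; exact/subsetPset/ndF/leq_maxl.
      - by move: y Gky; exact/subsetPset/ndG/leq_maxr.
    by move=> [i _ []/= ? ?]; split; exists i.
  move=> k; have [? ?] := Foo k; have [? ?] := Goo k.
  split; first exact: measurableX.
  by rewrite product_measure1E// lte_mul_pinfty// ge0_fin_numE.
pose g (t : euclidean R n.+1) : measurableTypeR R * euclidean R n :=
  (tnth t ord0, [tuple of behead t]).
have mg : measurable_fun setT g.
  apply/measurable_fun_pair; first exact: measurable_tnth.
  exact: measurable_behead.
have gK z : g (cons_pair z) = z.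
  by case: z => x t; rewrite /g/=; congr pair; apply: val_inj.
exists (fun k => g @^-1` F k).
  by rewrite -preimage_bigcup -TF preimage_setT.
move=> k; have [mFk Fkoo] := Foo k; split.
  by rewrite -[X in measurable X]setTI; exact: mg.
rewrite /cons_measure /pushforward -comp_preimage.
by rewrite (_ : g \o cons_pair = id) ?preimage_id//; apply/funext => z /=.
Qed.

HB.instance Definition _ := Measure_isSigmaFinite.Build _ _ _
  cons_measure cons_measure_sigma_finite.

End cons_measure.

Fixpoint lebesgue_measure_n (R : realType) (n : nat) :
    {sigma_finite_measure set (euclidean R n) -> \bar R} :=
  match n with
  | 0 => [the {sigma_finite_measure set (euclidean R 0) -> \bar R} of
           \d_([tuple] : euclidean R 0)]
  | n'.+1 => [the {sigma_finite_measure set (euclidean R n'.+1) -> \bar R} of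
               cons_measure (lebesgue_measure_n R n')]
  end.

(* The value on boxes, which characterizes Lebesgue measure. *)
Lemma lebesgue_measure_n_box (R : realType) (n : nat)
    (A : 'I_n -> set (measurableTypeR R)) :
  (forall i, measurable (A i)) ->
  lebesgue_measure_n R n [set x | forall i, A i (tnth x i)] =
  (\prod_(i < n) @lebesgue_measure R (A i))%E.
Proof.
elim: n A => [|n IHn] A mA /=.
  rewrite big_ord0 diracE mem_set//=.
  by case.
rewrite big_ord_recl -IHn//= /cons_measure /pushforward.
rewrite -product_measure1E//; last first.
  rewrite (_ : [set _ | _] =
      \bigcap_(i in [set: 'I_n]) ((@tnth _ _)^~ i @^-1` A (lift ord0 i))).
    apply: fin_bigcap_measurable => // i _.
    by rewrite -[X in measurable X]setTI; exact: measurable_tnth.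
  by apply/seteqP; split => x /= Ax i; [move=> _|]; exact: Ax.
congr product_measure1; apply/seteqP; split => -[x t] /=.
  move=> Axt; split; first exact: (Axt ord0).
  by move=> i; have := Axt (lift ord0 i); rewrite tnthS.
move=> [Ax At] i; case: (unliftP ord0 i) => [j|] ->; last exact: Ax.
by rewrite tnthS; exact: At.
Qed.

Section fourier.
Context (R : realType) (n : nat).
Implicit Types (x xi : euclidean R n) (f A B : euclidean R n -> R).

Local Notation lambda := (lebesgue_measure_n R n).

Definition dotn x xi : R := \sum_(i < n) (tnth x i : R) * tnth xi i.

Definition enorm x : R := Num.sqrt (dotn x x).

(* Real and imaginary parts of the integral of f(x) e^(-i x.xi) over the ball
   |x| <= N. *)
Definition fourier_re (N : nat) f xi : R :=
  \int[lambda]_(x in [set x | enorm x <= N%:R]) (f x * cos (dotn x xi)).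

Definition fourier_im (N : nat) f xi : R :=
  - \int[lambda]_(x in [set x | enorm x <= N%:R]) (f x * sin (dotn x xi)).

(* A + iB is the Fourier transform of the real function f in L^2, in the sense
   of Plancherel: the L^2 limit of the truncated Fourier integrals. *)
Definition is_fourier f A B : Prop :=
  [/\ f \in Lfun lambda 2%:E,
      A \in Lfun lambda 2%:E /\ B \in Lfun lambda 2%:E,
      Lnorm lambda 2%:E (EFin \o (fourier_re N f \- A)) @[N --> \oo] --> 0%E &
      Lnorm lambda 2%:E (EFin \o (fourier_im N f \- B)) @[N --> \oo] --> 0%E].

(* The real functions of the Bessel potential space H^a(R^n). *)
Definition in_bessel (a : R) f : Prop :=
  exists A B, [/\ is_fourier f A B,
    (fun xi => (1 + enorm xi ^+ 2) `^ (a / 2) * A xi) \in Lfun lambda 2%:E &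
    (fun xi => (1 + enorm xi ^+ 2) `^ (a / 2) * B xi) \in Lfun lambda 2%:E].

(* g = (-Delta)^sigma f (almost everywhere), for f in H^(2 sigma). *)
Definition is_frac_laplacian (sigma : R) f (g : euclidean R n -> R) : Prop :=
  exists A B, is_fourier f A B /\
    is_fourier g (fun xi => enorm xi `^ (2 * sigma) * A xi)
                 (fun xi => enorm xi `^ (2 * sigma) * B xi).

End fourier.

(* Monotonicity is not strict. Only values on [0, +oo[ matter. *)
Definition modulus_of_continuity (R : realType) (mu : R -> R) : Prop :=
  [/\ forall s, 0 <= s -> 0 <= mu s,
      {within `[0, +oo[, continuous mu},
      forall s t a, 0 <= s -> 0 <= t -> 0 <= a <= 1 ->
        a * mu s + (1 - a) * mu t <= mu (a * s + (1 - a) * t) &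
      forall s t, 0 <= s -> s <= t -> mu s <= mu t].

(* s^k mu^(k)(s) = O(mu(s)) as s -> 0+; the k-th derivative is only required to
   exist near 0. *)
Definition derivative_bound (R : realType) (mu : R -> R) (k : nat) : Prop :=
  (\forall s \near (0 : R)^'+,
     forall j, (j < k)%N -> derivable (derive1n j mu) s 1) /\
  (fun s => s ^+ k * derive1n k mu s) =O_ ((0 : R)^'+) mu.

Section sobolev_solution.
Context (R : realType) (n : nat).

Local Notation lambda := (lebesgue_measure_n R n).

Definition spacetime : set (measurableTypeR R * euclidean R n) :=
  `]0, +oo[%classic `*` setT.

Definition spacetime_measure := (@lebesgue_measure R \x lambda)%E.

Definition Phi (p : R) (mu : R -> R) (s : R) : R := s `^ p * mu s.

(* eta is C^oo on [0, +oo[ with compact support and is 1 near 0; smoothness at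
   the endpoint 0 follows from the latter. *)
Definition time_test (eta : R -> R) : Prop :=
  [/\ forall k t, 0 < t -> derivable (derive1n k eta) t 1,
      exists2 e, 0 < e & forall t, 0 <= t < e -> eta t = 1 &
      exists T, forall t, T <= t -> eta t = 0].

(* The identity
     int int w Lphi dx dt - int w1(x) phi(0, x) dx = int int F phi dx dt
   for phi(t, x) = eta(t) vphi(x), where Lphi is the adjoint operator applied to
   phi. The first integrand is required to be integrable; for vphi in
   H^(2 sigma), 4 sigma > n, w1 in L^1 and F in L^1 the others are, as vphi is
   then essentially bounded. *)
Definition weak_identity (w : R -> euclidean R n -> R) (w1 : euclidean R n -> R)
    (F : R -> euclidean R n -> R) (eta : R -> R) (vphi : euclidean R n -> R)
    (Lphi : R -> euclidean R n -> R) : Prop :=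
  spacetime_measure.-integrable spacetime
    (fun z => (w z.1 z.2 * Lphi z.1 z.2)%:E) /\
  \int[spacetime_measure]_(z in spacetime) (w z.1 z.2 * Lphi z.1 z.2)
    - \int[lambda]_x (w1 x * (eta 0 * vphi x))
  = \int[spacetime_measure]_(z in spacetime)
      (F z.1 z.2 * (eta z.1 * vphi z.2)).

Definition sobolev_solution (sigma p q : R) (mu1 mu2 : R -> R)
    (u1 v1 : euclidean R n -> R) (u v : R -> euclidean R n -> R) : Prop :=
  [/\ measurable_fun spacetime (fun z => u z.1 z.2) /\
      measurable_fun spacetime (fun z => v z.1 z.2),
      spacetime_measure.-integrable spacetime
        (fun z => (Phi p mu1 `|v z.1 z.2|)%:E) /\
      spacetime_measure.-integrable spacetime
        (fun z => (Phi q mu2 `|u z.1 z.2|)%:E),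
      (forall eta vphi psi, time_test eta -> in_bessel (2 * sigma) vphi ->
        is_frac_laplacian sigma vphi psi ->
        weak_identity u u1 (fun t x => Phi p mu1 `|v t x|) eta vphi
          (fun t x => derive1n 2 eta t * vphi x - derive1n 1 eta t * psi x
                      + eta t * psi x)) &
      (forall eta vphi psi, time_test eta -> in_bessel (2 * sigma) vphi ->
        is_frac_laplacian sigma vphi psi ->
        weak_identity v v1 (fun t x => Phi q mu2 `|u t x|) eta vphi
          (fun t x => derive1n 2 eta t * vphi x - derive1n 1 eta t * vphi x
                      + eta t * psi x))].

End sobolev_solution.

(* Main.v *)
(* Since Phi_p(|v|) and Phi_q(|u|) are integrable over all of space-time, the two
   equations can be treated separately. Test each one with eta(t / T_k) phi_k(x),
   where phi_k lives at the spatial scale 2^k, T_k = 4^(k sigma) for the damped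
   equation and T_k = 2^(k sigma) for the strongly damped one. The adjoint
   operator applied to this function is at most C 4^(-k sigma) W_k, for weights
   W_k >= 0 with sum_k W_k bounded and integral at most C T_k 2^(kn); as the data
   have positive mean, int int |w| W_k >= e 4^(k sigma) for large k. Hence, with
   s_k a small multiple of 4^(k sigma) / (T_k 2^(kn)), the part of this integral
   where |w| > s_k is at least half of it, so that
   int int Phi(|w|) W_k >= e' 4^(k sigma) s_k^(p-1) mu(s_k).
   Summing over k, int_0 s^(-1-d) mu(s) ds < oo, where d is the gap p_c - p,
   resp. q_c - q. On the critical curve one gap vanishes only if the other does,
   and two such Dini integrals (one with negative d converges trivially) combine
   by x^a y^(1-a) <= x + y against the assumed divergence.
   The phi_k are differences of two dilates of (1 + |x|^2)^(-b), whose Fourier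
   transform is a Bessel integral; for b = n/2 + m - sigma with m an integer, the
   recurrence and reflection formulas express (-Delta)^sigma of it as a finite
   combination of powers of the same kind. The differences make the weights
   telescope. *)
Require Import Defs.
From HB Require Import structures.
From mathcomp Require Import all_boot all_order all_algebra.
From mathcomp Require Import all_classical all_reals all_analysis.
From mathcomp Require Import measurable_realfun.
From mathcomp Require Import ring lra.

Set Implicit Arguments.
Unset Strict Implicit.
Unset Printing Implicit Defensive.

Import Order.TTheory GRing.Theory Num.Theory.
Import numFieldNormedType.Exports.

Local Open Scope classical_set_scope.
Local Open Scope ring_scope.

(** The weights must have a bounded sum, because all scales are tested against the same integral of
    Phi(|w|). The terms with phi_k and a derivative of eta are harmless: they live on ]T_k / 2,
    T_k], and these intervals are disjoint. The term eta (-Delta)^sigma phi_k is the obstacle: it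
    lives on all of ]0, T_k], where the scales overlap, and being nonlocal it cannot be confined to
    an annulus in space by a choice of support. It is therefore made a difference of two consecutive
    scales. As (-Delta)^sigma of (1 + |x|^2/c)^(-b) is c^(- sigma) times a combination at scale c
    whose coefficients do not depend on c, giving the larger dilate the coefficient 4^sigma produces
    the common factor c^(- sigma). The same coefficient makes phi_k nonnegative and its limit
    4^sigma - 1 positive, as the sign of the source and the mean of the data require. The
    coefficients of the combination have unknown signs; replacing them by absolute values keeps both
    the bound and the telescoping, since each (1 + |x|^2/c)^(-e) with e >= 0 increases with c. *)

Section integral_tools.
Context d (T : measurableType d) (R : realType).
Variable mu : {measure set T -> \bar R}.

Lemma integrable_le (D : set T) (f g : T -> R) : measurable D ->
  measurable_fun D f -> (forall x, D x -> `|f x| <= g x) ->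
  mu.-integrable D (EFin \o g) -> mu.-integrable D (EFin \o f).
Proof.
move=> mD mf fg; apply: le_integrable => //; first exact/measurable_EFinP.
by move=> x Dx /=; rewrite lee_fin (le_trans (fg _ Dx))// ler_norm.
Qed.

Lemma integrable_scale (D : set T) (k : R) (f : T -> R) : measurable D ->
  mu.-integrable D (EFin \o f) -> mu.-integrable D (EFin \o (fun x => k * f x)).
Proof. by move=> mD /(integrableZl mD k). Qed.

Lemma integrable_addr (D : set T) (f g : T -> R) : measurable D ->
  mu.-integrable D (EFin \o f) -> mu.-integrable D (EFin \o g) ->
  mu.-integrable D (EFin \o (fun x => f x + g x)).
Proof. by move=> mD intf intg; have := integrableD mD intf intg. Qed.

End integral_tools.

(** * Translation, reflection and integrals of derivatives on the line *)

Section line.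
Context (R : realType).
Local Notation mu := (@lebesgue_measure R).

(** The pushforward under the translation agrees with Lebesgue measure on half-open intervals, which
    determine it. *)
Lemma ge0_integral_shift (a : R) (f : R -> \bar R) :
  measurable_fun [set: measurableTypeR R] f -> (forall x, 0 <= f x)%E ->
  (\int[mu]_x f (x + a)%R = \int[mu]_x f x)%E.
Proof.
move=> mf f0.
pose S : measurableTypeR R -> measurableTypeR R := fun x : R => x + a.
have mS : measurable_fun setT S.
  by apply: continuous_measurable_fun => x; apply: cvgD => //; exact: cvg_cst.
have -> : (\int[mu]_x f x = \int[pushforward mu S]_x f x)%E.
  apply: eq_measure_integral => A mA _; apply: lebesgue_measure_unique => //= _ [[b c]] _ <-.
  rewrite /pushforward/=.
  rewrite (_ : _ @^-1` _ = `]b - a, c - a]%classic); last first.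
    by apply/seteqP; split=> x /=; rewrite !in_itv/= ltrBlDr lerBrDr.
  by rewrite !lebesgue_measure_itv/= !lte_fin ltrD2r -!EFinB; case: ifP => // _; congr EFin; ring.
by rewrite ge0_integral_pushforward.
Qed.

Lemma ge0_integral_opp (f : R -> \bar R) :
  measurable_fun [set: measurableTypeR R] f -> (forall x, 0 <= f x)%E ->
  (\int[mu]_x f (- x)%R = \int[mu]_x f x)%E.
Proof.
move=> mf f0.
have -> : (\int[mu]_x f x =
   \int[pushforward mu (-%R : measurableTypeR R -> measurableTypeR R)]_x f x)%E.
  by apply: eq_measure_integral => A mA _; exact/esym/lebesgue_measureN.
by rewrite ge0_integral_pushforward.
Qed.

(** The fundamental theorem of calculus on [-n, n], then dominated convergence. Plays the part of
    integration by parts, both for the Gaussian Fourier integral and for the Bessel recurrence. *)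
Lemma Rintegral_derive_eq0 (F f : R -> R) :
  (forall x : R, is_derive x 1 F (f x)) -> continuous f ->
  mu.-integrable setT (EFin \o f) ->
  F x @[x --> +oo] --> 0 -> F x @[x --> -oo] --> 0 ->
  \int[mu]_x f x = 0.
Proof.
move=> dF cf intf Fy FNy.
have mf : measurable_fun setT f by exact: continuous_measurable_fun.
pose fn (n : nat) := (EFin \o f) \_ `[- n%:R, n%:R].
have [] := @dominated_convergence _ _ _ mu setT measurableT fn (EFin \o f)
  (abse \o (EFin \o f)).
- move=> n; apply/(measurable_restrictT (EFin \o f)) => //.
  by apply: measurable_funTS; exact/measurable_EFinP.
- exact/measurable_EFinP.
- apply: aeW => x _; apply: cvg_near_cst; near=> n.
  rewrite /fn patchE mem_set//= in_itv/= -ler_norml.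
  near: n; exact: nbhs_infty_ger.
- exact: integrable_abse.
- apply: aeW => x n _; rewrite /fn patchE; case: ifP => //= _.
  by rewrite normr0 lee_fin.
move=> _ _ h.
have : (fun n => (F n%:R - F (- n%:R))%:E) @ \oo --> (\int[mu]_x (f x)%:E)%E.
  apply: cvg_trans h; apply: near_eq_cvg; near=> n.
  rewrite /= /fn -integral_mkcond (@continuous_FTC2 _ f F)//.
  - rewrite -subr_gt0 opprK -mulr2n pmulrn_lgt0// ltr0n; near: n; exact: nbhs_infty_gt.
  - exact: continuous_subspaceT.
  - have cF x : {for x, continuous F}.
      by apply/differentiable_continuous/derivable1_diffP; case: (dF x).
    split => [x _||]; first by case: (dF x).
    + by apply: cvg_at_right_filter; exact: cF.
    + by apply: cvg_at_left_filter; exact: cF.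
  - by move=> x _; rewrite derive1E; exact: derive_val.
have : (fun n => (F n%:R - F (- n%:R))%:E) @ \oo --> 0%:E.
  apply: cvg_EFin; first exact: nearW.
  rewrite -[X in _ --> X]subr0; apply: cvgB.
    by move/cvg_pinftyP : Fy; apply; exact: cvgr_idn.
  by move/cvg_ninftyP : FNy; apply; exact/cvgNrNy/cvgr_idn.
by move=> /(cvg_unique _) h1 /h1; rewrite /Rintegral => <-.
Unshelve. all: by end_near. Qed.

End line.

(** * Gaussian integrals *)

Lemma is_derive_Rintegral (R : realType) d (Y : measurableType d)
    (mu : {measure set Y -> \bar R}) (f df : R -> Y -> R) (G : Y -> R) :
  (forall x, mu.-integrable setT (EFin \o f x)) ->
  (forall (x : R) y, is_derive x 1 (f ^~ y) (df x y)) ->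
  mu.-integrable setT (EFin \o G) ->
  (forall x y, `|df x y| <= G y) ->
  forall x : R, is_derive x 1 (fun x => \int[mu]_y f x y) (\int[mu]_y df x y).
Proof.
move=> intf dff intG fG x.
have pE a y : partial1of2 f a y = df a y.
  by rewrite /partial1of2 derive1E; exact: derive_val.
have Ix : x \in `]x - 1, x + 1[ by rewrite in_itv/=; apply/andP; split; lra.
have G0 y : 0 <= G y by rewrite (le_trans _ (fG 0 y)).
have h1 := @derivable_under_integral R _ Y mu f setT measurableT x (x - 1) (x + 1) Ix
  (fun x _ => intf x) (fun x y _ _ => @ex_derive _ _ _ _ _ _ _ (dff x y)) G G0 intG.
have h2 := @differentiation_under_integral R _ Y mu f setT measurableT x (x - 1) (x + 1) Ix
  (fun x _ => intf x) (fun x y _ _ => @ex_derive _ _ _ _ _ _ _ (dff x y)) G G0 intG.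
apply: DeriveDef; first by apply: h1 => a y _ _; rewrite pE.
rewrite -derive1E h2; first by apply: eq_Rintegral => y _; rewrite pE.
by move=> a y _ _; rewrite pE.
Qed.

Section gauss.
Context (R : realType).
Local Notation mu := (@lebesgue_measure R).

Lemma continuous_gauss (t y : R) : continuous (fun x : R => expR (- t * (x - y) ^+ 2)).
Proof.
move=> x; apply: continuous_comp; last exact: continuous_expR.
apply: cvgM; first exact: cvg_cst.
apply: (@continuous_comp _ _ _ (fun x => x - y) (fun x => x ^+ 2)).
  by apply: cvgB => //; exact: cvg_cst.
exact: exprn_continuous.
Qed.

Lemma integral_gauss_affine (t y : R) : 0 < t ->
  (\int[mu]_x (expR (- t * (x - y) ^+ 2))%:E = (Num.sqrt (pi / t))%:E)%E.
Proof.
move=> t0; set s : R := Num.sqrt t.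
have s0 : 0 < s by rewrite sqrtr_gt0.
pose F (x : R) : R := s * (x - y).
have dF (x : R) : is_derive x 1 F s.
  by rewrite /F; apply: is_derive_eq; rewrite /GRing.scale/=; ring.
have dFE : derive1 F = cst s by apply/funext => x; rewrite derive1E; exact: derive_val.
have h : (Num.sqrt pi)%:E = (\int[mu]_x (((gauss_fun \o F) * cst s)%R x)%:E)%E.
  rewrite -integralT_gauss -dFE; apply: increasing_ge0_integration_by_substitutionT; rewrite ?dFE.
  - by move=> x1 x2 x12; rewrite /F ltr_pM2l// ltrD2r.
  - exact: cst_continuous.
  - exact: is_cvg_cst.
  - exact: is_cvg_cst.
  - by move=> x; case: (dF x).
  - apply/cvgrNyPle => A; near=> x; rewrite /F -ler_pdivlMl// lerBlDr.
    near: x; by apply: nbhs_ninfty_le; rewrite num_real.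
  - apply/cvgryPge => A; near=> x; rewrite /F -ler_pdivrMl// lerBrDr.
    near: x; by apply: nbhs_pinfty_ge; rewrite num_real.
  - exact: continuous_gauss_fun.
  - exact: gauss_fun_ge0.
have mg : measurable_fun setT (fun x : R => expR (- t * (x - y) ^+ 2)).
  by apply: continuous_measurable_fun; exact: continuous_gauss.
have h2 : (Num.sqrt pi)%:E = (s%:E * \int[mu]_x (expR (- t * (x - y) ^+ 2))%:E)%E.
  rewrite h -ge0_integralZl//.
  - apply: eq_integral => x _; rewrite -EFinM; congr EFin.
    rewrite /gauss_fun/= /F !fctE/= mulrC; congr (_ * expR _).
    by rewrite exprMn sqr_sqrtr ?ltW// mulNr.
  - exact/measurable_EFinP.
  - by rewrite lee_fin ltW.
rewrite sqrtrM ?pi_ge0// sqrtrV ?ltW// -/s EFinM h2 muleC muleA -EFinM mulVf ?gt_eqF//.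
by rewrite mul1e.
Unshelve. all: by end_near. Qed.

Lemma integral_gauss (t : R) : 0 < t ->
  (\int[mu]_x (expR (- t * x ^+ 2))%:E = (Num.sqrt (pi / t))%:E)%E.
Proof.
by move=> t0; rewrite -(integral_gauss_affine 0 t0); apply: eq_integral => x _; rewrite subr0.
Qed.

Lemma continuous_gauss0 (t : R) : continuous (fun x : R => expR (- t * x ^+ 2)).
Proof.
have -> : (fun x : R => expR (- t * x ^+ 2)) = (fun x : R => expR (- t * (x - 0) ^+ 2)).
  by apply/funext => x; rewrite subr0.
exact: continuous_gauss.
Qed.

Lemma measurable_gauss (t : R) :
  measurable_fun [set: measurableTypeR R] (fun x : R => expR (- t * x ^+ 2)).
Proof. by apply: continuous_measurable_fun; exact: continuous_gauss0. Qed.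

Lemma integrable_gauss (t : R) : 0 < t ->
  mu.-integrable setT (EFin \o (fun x => expR (- t * x ^+ 2))).
Proof.
move=> t0; have h := integral_gauss t0.
apply/integrableP; split; first by apply/measurable_EFinP; exact: measurable_gauss.
under eq_integral do rewrite /= ger0_norm ?expR_ge0//.
by rewrite h ltry.
Qed.

(** Half of the exponent pays for the factor |x|, by e^(t x^2 / 2) >= 1 + t x^2 / 2. This supplies
    the dominating function when the Fourier integral is differentiated in the frequency. *)
Lemma normr_gauss_le (t x : R) : 0 < t ->
  `|x| * expR (- t * x ^+ 2) <= (1 + 2 / t) * expR (- (t / 2) * x ^+ 2).
Proof.
move=> t0.
have -> : - t * x ^+ 2 = - (t / 2) * x ^+ 2 - (t / 2) * x ^+ 2 by field.
rewrite expRD mulrA mulrAC ler_pM2r ?expR_gt0//.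
rewrite expRN ler_pdivrMr ?expR_gt0//.
have h : 1 + t / 2 * x ^+ 2 <= expR (t / 2 * x ^+ 2) by exact: expR_ge1Dx.
apply: (@le_trans _ _ ((1 + 2 / t) * (1 + t / 2 * x ^+ 2))); last first.
  by rewrite ler_pM2l// addr_gt0// divr_gt0.
have -> : (1 + 2 / t) * (1 + t / 2 * x ^+ 2) = 1 + x ^+ 2 + (2 / t + t / 2 * x ^+ 2).
  by field; rewrite gt_eqF.
have : `|x| <= 1 + x ^+ 2.
  by rewrite -(real_normK (num_real x)); have := sqr_ge0 (`|x| - 2^-1); nra.
have : 0 <= 2 / t + t / 2 * x ^+ 2.
  have t0' := ltW t0; apply: addr_ge0; first exact: divr_ge0.
  by apply: mulr_ge0; [exact: divr_ge0|exact: sqr_ge0].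
lra.
Qed.

Lemma cvg_gauss_pinfty (t : R) : 0 < t -> expR (- t * x ^+ 2) @[x --> +oo] --> (0 : R).
Proof.
move=> t0.
have -> : (fun x : R => expR (- t * x ^+ 2)) = (fun u => expR (- u)) \o (fun x => t * x ^+ 2).
  by apply/funext => x /=; rewrite mulNr.
apply: (cvg_comp (fun x : R => t * x ^+ 2) (fun u => expR (- u))); last exact: cvgr_expR.
apply: gt0_cvgMry => //; exact: cvgr_expr2.
Qed.

Lemma cvg_gauss_ninfty (t : R) : 0 < t -> expR (- t * x ^+ 2) @[x --> -oo] --> (0 : R).
Proof.
move=> t0; apply/cvgNy_compNP.
rewrite [X in X x @[x --> _]](_ : _ = fun x : R => expR (- t * x ^+ 2)).
  exact: cvg_gauss_pinfty.
by apply/funext => x /=; rewrite sqrrN.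
Qed.

Lemma cvg_mul_bounded (F : set_system R) {FF : Filter F} (f g : R -> R) :
  (forall x, `|g x| <= 1) -> f x @[x --> F] --> 0 -> f x * g x @[x --> F] --> 0.
Proof.
move=> g1 /cvgr0Pnorm_lt f0; apply/cvgr0Pnorm_lt => e e0.
have := f0 e e0; apply: filterS => x; apply: le_lt_trans.
by rewrite normrM ler_piMr.
Qed.

Lemma integrable_gauss_cos (t xi th : R) : 0 < t ->
  mu.-integrable setT (EFin \o (fun x : R => expR (- t * x ^+ 2) * cos (xi * x + th))).
Proof.
move=> t0; apply: (integrable_le _ _ _ (integrable_gauss t0)) => //.
  apply: measurable_funM; apply: continuous_measurable_fun.
    exact: continuous_gauss0.
  move=> x; apply: continuous_comp; last exact: continuous_cos.
  by apply: cvgD; [apply: cvgM; [exact: cvg_cst|exact: cvg_id]|exact: cvg_cst].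
move=> x _; rewrite normrM ger0_norm ?expR_ge0// ler_piMr ?expR_ge0//.
by rewrite ler_norml cos_geN1 cos_le1.
Qed.

(** As a function J of the frequency the integral satisfies J' = - xi / (2 t) J, so that J e^(xi^2 /
    (4 t)) is constant. The phase [th] treats cosine and sine at once, and in dimension n it carries
    the contribution of the other coordinates. *)
Lemma Rintegral_gauss_cos (t xi th : R) : 0 < t ->
  \int[mu]_x (expR (- t * x ^+ 2) * cos (xi * x + th)) =
  Num.sqrt (pi / t) * expR (- xi ^+ 2 / (4 * t)) * cos th.
Proof.
move=> t0.
have mgauss := continuous_gauss0.
have caff (z c : R) : continuous (fun x : R => z * x + c).
  by move=> x; apply: cvgD; [apply: cvgM; [exact: cvg_cst|exact: cvg_id]|exact: cvg_cst].
have ccos (z : R) : continuous (fun x : R => cos (z * x + th)).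
  by move=> x; apply: continuous_comp; [exact: caff|exact: continuous_cos].
have csin (z : R) : continuous (fun x : R => sin (z * x + th)).
  by move=> x; apply: continuous_comp; [exact: caff|exact: continuous_sin].
have intx : mu.-integrable setT (EFin \o (fun x : R => `|x| * expR (- t * x ^+ 2))).
  apply: (@integrable_le _ (measurableTypeR R) _ mu setT _
    (fun x : R => (1 + 2 / t) * expR (- (t / 2) * x ^+ 2))) => //.
  - apply: measurable_funM; first exact: normr_measurable.
    exact: continuous_measurable_fun.
  - by move=> x _; rewrite ger0_norm ?normr_gauss_le// mulr_ge0// expR_ge0.
  - apply: integrable_scale => //.
    by apply: integrable_gauss; rewrite divr_gt0.
pose J (z : R) : R := \int[mu]_x (expR (- t * x ^+ 2) * cos (z * x + th)).
pose DJ (z : R) : R := \int[mu]_x (- (x * expR (- t * x ^+ 2) * sin (z * x + th))).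
have intJ (z : R) := integrable_gauss_cos z th t0.
have bDJ (z x : R) :
    `|- (x * expR (- t * x ^+ 2) * sin (z * x + th))| <= `|x| * expR (- t * x ^+ 2).
  rewrite normrN !normrM (ger0_norm (expR_ge0 _)); apply: ler_piMr.
    by rewrite mulr_ge0// expR_ge0.
  by rewrite ler_norml sin_geN1 sin_le1.
have mDJ (z : R) : measurable_fun [set: measurableTypeR R]
    (fun x : R => - (x * expR (- t * x ^+ 2) * sin (z * x + th))).
  apply: measurableT_comp => //; apply: measurable_funM; last exact: continuous_measurable_fun.
  by apply: measurable_funM => //; exact: continuous_measurable_fun.
have intDJ (z : R) : mu.-integrable setT
    (EFin \o (fun x : R => - (x * expR (- t * x ^+ 2) * sin (z * x + th)))).
  exact: (integrable_le measurableT (mDJ z) (fun x _ => bDJ z x) intx).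
have dJ (z : R) : is_derive z 1 J (DJ z).
  apply: (is_derive_Rintegral intJ _ intx bDJ) => {}z x.
  by apply: is_derive_eq; rewrite /GRing.scale/=; ring.
have DJE (z : R) : DJ z = - (z / (2 * t)) * J z.
  have sinb (x : R) : `|sin (z * x + th)| <= 1 by rewrite ler_norml sin_geN1 sin_le1.
  (* The integrand is the derivative of e^(-t x^2) sin(z x + th). *)
  have h0 : \int[mu]_x (2 * t * (- (x * expR (- t * x ^+ 2) * sin (z * x + th))) +
      z * (expR (- t * x ^+ 2) * cos (z * x + th))) = 0.

    apply: (@Rintegral_derive_eq0 R (fun x : R => expR (- t * x ^+ 2) * sin (z * x + th))).
    - by move=> x; apply: is_derive_eq; rewrite /GRing.scale/=; ring.
    - move=> x; apply: cvgD; apply: cvgM; try exact: cvg_cst.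
        apply: cvgN; apply: cvgM; last exact: csin.
        by apply: cvgM; [exact: cvg_id|exact: mgauss].
      by apply: cvgM; [exact: mgauss|exact: ccos].
    - by apply: integrable_addr => //; exact: integrable_scale.
    - exact: (cvg_mul_bounded sinb (cvg_gauss_pinfty t0)).
    - exact: (cvg_mul_bounded sinb (cvg_gauss_ninfty t0)).
  move: h0; rewrite RintegralD//; last 2 first.
    exact: integrable_scale.
    exact: integrable_scale.
  rewrite !RintegralZl// -/(DJ z) -/(J z) => h.
  have -> : DJ z = (2 * t * DJ z) / (2 * t) by field; rewrite gt_eqF.
  have -> : 2 * t * DJ z = - (z * J z) by move: h; lra.
  by field; rewrite gt_eqF.
pose H (z : R) : R := J z * expR (z ^+ 2 / (4 * t)).
have dH (z : R) : is_derive z 1 H 0.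
  apply: is_derive_eq; rewrite DJE /GRing.scale/=; field.
  by rewrite gt_eqF.
have HE : H xi = H 0 by exact: is_derive_0_is_cst.
have J0 : J 0 = Num.sqrt (pi / t) * cos th.
  rewrite /J; under eq_Rintegral do rewrite mul0r add0r.
  rewrite RintegralZr//; last exact: integrable_gauss.
  by rewrite /Rintegral integral_gauss.
rewrite -/(J xi); have -> : J xi = H xi * expR (- xi ^+ 2 / (4 * t)).
  by rewrite /H -mulrA -expRD mulNr subrr expR0 mulr1.
by rewrite HE /H J0 expr0n/= mul0r expR0 mulr1; ring.
Qed.

End gauss.

(** * Iterated integrals and Gaussians on R^n *)

Section euclidean.
Context (R : realType).
Local Notation mu := (@lebesgue_measure R).
Local Notation lambda n := (lebesgue_measure_n R n).

Lemma ge0_integral_cons n (f : euclidean R n.+1 -> \bar R) :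
  measurable_fun setT f -> (forall x, 0 <= f x)%E ->
  (\int[lambda n.+1]_x f x = \int[lambda n]_y \int[mu]_x f (cons_pair (x, y)))%E.
Proof.
move=> mf f0; rewrite /= /cons_measure ge0_integral_pushforward//; last first.
  exact: measurable_cons_pair.
rewrite preimage_setT fubini_tonelli2//; last by move=> x; exact: f0.
exact: measurableT_comp mf (@measurable_cons_pair R n).
Qed.

Lemma integral_cons n (f : euclidean R n.+1 -> \bar R) :
  (lambda n.+1).-integrable setT f ->
  (\int[lambda n.+1]_x f x = \int[lambda n]_y \int[mu]_x f (cons_pair (x, y)))%E.
Proof.
move=> intf; have mf := measurable_int _ intf.
have intf' : (mu \x lambda n)%E.-integrable setT (f \o @cons_pair R n).
  apply/integrableP; split.
    exact: measurableT_comp mf (@measurable_cons_pair R n).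
  move/integrableP : intf => [_]; rewrite /= /cons_measure ge0_integral_pushforward//.
    exact: measurable_cons_pair.
  exact: measurableT_comp.
rewrite /= /cons_measure integral_pushforward//; last exact: measurable_cons_pair.
by rewrite preimage_setT -(integral21_prod_meas1 intf').
Qed.

Lemma dotn_cons n (x x' : R) (y y' : euclidean R n) :
  dotn (cons_pair (x, y)) (cons_pair (x', y')) = x * x' + dotn y y'.
Proof.
rewrite /dotn big_ord_recl; congr (_ * _ + _).
by apply: eq_bigr => i _; rewrite /cons_pair/= !tnthS.
Qed.

Lemma cons_pair_surj n (xi : euclidean R n.+1) :
  xi = cons_pair (thead xi, [tuple of behead xi]).
Proof. by rewrite {1}(tuple_eta xi); apply: val_inj. Qed.

Lemma dotnC n (x y : euclidean R n) : dotn x y = dotn y x.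
Proof. by apply: eq_bigr => i _; rewrite mulrC. Qed.

Lemma dotn_ge0 n (x : euclidean R n) : 0 <= dotn x x.
Proof. by apply: sumr_ge0 => i _; rewrite -expr2 sqr_ge0. Qed.

Lemma enorm_sqr n (x : euclidean R n) : enorm x ^+ 2 = dotn x x.
Proof. by rewrite sqr_sqrtr// dotn_ge0. Qed.

Definition vsub n (x y : euclidean R n) : euclidean R n :=
  [tuple (tnth x i - tnth y i : R) | i < n].

Lemma dotn_vsubl n (x y z : euclidean R n) : dotn (vsub x y) z = dotn x z - dotn y z.
Proof.
by rewrite /dotn -sumrB; apply: eq_bigr => i _; rewrite tnth_mktuple mulrBl.
Qed.

Lemma measurable_dotn n d (T : measurableType d) (D : set T) (f g : T -> euclidean R n) :
  measurable_fun D f -> measurable_fun D g ->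
  measurable_fun D (fun z => dotn (f z) (g z) : measurableTypeR R).
Proof.
move=> mf mg; apply: measurable_sum => i; apply: measurable_funM.
  exact: (measurableT_comp (measurable_tnth i) mf).
exact: (measurableT_comp (measurable_tnth i) mg).
Qed.

Lemma measurable_gaussn n (t : R) :
  measurable_fun setT (fun x : euclidean R n => expR (- t * dotn x x)).
Proof.
apply: (measurableT_comp (@measurable_expR R)); apply: measurable_funM => //.
exact: measurable_dotn.
Qed.

Lemma integral_gaussn n (t : R) : 0 < t ->
  (\int[lambda n]_x (expR (- t * dotn x x))%:E = (Num.sqrt (pi / t) ^+ n)%:E)%E.
Proof.
move=> t0; elim: n => [|n IHn].
  rewrite /= integral_dirac//; last first.
    by apply/measurable_EFinP; exact: measurable_gaussn.
  by rewrite [X in (X * _)%E]diracT mul1e /dotn big_ord0 mulr0 expR0 expr0.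
rewrite ge0_integral_cons//; first last.
- by apply/measurable_EFinP; exact: measurable_gaussn.
transitivity (\int[lambda n]_y ((Num.sqrt (pi / t))%:E * (expR (- t * dotn y y))%:E))%E.
  apply: eq_integral => y _.
  transitivity (\int[mu]_x ((expR (- t * dotn y y))%:E * (expR (- t * x ^+ 2))%:E))%E.
    apply: eq_integral => x _; rewrite dotn_cons -EFinM -expRD; congr (expR _)%:E.
    by rewrite mulrDr addrC -expr2.
  rewrite ge0_integralZl//; first last.
  - by apply/measurable_EFinP; exact: measurable_gauss.
  by rewrite integral_gauss// muleC.
rewrite ge0_integralZl//; first last.
- by apply/measurable_EFinP; exact: measurable_gaussn.
by rewrite IHn -EFinM exprS.
Qed.

Lemma integrable_gaussn n (t : R) : 0 < t ->
  (lambda n).-integrable setT (EFin \o (fun x => expR (- t * dotn x x))).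
Proof.
move=> t0; apply/integrableP; split; first by apply/measurable_EFinP; exact: measurable_gaussn.
under eq_integral do rewrite /= ger0_norm ?expR_ge0//.
by rewrite integral_gaussn// ltry.
Qed.

Lemma measurable_gaussn_cos n (t : R) (xi : euclidean R n) (th : R) :
  measurable_fun setT (fun x : euclidean R n => expR (- t * dotn x x) * cos (dotn x xi + th)).
Proof.
apply: measurable_funM; first exact: measurable_gaussn.
have mc : measurable_fun [set: R] (@cos R).
  by apply: continuous_measurable_fun; exact: continuous_cos.
apply: (measurableT_comp mc); apply: measurable_funD => //.
by apply: measurable_dotn.
Qed.

Lemma integrable_gaussn_cos n (t : R) (xi : euclidean R n) (th : R) : 0 < t ->
  (lambda n).-integrable setT
    (EFin \o (fun x => expR (- t * dotn x x) * cos (dotn x xi + th))).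
Proof.
move=> t0; refine (integrable_le _ _ _ (integrable_gaussn n t0)) => //.
  exact: measurable_gaussn_cos.
move=> x _; rewrite normrM ger0_norm ?expR_ge0// ler_piMr ?expR_ge0//.
by rewrite ler_norml cos_geN1 cos_le1.
Qed.

(** Induction on the dimension: the first coordinate is integrated while the other ones are absorbed
    in the phase. *)
Lemma Rintegral_gaussn_cos n (t : R) (xi : euclidean R n) (th : R) : 0 < t ->
  \int[lambda n]_x (expR (- t * dotn x x) * cos (dotn x xi + th)) =
  Num.sqrt (pi / t) ^+ n * expR (- dotn xi xi / (4 * t)) * cos th.
Proof.
move=> t0; elim: n xi th => [|n IHn] xi th.
  rewrite /Rintegral /= integral_dirac//; last first.
    by apply/measurable_EFinP; exact: measurable_gaussn_cos.
  by rewrite [X in (X * _)%E]diracT mul1e /dotn !big_ord0 mulr0 add0r oppr0 mul0r expr0 mul1r.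
rewrite /Rintegral integral_cons; last exact: integrable_gaussn_cos.
rewrite (cons_pair_surj xi); set z := thead xi; set zeta := [tuple of behead xi].
set e := Num.sqrt (pi / t) * expR (- z ^+ 2 / (4 * t)).
transitivity (\int[lambda n]_y (e * (expR (- t * dotn y y) * cos (dotn y zeta + th)))).
  congr fine; apply: eq_integral => y _; rewrite /e.
  have cgauss : mu.-integrable setT
      (EFin \o (fun x : R => expR (- t * x ^+ 2) * cos (z * x + (dotn y zeta + th)))).
    exact: integrable_gauss_cos.
  rewrite mulrCA -(Rintegral_gauss_cos _ _ t0) -RintegralZl//.
  rewrite /Rintegral fineK; last by apply: integrable_fin_num => //; exact: integrable_scale.
  apply: eq_integral => x _; rewrite !dotn_cons; congr EFin.
  by rewrite mulrA -expRD; congr (expR _ * cos _); ring.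
rewrite RintegralZl//; last exact: integrable_gaussn_cos.
rewrite IHn dotn_cons /e; set E1 := expR (- z ^+ 2 / _); set E2 := expR (- dotn zeta _ / _).
have -> : expR (- (z * z + dotn zeta zeta) / (4 * t)) = E1 * E2.
  by rewrite -expRD; congr expR; ring.
by rewrite [_ ^+ n.+1]exprS; ring.
Qed.

Lemma dotn_vsub n (x y : euclidean R n) :
  dotn (vsub x y) (vsub x y) = dotn x x + dotn y y - 2 * dotn x y.
Proof.
rewrite dotn_vsubl !(dotnC _ (vsub x y)) !dotn_vsubl (dotnC y x); ring.
Qed.

Lemma measurable_gaussn_shift n (t : R) (y : euclidean R n) : measurable_fun setT
  (fun x : euclidean R n => expR (- t * dotn (vsub x y) (vsub x y))).
Proof.
apply: (measurableT_comp (@measurable_expR R)).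
apply: measurable_funM => //; under eq_fun do rewrite dotn_vsub.
apply: measurable_funB; last by apply: measurable_funM => //; exact: measurable_dotn.
by apply: measurable_funD => //; exact: measurable_dotn.
Qed.

(** One-dimensional translations in each coordinate, by the same induction as for the centred
    Gaussian. Provides the mass of the kernel in [plancherel_le]. *)
Lemma integral_gaussn_shift n (t : R) (y : euclidean R n) : 0 < t ->
  (\int[lambda n]_x (expR (- t * dotn (vsub x y) (vsub x y)))%:E =
   (Num.sqrt (pi / t) ^+ n)%:E)%E.
Proof.
have mg m (z : euclidean R m) : measurable_fun setT
    (fun x : euclidean R m => (expR (- t * dotn (vsub x z) (vsub x z)))%:E).
  by apply/measurable_EFinP; exact: measurable_gaussn_shift.
move=> t0; elim: n y => [|n IHn] y.
  rewrite /= integral_dirac//; last exact: mg.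
  by rewrite [X in (X * _)%E]diracT mul1e /dotn big_ord0 mulr0 expR0 expr0.
rewrite (ge0_integral_cons (mg _ y))// (cons_pair_surj y).
set z := thead y; set zeta : euclidean R n := [tuple of behead y].
transitivity (\int[lambda n]_y ((Num.sqrt (pi / t))%:E *
   (expR (- t * dotn (vsub y zeta) (vsub y zeta)))%:E))%E.
  apply: eq_integral => x' _.
  transitivity (\int[mu]_x ((expR (- t * dotn (vsub x' zeta) (vsub x' zeta)))%:E *
      (expR (- t * (x - z) ^+ 2))%:E))%E.
    apply: eq_integral => x _; rewrite !dotn_vsub !dotn_cons -EFinM -expRD; congr (expR _)%:E.
    ring.
  rewrite ge0_integralZl//; last first.
    by apply/measurable_EFinP; apply: continuous_measurable_fun; exact: continuous_gauss.
  by rewrite integral_gauss_affine// muleC.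
rewrite ge0_integralZl//; last exact: mg.
by rewrite IHn -EFinM exprS.
Qed.

End euclidean.

(** * Fourier transform *)

Section fubini_real.
Context d1 d2 (T1 : measurableType d1) (T2 : measurableType d2) (R : realType).
Variable m1 : {sigma_finite_measure set T1 -> \bar R}.
Variable m2 : {sigma_finite_measure set T2 -> \bar R}.

Lemma integrable_prod (f : T1 -> R) (g : T2 -> R) :
  m1.-integrable setT (EFin \o f) -> m2.-integrable setT (EFin \o g) ->
  (m1 \x m2)%E.-integrable setT (EFin \o (fun z => f z.1 * g z.2)).
Proof.
move=> intf intg.
have mf : measurable_fun setT f by apply/measurable_EFinP; exact: measurable_int intf.
have mg : measurable_fun setT g by apply/measurable_EFinP; exact: measurable_int intg.
apply/integrable12ltyP.
  apply/measurable_EFinP; apply: measurable_funM.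
    exact: measurableT_comp mf measurable_fst.
  exact: measurableT_comp mg measurable_snd.
rewrite /=; have -> : (\int[m1]_x \int[m2]_y `|(f x * g y)%R%:E| =
    (\int[m1]_x `|(f x)%:E|) * (\int[m2]_y `|(g y)%:E|))%E.
  rewrite -ge0_integralZr//; last 2 first.
  - by apply/measurable_EFinP; exact: measurableT_comp.
  - by apply: integral_ge0.
  apply: eq_integral => x _; rewrite -ge0_integralZl//.
    by apply: eq_integral => y _; rewrite /= normrM EFinM.
  by apply/measurable_EFinP; exact: measurableT_comp.
move/integrableP : intf => [_ f1]; move/integrableP : intg => [_ g1].
rewrite lte_mul_pinfty//; first exact: integral_ge0.
by rewrite ge0_fin_numE//; exact: integral_ge0.
Qed.

Lemma integrable_prod_le (h : T1 * T2 -> R) (f : T1 -> R) (g : T2 -> R) :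
  measurable_fun setT h -> (forall z, `|h z| <= f z.1 * g z.2) ->
  m1.-integrable setT (EFin \o f) -> m2.-integrable setT (EFin \o g) ->
  (m1 \x m2)%E.-integrable setT (EFin \o h).
Proof.
move=> mh hfg intf intg.
exact: (integrable_le measurableT mh (fun z _ => hfg z) (integrable_prod intf intg)).
Qed.

Variable h : T1 * T2 -> R.
Hypothesis inth : (m1 \x m2)%E.-integrable setT (EFin \o h).

(** Integrability of every section, not merely of almost every one, makes the inner real integral
    agree with the extended one at each point, so that Fubini's theorem can be stated with real
    integrals. *)
Lemma Rintegral_fubini1 : (forall x, m2.-integrable setT (fun y => (h (x, y))%:E)) ->
  m1.-integrable setT (EFin \o (fun x => \int[m2]_y h (x, y))) /\
  \int[(m1 \x m2)%E]_z h z = \int[m1]_x \int[m2]_y h (x, y).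
Proof.
move=> hx; have hE : EFin \o (fun x => \int[m2]_y h (x, y)) =
    fubini_F m2 (EFin \o h).
  by apply/funext => x; rewrite /= /Rintegral fineK//; exact: integrable_fin_num.
split; first by rewrite hE; exact: integrable_fubini_F inth.
rewrite /Rintegral -(integral12_prod_meas1 inth); congr fine.
by apply: eq_integral => x _; rewrite -[RHS]/((EFin \o (fun x => \int[m2]_y h (x, y))) x) hE.
Qed.

Lemma Rintegral_fubini2 : (forall y, m1.-integrable setT (fun x => (h (x, y))%:E)) ->
  \int[(m1 \x m2)%E]_z h z = \int[m2]_y \int[m1]_x h (x, y).
Proof.
move=> hx; have hE : EFin \o (fun y => \int[m1]_x h (x, y))%R =
    fubini_G m1 (EFin \o h).
  by apply/funext => x; rewrite /= /Rintegral fineK//; exact: integrable_fin_num.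
rewrite /Rintegral -(integral21_prod_meas1 inth); congr fine.
by apply: eq_integral => x _; rewrite -[RHS]/((EFin \o (fun x => \int[m1]_y h (y, x))) x) hE.
Qed.

End fubini_real.

Section plancherel.
Context (R : realType) (n : nat).
Local Notation lambda := (lebesgue_measure_n R n).
Implicit Types (f : euclidean R n -> R).

Definition ftre f (xi : euclidean R n) : R := \int[lambda]_x (f x * cos (dotn x xi)).
Definition ftim f (xi : euclidean R n) : R := - \int[lambda]_x (f x * sin (dotn x xi)).

Lemma measurable_cosR : measurable_fun [set: R] (@cos R).
Proof. by apply: continuous_measurable_fun; exact: continuous_cos. Qed.

Lemma measurable_sinR : measurable_fun [set: R] (@sin R).
Proof. by apply: continuous_measurable_fun; exact: continuous_sin. Qed.

Lemma integrable_mul_trig f (g : R -> R) (xi : euclidean R n) :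
  measurable_fun [set: R] g -> (forall x, `|g x| <= 1) ->
  lambda.-integrable setT (EFin \o f) ->
  lambda.-integrable setT (EFin \o (fun x => f x * g (dotn x xi))).
Proof.
move=> mg g1 intf.
have mf : measurable_fun setT f by apply/measurable_EFinP; exact: measurable_int intf.
refine (integrable_le (g := fun x => `|f x|) _ _ _ _) => //.
- apply: measurable_funM => //; apply: (measurableT_comp mg).
  exact: measurable_dotn.
- by move=> x _; rewrite normrM ler_piMr.
- exact: integrable_norm.
Qed.

(** A Gaussian factor in xi makes the integrand integrable on the product, and Fubini's theorem then
    yields measurability in xi; afterwards the factor is divided out. *)
Lemma measurable_Rintegral_trig f (g : R -> R) :
  measurable_fun [set: R] g -> (forall x, `|g x| <= 1) ->
  lambda.-integrable setT (EFin \o f) ->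
  measurable_fun setT (fun xi : euclidean R n => \int[lambda]_x (f x * g (dotn x xi))).
Proof.
move=> mg g1 intf.
have mf : measurable_fun setT f by apply/measurable_EFinP; exact: measurable_int intf.
pose h (z : euclidean R n * euclidean R n) : R :=
  expR (- 1 * dotn z.1 z.1) * (f z.2 * g (dotn z.2 z.1)).
have inth : (lambda \x lambda)%E.-integrable setT (EFin \o h).
  refine (integrable_le (g := fun z => expR (- 1 * dotn z.1 z.1) * `|f z.2|) _ _ _ _) => //.
  - apply: measurable_funM.
      by apply: (measurableT_comp (@measurable_gaussn R n 1) measurable_fst).
    apply: measurable_funM; first exact: measurableT_comp mf measurable_snd.
    apply: (measurableT_comp mg); apply: measurable_dotn.
      exact: measurable_snd.
    exact: measurable_fst.
  - move=> z _; rewrite normrM ger0_norm ?expR_ge0// ler_pM2l ?expR_gt0//.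
    by rewrite normrM ler_piMr.
  - apply: (@integrable_prod _ _ _ _ R lambda lambda (fun x => expR (- 1 * dotn x x))
      (fun x => `|f x|)); last exact: integrable_norm.
    exact: integrable_gaussn.
have hx xi : lambda.-integrable setT (fun x => (h (xi, x))%:E).
  have := integrable_scale (expR (- 1 * dotn xi xi)) measurableT (integrable_mul_trig xi mg g1 intf).
  by [].
have [intR _] := Rintegral_fubini1 inth hx.
have /measurable_EFinP mR := measurable_int _ intR.
have -> : (fun xi : euclidean R n => \int[lambda]_x (f x * g (dotn x xi))) =
  (fun xi => expR (1 * dotn xi xi) * \int[lambda]_x h (xi, x)).
  apply/funext => xi.
  have -> : \int[lambda]_x h (xi, x) =
      expR (- 1 * dotn xi xi) * \int[lambda]_x (f x * g (dotn x xi)).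
    by rewrite -RintegralZl//; exact: integrable_mul_trig.
  by rewrite mulrA -expRD mulNr subrr expR0 mul1r.
apply: measurable_funM => //.
(* Taken at t = -1, this gives the growing exponential that removes the factor. *)
have := @measurable_gaussn R n (- 1).
by rewrite opprK.
Qed.

Lemma measurable_ftre f : lambda.-integrable setT (EFin \o f) -> measurable_fun setT (ftre f).
Proof.
by apply: measurable_Rintegral_trig; [exact: measurable_cosR|
  move=> x; rewrite ler_norml cos_geN1 cos_le1].
Qed.

Lemma measurable_ftim f : lambda.-integrable setT (EFin \o f) -> measurable_fun setT (ftim f).
Proof.
move=> intf; apply: measurableT_comp => //; apply: measurable_Rintegral_trig => //.
  exact: measurable_sinR.
by move=> x; rewrite ler_norml sin_geN1 sin_le1.
Qed.

Lemma integrable_mul_cos f (xi : euclidean R n) : lambda.-integrable setT (EFin \o f) ->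
  lambda.-integrable setT (EFin \o (fun x => f x * cos (dotn x xi))).
Proof.
apply: integrable_mul_trig => //; first exact: measurable_cosR.
by move=> x; rewrite ler_norml cos_geN1 cos_le1.
Qed.

Lemma integrable_mul_sin f (xi : euclidean R n) : lambda.-integrable setT (EFin \o f) ->
  lambda.-integrable setT (EFin \o (fun x => f x * sin (dotn x xi))).
Proof.
apply: integrable_mul_trig => //; first exact: measurable_sinR.
by move=> x; rewrite ler_norml sin_geN1 sin_le1.
Qed.

Lemma Rintegral_cos_vsub f (x xi : euclidean R n) : lambda.-integrable setT (EFin \o f) ->
  \int[lambda]_y (f y * cos (dotn (vsub x y) xi)) =
  cos (dotn x xi) * ftre f xi - sin (dotn x xi) * ftim f xi.
Proof.
move=> intf; have ic := integrable_mul_cos xi intf; have isn := integrable_mul_sin xi intf.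
rewrite /ftim mulrN opprK -!RintegralZl// -RintegralD//; last 2 first.
- exact: integrable_scale.
- exact: integrable_scale.
by apply: eq_Rintegral => y _; rewrite dotn_vsubl cosB; ring.
Qed.

Lemma measurable_vsub_gauss (t : R) : measurable_fun setT
  (fun z : euclidean R n * euclidean R n => expR (- t * dotn (vsub z.1 z.2) (vsub z.1 z.2))).
Proof.
apply: (measurableT_comp (@measurable_expR R)).
apply: measurable_funM => //; under eq_fun do rewrite dotn_vsub.
apply: measurable_funB; last by apply: measurable_funM => //; exact: measurable_dotn.
by apply: measurable_funD => //; exact: measurable_dotn.
Qed.

Lemma measurable_vsubr (x : euclidean R n) : measurable_fun setT (vsub x).
Proof.
apply/measurable_fun_tnthP => i; rewrite (_ : _ \o _ = fun z => tnth x i - tnth z i).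
  by apply: measurable_funB => //; exact: measurable_tnth.
by apply/funext => z /=; rewrite tnth_mktuple.
Qed.

(** Under the Gaussian damping xi can be integrated first, which leaves the Fourier transform of the
    Gaussian at the point [w z]. *)
Lemma Rintegral_gauss_trig d (T : measurableType d)
    (m : {sigma_finite_measure set T -> \bar R}) (F : T -> R) (w : T -> euclidean R n) (e : R) :
  0 < e -> m.-integrable setT (EFin \o F) -> measurable_fun setT w ->
  (\int[lambda]_xi (expR (- e * dotn xi xi) * \int[m]_z (F z * cos (dotn (w z) xi)))%:E =
  (\int[m]_z (F z * (Num.sqrt (pi / e) ^+ n * expR (- (4 * e)^-1 * dotn (w z) (w z)))))%:E)%E.
Proof.
move=> e0 intF mw.
have mF : measurable_fun setT F by apply/measurable_EFinP; exact: measurable_int intF.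
have mcos (g : T -> R) : measurable_fun setT g -> measurable_fun setT (fun z => cos (g z)).
  exact: measurableT_comp measurable_cosR.
pose H (z : euclidean R n * T) : R :=
  expR (- e * dotn z.1 z.1) * (F z.2 * cos (dotn (w z.2) z.1)).
have inH : (lambda \x m)%E.-integrable setT (EFin \o H).
  apply: (@integrable_prod_le _ _ _ _ R lambda m H
      (fun x => expR (- e * dotn x x)) (fun z => `|F z|)).
  - apply: measurable_funM.
      by apply: (measurableT_comp (@measurable_gaussn R n e) measurable_fst).
    apply: measurable_funM; first exact: measurableT_comp mF measurable_snd.
    apply: (measurableT_comp measurable_cosR); apply: measurable_dotn; last exact: measurable_fst.
    exact: measurableT_comp mw measurable_snd.
  - move=> z; rewrite normrM ger0_norm ?expR_ge0// ler_pM2l ?expR_gt0//.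
    by rewrite normrM ler_piMr// ler_norml cos_geN1 cos_le1.
  - exact: integrable_gaussn.
  - exact: integrable_norm.
have intFc xi : m.-integrable setT (EFin \o (fun z => F z * cos (dotn (w z) xi))).
  refine (integrable_le (g := fun z => `|F z|) _ _ _ _) => //.
  - by apply: measurable_funM => //; apply: mcos; exact: measurable_dotn.
  - by move=> z _; rewrite normrM ler_piMr// ler_norml cos_geN1 cos_le1.
  - exact: integrable_norm.
have [|intS H1] := Rintegral_fubini1 inH.
  by move=> xi; have := integrable_scale (expR (- e * dotn xi xi)) measurableT (intFc xi).
have HE xi : \int[m]_z H (xi, z) =
    expR (- e * dotn xi xi) * \int[m]_z (F z * cos (dotn (w z) xi)).
  by rewrite -RintegralZl.
transitivity ((\int[lambda]_xi \int[m]_z H (xi, z))%:E).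
  rewrite /Rintegral fineK; last exact: integrable_fin_num intS.
  by apply: eq_integral => xi _; rewrite -HE.
have HzE z : (fun xi => H (xi, z)) =
    (fun xi => F z * (expR (- e * dotn xi xi) * cos (dotn xi (w z) + 0))).
  by apply/funext => xi; rewrite /H/= addr0 (dotnC xi (w z)); ring.
rewrite -H1 (Rintegral_fubini2 inH); last first.
  move=> z; rewrite -[X in _.-integrable _ X]/(EFin \o (fun xi => H (xi, z))) HzE.
  by apply: integrable_scale => //; exact: integrable_gaussn_cos.
congr EFin; apply: eq_Rintegral => z _; rewrite HzE.
rewrite RintegralZl//; last exact: integrable_gaussn_cos.
rewrite Rintegral_gaussn_cos// cos0 mulr1; congr (_ * (_ * expR _)).
by rewrite mulrC mulNr mulrN.
Qed.

(** The squared modulus of the transform is the double integral of f(x) f(y) cos((x - y) . xi);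
    integrated against the damping, the cosine becomes a Gaussian in x - y. *)
Lemma integral_gauss_ft_sqr f (e : R) : 0 < e -> lambda.-integrable setT (EFin \o f) ->
  (\int[lambda]_xi (expR (- e * dotn xi xi) * (ftre f xi ^+ 2 + ftim f xi ^+ 2))%:E =
  (\int[lambda]_x (f x * \int[lambda]_y (f y * (Num.sqrt (pi / e) ^+ n *
     expR (- (4 * e)^-1 * dotn (vsub x y) (vsub x y))))))%:E)%E.
Proof.
move=> e0 intf.
have mf : measurable_fun setT f by apply/measurable_EFinP; exact: measurable_int intf.
(* [cc x xi] is the integral of f(y) cos((x - y) . xi) over y, hence bounded by the L^1 norm [M] of
   f. *)
pose cc (x xi : euclidean R n) : R := cos (dotn x xi) * ftre f xi - sin (dotn x xi) * ftim f xi.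
pose M : R := \int[lambda]_y `|f y|.
have ccM x xi : `|cc x xi| <= M.
  rewrite /cc -Rintegral_cos_vsub//; apply: le_trans (le_normr_Rintegral _ _) _ => //.
    apply: (@integrable_le _ _ R lambda setT _ (fun x => `|f x|)) => //.
    - apply: measurable_funM => //; apply: (measurableT_comp measurable_cosR).
      by apply: measurable_dotn => //; exact: measurable_vsubr.
    - by move=> w _; rewrite normrM ler_piMr// ler_norml cos_geN1 cos_le1.
    - exact: integrable_norm.
  apply: le_Rintegral => //.
  - apply: integrable_norm => //.
    apply: (@integrable_le _ _ R lambda setT _ (fun x => `|f x|)) => //.
    + apply: measurable_funM => //; apply: (measurableT_comp measurable_cosR).
      by apply: measurable_dotn => //; exact: measurable_vsubr.
    + by move=> w _; rewrite normrM ler_piMr// ler_norml cos_geN1 cos_le1.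
    + exact: integrable_norm.
  - exact: integrable_norm.
  - by move=> y _; rewrite normrM ler_piMr// ler_norml cos_geN1 cos_le1.
pose H (z : euclidean R n * euclidean R n) : R :=
  expR (- e * dotn z.1 z.1) * (f z.2 * cc z.2 z.1).
have inH : (lambda \x lambda)%E.-integrable setT (EFin \o H).
  apply: (@integrable_prod_le _ _ _ _ R lambda lambda H
      (fun x => expR (- e * dotn x x)) (fun z => M * `|f z|)).
  - apply: measurable_funM.
      by apply: (measurableT_comp (@measurable_gaussn R n e) measurable_fst).
    apply: measurable_funM; first exact: measurableT_comp mf measurable_snd.
    have md : measurable_fun setT (fun z : euclidean R n * euclidean R n => dotn z.2 z.1).
      by apply: measurable_dotn; [exact: measurable_snd|exact: measurable_fst].
    apply: measurable_funB; apply: measurable_funM.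
    + exact: measurableT_comp measurable_cosR md.
    + exact: measurableT_comp (measurable_ftre intf) measurable_fst.
    + exact: measurableT_comp measurable_sinR md.
    + exact: measurableT_comp (measurable_ftim intf) measurable_fst.
  - move=> z; rewrite normrM ger0_norm ?expR_ge0// ler_pM2l ?expR_gt0//.
    by rewrite normrM mulrC ler_wpM2r.
  - exact: integrable_gaussn.
  - by apply: integrable_scale => //; exact: integrable_norm.
have ifc xi := integrable_mul_cos xi intf; have ifs xi := integrable_mul_sin xi intf.
have ifcc xi : lambda.-integrable setT (EFin \o (fun x => f x * cc x xi)).
  rewrite (_ : (fun x => f x * cc x xi) = (fun x => ftre f xi * (f x * cos (dotn x xi)) +
     (- ftim f xi) * (f x * sin (dotn x xi)))).
    by apply: integrable_addr => //; exact: integrable_scale.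
  by apply/funext => x; rewrite /cc; ring.
have HE xi : \int[lambda]_x H (xi, x) =
    expR (- e * dotn xi xi) * (ftre f xi ^+ 2 + ftim f xi ^+ 2).
  rewrite /H/= RintegralZl//; congr (_ * _).
  transitivity (\int[lambda]_x (ftre f xi * (f x * cos (dotn x xi)) +
     (- ftim f xi) * (f x * sin (dotn x xi)))).
    by apply: eq_Rintegral => x _; rewrite /cc; ring.
  rewrite RintegralD//; try exact: integrable_scale.
  by rewrite !RintegralZl// -/(ftre f xi) -[X in - _ * X]opprK -/(ftim f xi); ring.
have [|intS H1] := Rintegral_fubini1 inH.
  by move=> xi; have := integrable_scale (expR (- e * dotn xi xi)) measurableT (ifcc xi).
transitivity ((\int[lambda]_xi \int[lambda]_z H (xi, z))%:E).
  rewrite /Rintegral fineK; last exact: integrable_fin_num intS.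
  by apply: eq_integral => xi _; rewrite -HE.
have HzE x : (fun xi => H (xi, x)) = (fun xi => f x * (expR (- e * dotn xi xi) * cc x xi)).
  by apply/funext => xi; rewrite /H/=; ring.
have igcc x : lambda.-integrable setT (EFin \o (fun xi => expR (- e * dotn xi xi) * cc x xi)).
  apply: (@integrable_le _ _ R lambda setT _ (fun xi => M * expR (- e * dotn xi xi))) => //.
  - apply: measurable_funM; first exact: measurable_gaussn.
    apply: measurable_funB; apply: measurable_funM.
    + by apply: (measurableT_comp measurable_cosR); exact: measurable_dotn.
    + exact: measurable_ftre.
    + by apply: (measurableT_comp measurable_sinR); exact: measurable_dotn.
    + exact: measurable_ftim.
  - by move=> xi _; rewrite normrM ger0_norm ?expR_ge0// mulrC ler_pM2r ?expR_gt0.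
  - by apply: integrable_scale => //; exact: integrable_gaussn.
rewrite -H1 (Rintegral_fubini2 inH); last first.
  move=> z; rewrite -[X in _.-integrable _ X]/(EFin \o (fun xi => H (xi, z))) HzE.
  by apply: integrable_scale.
congr EFin; apply: eq_Rintegral => x _; rewrite HzE RintegralZl//; congr (_ * _).
apply: EFin_inj; rewrite -Rintegral_gauss_trig//; last exact: measurable_vsubr.
rewrite /Rintegral fineK; last exact: (integrable_fin_num _ (igcc x)).
apply: eq_integral => xi _; congr (_ * _)%:E.
exact/esym/(Rintegral_cos_vsub x xi intf).
Qed.

(* Gaussian damping turns the left-hand side into the integral of f(x) f(y) K(x - y), with
   K >= 0 of integral (2 pi)^n. Bound f(x) f(y) by (f(x)^2 + f(y)^2) / 2 and remove the damping
   by monotone convergence. *)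
Lemma plancherel_le f : lambda.-integrable setT (EFin \o f) ->
  (\int[lambda]_xi (ftre f xi ^+ 2 + ftim f xi ^+ 2)%:E <=
   ((2 * pi) ^+ n)%:E * \int[lambda]_x (f x ^+ 2)%:E)%E.
Proof.
move=> intf.
have mf : measurable_fun setT f by apply/measurable_EFinP; exact: measurable_int intf.
have mS : measurable_fun setT (fun xi => ftre f xi ^+ 2 + ftim f xi ^+ 2).
  by apply: measurable_funD; apply: measurable_funX; [exact: measurable_ftre|exact: measurable_ftim].
have S0 xi : 0 <= ftre f xi ^+ 2 + ftim f xi ^+ 2 by rewrite addr_ge0 ?sqr_ge0.
have step (e : R) : 0 < e ->
  (\int[lambda]_xi (expR (- e * dotn xi xi) * (ftre f xi ^+ 2 + ftim f xi ^+ 2))%:E <=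
   ((2 * pi) ^+ n)%:E * \int[lambda]_x (f x ^+ 2)%:E)%E.
  move=> e0; rewrite integral_gauss_ft_sqr//.
  have e40 : 0 < (4 * e)^-1 by rewrite invr_gt0 mulr_gt0.
  pose K (z : euclidean R n * euclidean R n) : R := Num.sqrt (pi / e) ^+ n *
     expR (- (4 * e)^-1 * dotn (vsub z.1 z.2) (vsub z.1 z.2)).
  have K0 z : 0 <= K z by rewrite mulr_ge0 ?expR_ge0// exprn_ge0// sqrtr_ge0.
  have mK : measurable_fun setT K by apply: measurable_funM => //; exact: measurable_vsub_gauss.
  have mfK (i : euclidean R n * euclidean R n -> euclidean R n) : measurable_fun setT i ->
      measurable_fun setT (fun z => (f (i z) ^+ 2 / 2 * K z)%:E).
    move=> mi; apply/measurable_EFinP; apply: measurable_funM => //; apply: measurable_funM => //.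
    by apply: measurable_funX; exact: measurableT_comp mf mi.
  have fK0 (i : euclidean R n * euclidean R n -> euclidean R n) z :
      (0 <= (f (i z) ^+ 2 / 2 * K z)%:E)%E.
    by rewrite lee_fin mulr_ge0// divr_ge0// sqr_ge0.
  have intK x : (\int[lambda]_y (K (x, y))%:E = ((2 * pi) ^+ n)%:E)%E.
    transitivity (\int[lambda]_y ((Num.sqrt (pi / e) ^+ n)%:E *
        (expR (- (4 * e)^-1 * dotn (vsub y x) (vsub y x)))%:E))%E.
      by apply: eq_integral => y _; rewrite -EFinM /K/= !dotn_vsub (dotnC x y);
        congr (_ * expR _)%:E; ring.
    rewrite ge0_integralZl//; last first.
      by apply/measurable_EFinP; exact: measurable_gaussn_shift.
    rewrite integral_gaussn_shift// -EFinM -exprMn; congr ((_ ^+ n)%:E).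
    rewrite -sqrtrM ?divr_ge0 ?pi_ge0 ?ltW// invrK.
    rewrite (_ : pi / e * (pi * (4 * e)) = (2 * pi) ^+ 2); last by field; rewrite gt_eqF.
    by rewrite sqrtr_sqr ger0_norm// mulr_ge0 ?pi_ge0.
  have KC z w : K (z, w) = K (w, z).
    by rewrite /K/= !dotn_vsub (dotnC z w); congr (_ * expR (_ * _)); ring.
  have half : (\int[lambda]_x \int[lambda]_y (f x ^+ 2 / 2 * K (x, y))%:E =
      ((2 * pi) ^+ n)%:E * \int[lambda]_x (f x ^+ 2 / 2)%:E)%E.
    rewrite -ge0_integralZl//;
      try (by rewrite lee_fin exprn_ge0// mulr_ge0// pi_ge0);
      try (by move=> x _; rewrite lee_fin divr_ge0// sqr_ge0);
      try (by apply/measurable_EFinP; apply: measurable_funM => //; exact: measurable_funX).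
    apply: eq_integral => x _; rewrite -(intK x) muleC -ge0_integralZl//;
      try (by move=> y _; rewrite lee_fin);
      try (by rewrite lee_fin divr_ge0// sqr_ge0).
    by apply/measurable_EFinP; exact: measurableT_comp mK (pair1_measurable x).
  pose J (z : euclidean R n * euclidean R n) : R := f z.1 * f z.2 * K z.
  have mJ : measurable_fun setT J.
    apply: measurable_funM => //; apply: measurable_funM.
      exact: measurableT_comp mf measurable_fst.
    exact: measurableT_comp mf measurable_snd.
  pose C : R := Num.sqrt (pi / e) ^+ n.
  have C0 : 0 <= C by rewrite exprn_ge0// sqrtr_ge0.
  have KleC z : K z <= C.
    rewrite /K ler_piMr// -[leRHS]expR0 ler_expR mulNr oppr_le0.
    by apply: mulr_ge0; [exact: ltW|exact: dotn_ge0].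
  have inJ : (lambda \x lambda)%E.-integrable setT (EFin \o J).
    apply: (@integrable_prod_le _ _ _ _ R lambda lambda J
      (fun x => C * `|f x|) (fun z => `|f z|)) => //.
    - move=> z; rewrite /J normrM (ger0_norm (K0 z)) normrM -[leRHS]mulrA [leLHS]mulrC.
      by rewrite ler_wpM2r.
    - by apply: integrable_scale => //; exact: integrable_norm.
    - exact: integrable_norm.
  have inJx x : lambda.-integrable setT (EFin \o (fun y => f y * K (x, y))).
    apply: (@integrable_le _ _ R lambda setT _ (fun y => C * `|f y|)) => //.
    - by apply: measurable_funM => //; exact: measurableT_comp mK (pair1_measurable x).
    - by move=> y _; rewrite normrM (ger0_norm (K0 _)) mulrC ler_wpM2r.
    - by apply: integrable_scale => //; exact: integrable_norm.
  have [|_ JE] := Rintegral_fubini1 inJ.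
    move=> x; have := integrable_scale (f x) measurableT (inJx x).
    by congr (_.-integrable _ _); apply/funext => y; rewrite /J/= mulrA.
  have -> : \int[lambda]_x (f x * \int[lambda]_y (f y * (Num.sqrt (pi / e) ^+ n *
      expR (- (4 * e)^-1 * dotn (vsub x y) (vsub x y))))) = \int[(lambda \x lambda)%E]_z J z.
    rewrite JE; apply: eq_Rintegral => x _; rewrite -RintegralZl//; last exact: inJx.
    by apply: eq_Rintegral => y _; rewrite /J mulrA.
  have h1 : ((\int[(lambda \x lambda)%E]_z J z)%R%:E <=
      \int[(lambda \x lambda)%E]_z `|(J z)%:E|)%E.
    apply: le_trans (le_abse_integral _ _ _) => //; last exact/measurable_EFinP.
    rewrite /Rintegral; case: (integral _ _ _) => [r| |] /=; rewrite ?lee_fin ?ler_norm// ?leey//.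
  apply: (le_trans h1).
  have h2 : (\int[(lambda \x lambda)%E]_z `|(J z)%:E| <= \int[(lambda \x lambda)%E]_z
      ((f z.1 ^+ 2 / 2 * K z)%:E + (f z.2 ^+ 2 / 2 * K z)%:E))%E.
    apply: ge0_le_integral => //.
    - by apply/measurable_EFinP; exact: measurableT_comp.
    - by apply: emeasurable_funD; [exact: mfK measurable_fst|exact: mfK measurable_snd].
    - move=> z _; rewrite -EFinD lee_fin /J normrM (ger0_norm (K0 z)) -mulrDl ler_wpM2r//.
      rewrite normrM -(real_normK (num_real (f z.1))) -(real_normK (num_real (f z.2))).
      by have := sqr_ge0 (`|f z.1| - `|f z.2|); nra.
  apply: (le_trans h2).
  rewrite ge0_integralD//; [|exact: mfK measurable_fst|exact: mfK measurable_snd].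
  rewrite fubini_tonelli1//; last exact: mfK measurable_fst.
  rewrite fubini_tonelli2//; last exact: mfK measurable_snd.
  rewrite /fubini_F /fubini_G/= half.
  have -> : (\int[lambda]_y \int[lambda]_x (f y ^+ 2 / 2 * K (x, y))%:E =
      ((2 * pi) ^+ n)%:E * \int[lambda]_x (f x ^+ 2 / 2)%:E)%E.
    by rewrite -half; apply: eq_integral => y _; apply: eq_integral => x _; rewrite KC.
  rewrite -ge0_muleDr; try by apply: integral_ge0 => x _; rewrite lee_fin divr_ge0// sqr_ge0.
  rewrite -ge0_integralD//;
    try (by move=> x _; rewrite lee_fin divr_ge0// sqr_ge0);
    try (by apply/measurable_EFinP; apply: measurable_funM => //; exact: measurable_funX).
  rewrite le_eqVlt; apply/orP; left; apply/eqP; congr (_ * _)%E.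
  by apply: eq_integral => x _; rewrite -EFinD -splitr.
pose g (k : nat) xi := (expR (- (k.+1%:R)^-1 * dotn xi xi) * (ftre f xi ^+ 2 + ftim f xi ^+ 2))%:E.
have -> : (\int[lambda]_xi (ftre f xi ^+ 2 + ftim f xi ^+ 2)%:E =
    \int[lambda]_xi limn (g ^~ xi))%E.
  apply: eq_integral => xi _; apply/esym/cvg_lim => //.
  apply: cvg_EFin; first exact: nearW.
  rewrite -[X in _ --> X]mul1r; apply: cvgM; last exact: cvg_cst.
  rewrite -[X in _ --> X](@expR0 R).
  apply: continuous_cvg; first exact: continuous_expR.
  rewrite -[X in _ --> X](mul0r (dotn xi xi)); apply: cvgM; last exact: cvg_cst.
  by rewrite -[X in _ --> X]oppr0; apply: cvgN; exact: cvg_harmonic.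
have mg k : measurable_fun setT (g k).
  by apply/measurable_EFinP; apply: measurable_funM => //; exact: measurable_gaussn.
have g0 k xi : (0 <= g k xi)%E by rewrite lee_fin mulr_ge0// expR_ge0.
have ndg xi k l : (k <= l)%N -> (g k xi <= g l xi)%E.
  move=> kl; rewrite lee_fin ler_wpM2r// ler_expR ler_wpM2r ?dotn_ge0//.
  by rewrite lerN2 lef_pV2 ?posrE// ler_nat.
rewrite monotone_convergence//; last by move=> xi _ k l; exact: ndg.
apply: lime_le; last by apply: nearW => k; exact: step.
apply: ereal_nondecreasing_is_cvgn => k l kl.
by apply: ge0_le_integral => // xi _; exact: ndg.
Qed.

Lemma Lnorm2E (g : euclidean R n -> R) :
  Lnorm lambda 2%:E (EFin \o g) = ((\int[lambda]_x (g x ^+ 2)%:E) `^ 2^-1)%E.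
Proof.
rewrite unlock; congr (_ `^ _)%E; apply: eq_integral => x _.
by rewrite /= powR_mulrn// -normrX ger0_norm// sqr_ge0.
Qed.

Lemma Lfun2P (g : euclidean R n -> R) : measurable_fun setT g ->
  (\int[lambda]_x (g x ^+ 2)%:E < +oo)%E -> g \in Lfun lambda 2%:E.
Proof.
move=> mg gy; rewrite inE; apply/andP; split; rewrite inE//=.
by rewrite /finite_norm Lnorm2E poweR_lty.
Qed.

Lemma Lnorm2_cvg0 (g : nat -> euclidean R n -> R) (a : nat -> \bar R) :
  (forall k, measurable_fun setT (g k)) ->
  (forall k, (\int[lambda]_x (g k x ^+ 2)%:E <= a k)%E) -> a @ \oo --> 0%E ->
  Lnorm lambda 2%:E (EFin \o g k) @[k --> \oo] --> 0%E.
Proof.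
move=> mg ga a0.
have /fine_cvgP[afin fa0] := a0.
apply: (@squeeze_cvge _ _ _ _ (cst 0%E) _ (fun k => (Num.sqrt (fine (a k)))%:E)).
- near=> k; rewrite Lnorm_ge0/= Lnorm2E.
  have ak : a k \is a fin_num by near: k.
  have i0 : (0 <= \int[lambda]_x (g k x ^+ 2)%:E)%E.
    by apply: integral_ge0 => x _; rewrite lee_fin sqr_ge0.
  have a0k : (0 <= a k)%E by exact: le_trans (ga k).
  rewrite -powR12_sqrt ?fine_ge0// -poweR_EFin fineK//.
  apply: gt0_ler_poweR => //; rewrite in_itv/= ?leey ?andbT//.
- exact: cvg_cst.
- apply: cvg_EFin; first exact: nearW.
  rewrite -[X in _ --> X](@sqrtr0 R).
  by apply: continuous_cvg => //; exact: sqrt_continuous.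
Unshelve. all: by end_near. Qed.

Lemma measurable_enorm_ball (N : nat) :
  measurable [set x : euclidean R n | enorm x <= N%:R].
Proof.
rewrite (_ : [set x | _] = (fun x : euclidean R n => dotn x x) @^-1` `]-oo, N%:R ^+ 2]%classic).
  rewrite -[X in measurable X]setTI.
  by apply: (@measurable_dotn R n _ _ setT id id) => //; exact: measurable_itv.
apply/seteqP; split => x /=; rewrite in_itv/= -enorm_sqr.
  by move=> h; rewrite lerXn2r ?nnegrE ?sqrtr_ge0.
by rewrite ler_pXn2r ?nnegrE ?sqrtr_ge0.
Qed.

(** The error of the truncated Fourier integral is, up to sign, the transform of f restricted to the
    complement of the ball. By [plancherel_le] its L^2 norm is at most a constant times that of the
    restriction, which tends to 0. *)
Lemma is_fourier_ft f : lambda.-integrable setT (EFin \o f) ->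
  (\int[lambda]_x (f x ^+ 2)%:E < +oo)%E -> is_fourier f (ftre f) (ftim f).
Proof.
move=> intf f2.
have mf : measurable_fun setT f by apply/measurable_EFinP; exact: measurable_int intf.
pose B N := [set x : euclidean R n | enorm x <= N%:R].
have mB N : measurable (B N) := measurable_enorm_ball N.
pose fo N := f \_ (~` B N).
have mfo N : measurable_fun setT (fo N).
  by apply/(measurable_restrictT f); [exact: measurableC|exact: measurable_funTS].
have intfo N : lambda.-integrable setT (EFin \o fo N).
  rewrite /fo -restrict_EFin; apply/integrable_restrict => //; first exact: measurableC.
  by rewrite setTI; apply: integrableS intf => //; exact: measurableC.
have split (g : euclidean R n -> R) N : lambda.-integrable setT (EFin \o (fun x => f x * g x)) ->
    \int[lambda]_(x in B N) (f x * g x) =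
    \int[lambda]_x (f x * g x) - \int[lambda]_x (fo N x * g x).
  move=> ifg; rewrite -{1}(setUv (B N)) Rintegral_setU//; last 3 first.
  - exact: measurableC.
  - by rewrite setUv.
  - by apply/disj_setPS => x [].
  rewrite (_ : \int[lambda]_(x in ~` B N) (f x * g x) = \int[lambda]_x (fo N x * g x)) ?addrK//.
  rewrite [LHS]Rintegral_mkcond; apply: eq_Rintegral => x _; rewrite /fo !patchE.
  by case: ifP => // _; rewrite mul0r.
pose a N := (((2 * pi) ^+ n)%:E * \int[lambda]_x (fo N x ^+ 2)%:E)%E.
have a0 : a @ \oo --> 0%E.
  rewrite -[X in _ --> X](mule0 ((2 * pi) ^+ n)%:E); apply: cvgeZl => //.
  have [] := @dominated_convergence _ _ _ lambda setT measurableT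
    (fun N x => (fo N x ^+ 2)%:E) (cst 0%E) (fun x => (f x ^+ 2)%:E).
  - by move=> N; apply/measurable_EFinP; exact: measurable_funX.
  - exact: measurable_cst.
  - apply: aeW => x _; apply: cvg_near_cst; near=> N.
    rewrite /fo patchE memNset ?expr0n//= => h; apply: h.
    by rewrite /B/=; near: N; exact: nbhs_infty_ger.
  - apply/integrableP; split; first by apply/measurable_EFinP; exact: measurable_funX.
    by under eq_integral do rewrite /= ger0_norm ?sqr_ge0//.
  - apply: aeW => x N _; rewrite /= ger0_norm ?sqr_ge0// lee_fin /fo patchE.
    by case: ifP => //; rewrite expr0n/= sqr_ge0.
  by rewrite integral_cst// mul0e.
have bound N : (\int[lambda]_xi (ftre (fo N) xi ^+ 2 + ftim (fo N) xi ^+ 2)%:E <= a N)%E.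
  exact: plancherel_le.
have mre g : lambda.-integrable setT (EFin \o g) -> measurable_fun setT (fun xi => (ftre g xi ^+ 2)%:E).
  by move=> ig; apply/measurable_EFinP; apply: measurable_funX; exact: measurable_ftre.
have mim g : lambda.-integrable setT (EFin \o g) -> measurable_fun setT (fun xi => (ftim g xi ^+ 2)%:E).
  by move=> ig; apply/measurable_EFinP; apply: measurable_funX; exact: measurable_ftim.
have ms g : lambda.-integrable setT (EFin \o g) ->
    measurable_fun setT (fun xi => (ftre g xi ^+ 2 + ftim g xi ^+ 2)%:E).
  by move=> ig; apply/measurable_EFinP; apply: measurable_funD; apply/measurable_EFinP;
    [exact: mre|exact: mim].
have lre g : lambda.-integrable setT (EFin \o g) -> (\int[lambda]_xi (ftre g xi ^+ 2)%:E <=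
    \int[lambda]_xi (ftre g xi ^+ 2 + ftim g xi ^+ 2)%:E)%E.
  move=> ig; apply: ge0_le_integral => //.
  - by move=> xi _; rewrite lee_fin sqr_ge0.
  - exact: mre.
  - exact: ms.
  - by move=> xi _; rewrite lee_fin lerDl sqr_ge0.
have lim g : lambda.-integrable setT (EFin \o g) -> (\int[lambda]_xi (ftim g xi ^+ 2)%:E <=
    \int[lambda]_xi (ftre g xi ^+ 2 + ftim g xi ^+ 2)%:E)%E.
  move=> ig; apply: ge0_le_integral => //.
  - by move=> xi _; rewrite lee_fin sqr_ge0.
  - exact: mim.
  - exact: ms.
  - by move=> xi _; rewrite lee_fin lerDr sqr_ge0.
have fin : (\int[lambda]_xi (ftre f xi ^+ 2 + ftim f xi ^+ 2)%:E < +oo)%E.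
  apply: le_lt_trans (plancherel_le intf) _; rewrite lte_mul_pinfty//.
  by rewrite lee_fin exprn_ge0// mulr_ge0// pi_ge0.
have reE N : (fourier_re N f \- ftre f) = (fun xi => - ftre (fo N) xi).
  apply/funext => xi; rewrite /= /fourier_re split; last exact: integrable_mul_cos.
  by rewrite addrAC subrr add0r.
have imE N : (fourier_im N f \- ftim f) = (fun xi => - ftim (fo N) xi).
  apply/funext => xi; rewrite /= /fourier_im split; last exact: integrable_mul_sin.
  by rewrite /ftim; ring.
split.
- exact: Lfun2P.
- split; apply: Lfun2P.
  + exact: measurable_ftre.
  + exact: le_lt_trans (lre _ intf) fin.
  + exact: measurable_ftim.
  + exact: le_lt_trans (lim _ intf) fin.
- apply: (@Lnorm2_cvg0 _ a) => // N; rewrite reE.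
    by apply: measurableT_comp => //; exact: measurable_ftre.
  by under eq_integral do rewrite sqrrN; exact: le_trans (lre _ (intfo N)) (bound N).
- apply: (@Lnorm2_cvg0 _ a) => // N; rewrite imE.
    by apply: measurableT_comp => //; exact: measurable_ftim.
  by under eq_integral do rewrite sqrrN; exact: le_trans (lim _ (intfo N)) (bound N).
Unshelve. all: by end_near. Qed.

End plancherel.

(** * Bessel integrals *)

Section kernel.
Context (R : realType).
Local Notation mu := (@lebesgue_measure R).

(** Over [-k, k] the integral is a difference of two values of [F], hence at most 1; these intervals
    exhaust the line. *)
Lemma integrable_derive_bounded (F f : R -> R) :
  (forall x : R, is_derive x 1 F (f x)) -> continuous f -> (forall x, 0 <= f x) ->
  (forall x, 0 <= F x <= 1) -> mu.-integrable setT (EFin \o f).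
Proof.
move=> dF cf f0 F01.
have mf : measurable_fun [set: measurableTypeR R] f by exact: continuous_measurable_fun.
apply/integrableP; split; first exact/measurable_EFinP.
under eq_integral do rewrite /= ger0_norm//.
pose I (k : nat) : set (measurableTypeR R) := [set` `[- (k%:R : R), k%:R]].
have UE : [set: measurableTypeR R] = \bigcup_n I n.
  apply/esym; rewrite -subTset => x _; exists (Num.Def.truncn `|x : R|).+1 => //=.
  by rewrite /I/= in_itv/= -ler_norml ltW// truncnS_gt.
have cF x : {for x, continuous F}.
  by apply/differentiable_continuous/derivable1_diffP; case: (dF x).
have int_le1 (k : nat) : (\int[mu]_(x in I k) (f x)%:E <= 1)%E.
  have [->|k0] := eqVneq k 0%N.
    rewrite (_ : I 0%N = [set 0]) ?integral_set1//.
    by apply/seteqP; split=> x; rewrite /I/= in_itv/= oppr0; [move/le_anti|move=> ->; rewrite lexx].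
  rewrite /I (@continuous_FTC2 _ f F).
  - have /andP[_ h1] := F01 k%:R; have /andP[h2 _] := F01 (- k%:R).
    by rewrite -EFinB lee_fin; move: h1 h2; lra.
  - by rewrite -subr_gt0 opprK -mulr2n pmulrn_lgt0// ltr0n lt0n.
  - exact: continuous_subspaceT.
  - split => [x _||]; first by case: (dF x).
    + by apply: cvg_at_right_filter; exact: cF.
    + by apply: cvg_at_left_filter; exact: cF.
  - by move=> x _; rewrite derive1E; exact: derive_val.
have h := @ge0_nondecreasing_set_cvg_integral _ (measurableTypeR R) R
  I (EFin \o f) mu.
have cvg_int : (\int[mu]_(x in I k) (f x)%:E)%E @[k --> \oo] -->
    (\int[mu]_x (f x)%:E)%E.
  rewrite UE; apply: h.
  - move=> k l kl; apply/subsetPset => x; rewrite /I/= !in_itv/= -!ler_norml => /le_trans; apply.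
    by rewrite ler_nat.
  - by move=> k; exact: measurable_itv.
  - by move=> k; apply/measurable_EFinP; exact: measurable_funTS.
  - by move=> k x _; rewrite lee_fin.
have -> : (\int[mu]_x (f x)%:E)%E = limn (fun k => \int[mu]_(x in I k) (f x)%:E)%E.
  by apply/esym/cvg_lim.
apply: (@le_lt_trans _ _ 1%E); last exact: ltry.
apply: lime_le; first by apply/cvg_ex; eexists; exact: cvg_int.
exact: nearW.
Qed.

Lemma expR_affine_le (b c : R) : 0 <= b -> 0 < c ->
  exists C, forall y, b * y - c * expR y <= C.
Proof.
(* The tangent line of exp gives 1 + (y - s) <= e^(y - s), where e^(- s) = c / (b + 1). The
   numerator b + 1 instead of b keeps the logarithm meaningful for b = 0. *)
move=> b0 c0; have s0 : 0 < (b + 1) / c by rewrite divr_gt0// ltr_wpDl.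
set s := ln ((b + 1) / c); exists (b * (s - 1)) => y.
have h : 1 + (y - s) <= expR (y - s) by exact: expR_ge1Dx.
have e : expR (y - s) = expR y * c / (b + 1).
  by rewrite expRD expRN lnK ?posrE// invf_div mulrA.
have h2 : b * (1 + (y - s)) <= c * expR y.
  apply: (@le_trans _ _ (b * expR (y - s))); first exact: ler_wpM2l.
  rewrite e mulrA ler_pdivrMr ?ltr_wpDl//.
  have := expR_gt0 y; nra.
lra.
Qed.

Lemma powRE (x r : R) : 0 < x -> x `^ r = expR (r * ln x).
Proof. by move=> x0; rewrite /powR gt_eqF. Qed.

(** The integrand t^a e^(-t - d/t) dt/t of the Macdonald function, in the variable y = ln t. On the
    line its symmetries become translations and reflections. *)
Definition bkern (a d y : R) : R := expR (a * y - expR y - d * expR (- y)).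

Lemma bkern_gt0 a d y : 0 < bkern a d y. Proof. exact: expR_gt0. Qed.

Lemma bkern_bounded (a d : R) : 0 <= d -> 0 < a \/ 0 < d ->
  exists C, forall y, bkern a d y <= C.
Proof.
move=> d0 ad; have [a0|a0] := leP 0 a.
  have [C hC] := expR_affine_le a0 ltr01; exists (expR C) => y.
  rewrite ler_expR; have := hC y; rewrite mul1r.
  by have := mulr_ge0 d0 (expR_ge0 (- y)); lra.
case: ad => [|d1]; first by rewrite ltNge ltW.
have [|C hC] := @expR_affine_le (- a) d _ d1; first by rewrite oppr_ge0 ltW.
exists (expR C) => y; rewrite ler_expR; have := hC (- y); rewrite mulrNN.
by have := expR_ge0 y; lra.
Qed.

Lemma bkernD (a b d y : R) : bkern (a + b) d y = expR (b * y) * bkern a d y.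
Proof. by rewrite /bkern -expRD; congr expR; ring. Qed.

Lemma continuous_bkern (a d : R) : continuous (bkern a d).
Proof.
move=> y; apply: continuous_comp; last exact: continuous_expR.
apply: cvgB; first apply: cvgB.
- by apply: cvgM; [exact: cvg_cst|exact: cvg_id].
- exact: continuous_expR.
- apply: cvgM; first exact: cvg_cst.
  by apply: continuous_comp; [apply: cvgN; exact: cvg_id|exact: continuous_expR].
Qed.

Lemma measurable_bkern (a d : R) : measurable_fun [set: measurableTypeR R] (bkern a d).
Proof. by apply: continuous_measurable_fun; exact: continuous_bkern. Qed.

(** The majorant is the derivative of the logistic function E / (1 + E) with E = [expR (e * y)], so
    its integrability is immediate. As (1 + E)^2 = E (E^-1 + 2 + E), the bound reduces to the
    boundedness of [bkern] at the orders a - e, a and a + e. *)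
Lemma bkern_le_logistic (a d : R) : 0 <= d -> 0 < a \/ 0 < d ->
  exists e C, 0 < e /\ forall y,
    bkern a d y <= C * (e * expR (e * y) / (1 + expR (e * y)) ^+ 2).
Proof.
move=> d0 ad.
(* Boundedness at order a - e requires a - e > 0 or d > 0: take e = a/2 when a > 0, and any e when d
   > 0. *)
have [e [e0 ae]] : exists e, 0 < e /\ (0 < a - e \/ 0 < d).
  case: ad => [a0|d1]; last by exists 1; split => //; right.
  by exists (a / 2); split; [rewrite divr_gt0|left; lra].
have [C1 h1] := bkern_bounded d0 ae.
have [C2 h2] := bkern_bounded d0 ad.
have [|C3 h3] := @bkern_bounded (a + e) d d0.
  by case: ae => h; [left; lra|right].
exists e, ((C1 + 2 * C2 + C3) / e); split => // y.
have E0 : 0 < expR (e * y) := expR_gt0 _.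
rewrite mulrA mulrA divfK ?gt_eqF// ler_pdivlMr; last by rewrite exprn_gt0// addr_gt0.
have -> : bkern a d y * (1 + expR (e * y)) ^+ 2 =
    (bkern (a - e) d y + 2 * bkern a d y + bkern (a + e) d y) * expR (e * y).
  rewrite !bkernD mulNr expRN; field; rewrite gt_eqF//.
by rewrite ler_pM2r//; have := h1 y; have := h2 y; have := h3 y; lra.
Qed.

Lemma integrable_bkern (a d : R) : 0 <= d -> 0 < a \/ 0 < d ->
  mu.-integrable setT (EFin \o bkern a d).
Proof.
move=> d0 ad; have [e [C [e0 h]]] := bkern_le_logistic d0 ad.
have E1 (y : R) : 0 < 1 + expR (e * y) by rewrite addr_gt0 ?expR_gt0.
pose f (y : R) := e * expR (e * y) / (1 + expR (e * y)) ^+ 2.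
apply: (@integrable_le _ _ R mu setT _ (fun y => C * f y)) => //.
- exact: measurable_bkern.
- by move=> y _; rewrite ger0_norm; [exact: h|exact/ltW/bkern_gt0].
apply: integrable_scale => //.
have cexp : continuous (fun y : R => expR (e * y)).
  move=> y; apply: continuous_comp; last exact: continuous_expR.
  by apply: cvgM; [exact: cvg_cst|exact: cvg_id].
apply: (@integrable_derive_bounded (fun y : R => - (1 + expR (e * y))^-1 + 1)).
- move=> y.
  have d1 : is_derive y 1 (fun y : R => 1 + expR (e * y)) (e * expR (e * y)).
    by apply: is_derive_eq; rewrite /GRing.scale/=; ring.
  have d2 := @is_deriveV _ (fun y : R => 1 + expR (e * y)) y _ _ (lt0r_neq0 (E1 y)) d1.
  by apply: is_derive_eq; rewrite /f /GRing.scale/=; field; rewrite gt_eqF.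
- move=> y; apply: cvgM; first by apply: cvgM; [exact: cvg_cst|exact: cexp].
  apply: cvgV; first by rewrite expf_neq0// gt_eqF.
  apply: (@continuous_comp _ _ _ (fun y => 1 + expR (e * y)) (fun x => x ^+ 2)).
    by apply: cvgD; [exact: cvg_cst|exact: cexp].
  exact: exprn_continuous.
- by move=> y; rewrite /f divr_ge0// ?mulr_ge0 ?expR_ge0 ?(ltW e0)// exprn_ge0// ltW.
- move=> y; have : (1 + expR (e * y))^-1 <= 1 by rewrite invf_le1// lerDl expR_ge0.
  have : 0 <= (1 + expR (e * y))^-1 by rewrite invr_ge0 ltW.
  by move=> h1 h2; apply/andP; split; lra.
Qed.

Lemma cvg_expRN (e : R) : 0 < e -> expR (- (e * y)) @[y --> +oo] --> (0 : R).
Proof.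
move=> e0; apply: (cvg_comp (fun y : R => e * y) (fun u => expR (- u))); last exact: cvgr_expR.
by apply: gt0_cvgMry => //; exact: cvg_id.
Qed.

Lemma bkern_cvg_pinfty (a d : R) : 0 < d -> bkern a d y @[y --> +oo] --> (0 : R).
Proof.
move=> d0; have [C hC] := @bkern_bounded (a + 1) d (ltW d0) (or_intror d0).
apply: (@squeeze_cvgr _ _ _ _ (cst 0) (fun y => C * expR (- (1 * y)))).
- apply: nearW => y; rewrite ltW ?bkern_gt0//=.
  by rewrite expRN ler_pdivlMr ?expR_gt0// mulrC -bkernD.
- exact: cvg_cst.
- rewrite -[X in _ --> X](mulr0 C); apply: cvgM; first exact: cvg_cst.
  exact: cvg_expRN.
Qed.

Lemma bkern_cvg_ninfty (a d : R) : 0 < d -> bkern a d y @[y --> -oo] --> (0 : R).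
Proof.
move=> d0; have [C hC] := @bkern_bounded (a - 1) d (ltW d0) (or_intror d0).
apply/cvgNy_compNP.
apply: (@squeeze_cvgr _ _ _ _ (cst 0) (fun y => C * expR (- (1 * y)))).
- apply: nearW => y; rewrite /= ltW ?bkern_gt0//=.
  have := hC (- y); rewrite bkernD mulrNN mul1r expRN => h.
  by rewrite ler_pdivlMr ?expR_gt0// mulrC.
- exact: cvg_cst.
- rewrite -[X in _ --> X](mulr0 C); apply: cvgM; first exact: cvg_cst.
  exact: cvg_expRN.
Qed.

(** For d > 0 this is 2 d^(a/2) K_a(2 sqrt d) with K_a the Macdonald function; for d = 0 and a > 0
    it is Euler's Gamma(a). *)
Definition bessel (a d : R) : R := \int[mu]_y bkern a d y.

Lemma besselE (a d : R) : 0 <= d -> 0 < a \/ 0 < d ->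
  (\int[mu]_y (bkern a d y)%:E)%E = (bessel a d)%:E.
Proof.
move=> d0 ad; rewrite /bessel /Rintegral fineK//.
by apply: integrable_fin_num => //; exact: integrable_bkern.
Qed.

(** A vanishing integral would make the positive function [bkern a d] zero almost everywhere, so the
    whole line would be a null set. *)
Lemma bessel_gt0 (a d : R) : 0 <= d -> 0 < a \/ 0 < d -> 0 < bessel a d.
Proof.
move=> d0 ad; rewrite -lte_fin -besselE//.
rewrite lt0e integral_ge0 ?andbT; last by move=> y _; rewrite lee_fin ltW ?bkern_gt0.
apply/eqP => h0.
have : (\int[mu]_y `|(bkern a d y)%:E|)%E = 0%E.
  by rewrite -[RHS]h0; apply: eq_integral => y _; rewrite gee0_abs// lee_fin ltW ?bkern_gt0.
have mb : measurable_fun [set: measurableTypeR R] (EFin \o bkern a d).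
  by apply/measurable_EFinP; exact: measurable_bkern.
move=> /(ae_eq_integral_abs mu measurableT mb) [N [mN N0 sub]].
have : (mu [set: R] <= mu N)%E.
  apply: le_measure; rewrite ?inE// => y _; apply: sub => /= /(_ I) /eqP.
  by rewrite eqe gt_eqF ?bkern_gt0.
rewrite [mu N]N0 -set_itvNyy lebesgue_measure_itv/=.
by rewrite leye_eq.
Qed.

(** The substitution y -> ln d - y exchanges e^y and d e^(-y). It is the symmetry K_(-a) = K_a. *)
Lemma bessel_opp (a d : R) : 0 < d -> bessel (- a) d = d `^ (- a) * bessel a d.
Proof.
move=> d0; apply: EFin_inj; rewrite EFinM -!besselE ?ltW//; try by right.
have mb b : measurable_fun [set: measurableTypeR R] (EFin \o bkern b d).
  by apply/measurable_EFinP; exact: measurable_bkern.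
have b0 b (y : R) : (0 <= (bkern b d y)%:E)%E by rewrite lee_fin ltW ?bkern_gt0.
have mo : measurable_fun [set: measurableTypeR R] (fun y : R => (bkern (- a) d (- y))%:E).
  apply/measurable_EFinP; apply: continuous_measurable_fun => y.
  apply: (@continuous_comp _ _ _ (@GRing.opp R) (bkern (- a) d)); last exact: continuous_bkern.
  by apply: cvgN; exact: cvg_id.
rewrite -(ge0_integral_opp (mb (- a)) (b0 (- a))).
rewrite -(ge0_integral_shift (- ln d) mo)//.
rewrite -ge0_integralZl//; last 2 first.
- exact: mb.
- by rewrite lee_fin powR_ge0.
apply: eq_integral => y _; rewrite -EFinM; congr EFin.
rewrite (powRE _ d0) /bkern -expRD; congr expR.
have -> : - (y - ln d) = ln d - y by ring.
by rewrite opprB !expRD !expRN !lnK ?posrE//; field; rewrite ?gt_eqF ?expR_gt0.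
Qed.

(** The derivative of [bkern a d] is (a - e^y + d e^(-y)) times [bkern a d], and its integral
    vanishes. *)
Lemma bessel_rec (a d : R) : 0 < d ->
  d * bessel (a - 1) d = bessel (a + 1) d - a * bessel a d.
Proof.
move=> d0.
have ib b := @integrable_bkern b d (ltW d0) (or_intror d0).
have dE : \int[mu]_y (a * bkern a d y + (- bkern (a + 1) d y + d * bkern (a - 1) d y)) = 0.
  apply: (@Rintegral_derive_eq0 R (bkern a d)).
  - move=> y; rewrite !bkernD /bkern; apply: is_derive_eq; rewrite /GRing.scale/=.
    by rewrite mul1r mulN1r; ring.
  - move=> y; apply: cvgD; first by apply: cvgM; [exact: cvg_cst|exact: continuous_bkern].
    apply: cvgD; first by apply: cvgN; exact: continuous_bkern.
    by apply: cvgM; [exact: cvg_cst|exact: continuous_bkern].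
  - apply: integrable_addr => //; first exact: integrable_scale.
    apply: integrable_addr => //; last exact: integrable_scale.
    by have := integrable_scale (- 1) measurableT (ib (a + 1)); congr (_.-integrable _ _);
      apply/funext => y /=; rewrite mulN1r.
  - exact: bkern_cvg_pinfty.
  - exact: bkern_cvg_ninfty.
have iN : mu.-integrable setT (EFin \o (fun y => - bkern (a + 1) d y)).
  have := integrable_scale (- 1) measurableT (ib (a + 1)).
  by congr (_.-integrable _ _); apply/funext => y /=; rewrite mulN1r.
move: dE; rewrite RintegralD//; last 2 first.
- exact: integrable_scale.
- by apply: integrable_addr => //; exact: integrable_scale.
rewrite RintegralD//; last exact: integrable_scale.
rewrite !RintegralZl//.
have -> : \int[mu]_y (- bkern (a + 1) d y) = - bessel (a + 1) d.
  rewrite -[RHS]mulN1r -RintegralZl//.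
  by apply: eq_Rintegral => y _; rewrite mulN1r.
by rewrite -!/(bessel _ _); lra.
Qed.

(* [bessel_rec] absorbs each factor [d], raising the order. *)
Lemma bessel_shift (m : nat) : forall a : R, exists s : seq (R * nat), forall d, 0 < d ->
  d ^+ m * bessel (a - m%:R) d = \sum_(w <- s) w.1 * bessel (a + w.2%:R) d.
Proof.
elim: m => [|m IHm] a.
  by exists [:: (1, 0%N)] => d d0; rewrite big_seq1/= mul1r expr0 mul1r subr0 addr0.
have [s hs] := IHm (a - 1).
exists ([seq (w.1, w.2.+1) | w <- s] ++ [seq (- (a + w.2%:R) * w.1, w.2) | w <- s]) => d d0.
rewrite big_cat !big_map/= -big_split/= exprS -mulrA.
have -> : a - m.+1%:R = a - 1 - m%:R by rewrite -natr1; ring.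
rewrite hs// mulr_sumr; apply: eq_bigr => w _.
have -> : a - 1 + w.2%:R = (a + w.2%:R) - 1 by ring.
rewrite mulrCA bessel_rec// -natr1 addrA; ring.
Qed.

Definition Gam (b : R) : R := bessel b 0.

(** The substitution y -> y - ln r. It writes r^(-b) as a superposition of the exponentials e^(-r t)
    with t = e^y, hence a power of 1 + |x|^2 / c as a superposition of Gaussians. *)
Lemma Gam_powR (b r : R) : 0 < b -> 0 < r ->
  (\int[mu]_y (expR (b * y - r * expR y))%:E)%E = (r `^ (- b) * Gam b)%:E.
Proof.
move=> b0 r0; rewrite EFinM -besselE//; last by left.
have mo : measurable_fun [set: measurableTypeR R] (fun y : R => (expR (b * y - r * expR y))%:E).
  apply/measurable_EFinP; apply: continuous_measurable_fun => y.
  apply: continuous_comp; last exact: continuous_expR.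
  by apply: cvgB; apply: cvgM; try exact: cvg_cst; [exact: cvg_id|exact: continuous_expR].
rewrite -(ge0_integral_shift (- ln r) mo)//.
rewrite -ge0_integralZl//; last first.
- by rewrite lee_fin powR_ge0.
- by move=> y _; rewrite lee_fin ltW ?bkern_gt0.
- by apply/measurable_EFinP; exact: measurable_bkern.
apply: eq_integral => y _; rewrite -EFinM; congr EFin.
rewrite (powRE _ r0) /bkern -expRD; congr expR.
by rewrite !expRD !expRN !lnK ?posrE//; field; rewrite ?gt_eqF ?expR_gt0.
Qed.

End kernel.

(** * Fourier transform of (1 + |x|^2 / c)^(-b) *)

Section bessel_function.
Context (R : realType) (n : nat).
Local Notation mu := (@lebesgue_measure R).
Local Notation lambda := (lebesgue_measure_n R n).

(** A power of the Japanese bracket at the spatial scale sqrt c. *)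
Definition jpow (b c : R) (x : euclidean R n) : R := (1 + dotn x x / c) `^ (- b).

(** Subordination: the integral over y is [Gam b * jpow b c x], whereas for fixed y this is a
    Gaussian in x. Integrating against a cosine in both orders gives the Fourier transform of the
    power. *)
Let P (b c : R) (z : euclidean R n * measurableTypeR R) : R :=
  expR (b * z.2 - (1 + dotn z.1 z.1 / c) * expR z.2).

Let P_gt0 b c z : 0 < P b c z. Proof. exact: expR_gt0. Qed.

Let measurable_P b c : measurable_fun setT (P b c).
Proof.
apply: (measurableT_comp (@measurable_expR R)); apply: measurable_funB.
  by apply: measurable_funM => //; exact: measurable_snd.
apply: measurable_funM; last exact: (measurableT_comp (@measurable_expR R)) measurable_snd.
apply: measurable_funD => //; apply: measurable_funM => //.
by apply: measurable_dotn; exact: measurable_fst.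
Qed.

Let PE b c x y : 0 < c ->
  P b c (x, y) = expR (b * y - expR y) * expR (- (expR y / c) * dotn x x).
Proof. by move=> c0; rewrite -expRD /P/=; congr expR; field; rewrite gt_eqF. Qed.

Let sqrt_gauss (c y : R) : 0 < c ->
  Num.sqrt (pi / (expR y / c)) ^+ n = Num.sqrt (pi * c) ^+ n * expR (- (n%:R / 2) * y).
Proof.
move=> c0; have -> : pi / (expR y / c) = (pi * c) * expR (- (y / 2)) ^+ 2.
  rewrite -expRM_natl mulr_natl -mulr_natr -mulNr divfK// expRN.
  by field; rewrite !gt_eqF ?expR_gt0.
rewrite sqrtrM ?mulr_ge0 ?pi_ge0 ?(ltW c0)// sqrtr_sqr ger0_norm ?expR_ge0// exprMn.
by congr (_ * _); rewrite -expRM_natl; congr expR; ring.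
Qed.

Let bkernE (b d y : R) :
  expR (b * y - expR y) * (expR (- (n%:R / 2) * y) * expR (- d * expR (- y))) =
  bkern (b - n%:R / 2) d y.
Proof. by rewrite -!expRD /bkern; congr expR; ring. Qed.

Let int_P b c y : 0 < c -> (\int[lambda]_x (P b c (x, y))%:E =
  (Num.sqrt (pi * c) ^+ n)%:E * (bkern (b - n%:R / 2) 0 y)%:E)%E.
Proof.
move=> c0; have ey : 0 < expR y / c by rewrite divr_gt0 ?expR_gt0.
transitivity (\int[lambda]_x ((expR (b * y - expR y))%:E * (expR (- (expR y / c) * dotn x x))%:E))%E.
  by apply: eq_integral => x _; rewrite PE// EFinM.
rewrite ge0_integralZl//; last by apply/measurable_EFinP; exact: measurable_gaussn.
rewrite integral_gaussn// sqrt_gauss// -!EFinM; congr EFin.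
by rewrite -bkernE oppr0 mul0r expR0 mulr1; ring.
Qed.

(** Integrating in x first leaves a multiple of [bkern (b - n%:R / 2) 0]; this is where b > n/2
    enters. *)
Let integrable_P b c : 0 < c -> n%:R / 2 < b ->
  (lambda \x mu)%E.-integrable setT (EFin \o P b c).
Proof.
move=> c0 bn; apply/integrable21ltyP; first by apply/measurable_EFinP; exact: measurable_P.
have -> : (\int[mu]_y \int[lambda]_x `|(P b c (x, y))%:E| =
    \int[mu]_y ((Num.sqrt (pi * c) ^+ n)%:E * (bkern (b - n%:R / 2) 0 y)%:E))%E.
  apply: eq_integral => y _; rewrite -int_P//; apply: eq_integral => x _.
  by rewrite gee0_abs// lee_fin ltW ?P_gt0.
rewrite ge0_integralZl//; last first.
- by move=> y _; rewrite lee_fin ltW ?bkern_gt0.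
- by apply/measurable_EFinP; exact: measurable_bkern.
by rewrite besselE//; [rewrite -EFinM ltry|left; rewrite subr_gt0].
Qed.

Let integrable_Px b c x : 0 < c -> 0 < b -> mu.-integrable setT (EFin \o (fun y => P b c (x, y))).
Proof.
move=> c0 b0; apply/integrableP; split.
  by apply/measurable_EFinP; exact: measurableT_comp (measurable_P b c) (pair1_measurable x).
under eq_integral do rewrite /= ger0_norm ?expR_ge0//.
rewrite /P/= Gam_powR// ?ltry//.
by rewrite ltr_wpDr// divr_ge0 ?dotn_ge0 ?ltW.
Qed.

Let GamE b c x : 0 < c -> 0 < b -> \int[mu]_y P b c (x, y) = Gam b * jpow b c x.
Proof.
move=> c0 b0; have r0 : 0 < 1 + dotn x x / c by rewrite ltr_wpDr// divr_ge0 ?dotn_ge0 ?ltW.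
by rewrite mulrC; apply: EFin_inj; rewrite -(Gam_powR b0 r0) /Rintegral /P/= (Gam_powR b0 r0).
Qed.

Lemma Gam_gt0 (b : R) : 0 < b -> 0 < Gam b.
Proof. by move=> b0; apply: bessel_gt0 => //; left. Qed.

Lemma integrable_jpow (b c : R) : 0 < c -> n%:R / 2 < b ->
  lambda.-integrable setT (EFin \o jpow b c).
Proof.
move=> c0 bn; have b0 : 0 < b by rewrite (le_lt_trans _ bn)// divr_ge0.
have [|+ _] := Rintegral_fubini1 (integrable_P c0 bn); first by move=> x; exact: integrable_Px.
move=> /(integrable_scale (Gam b)^-1 measurableT); congr (_.-integrable _ _).
by apply/funext => x; rewrite /= GamE// mulKf// gt_eqF// Gam_gt0.
Qed.

Lemma Rintegral_jpow_cos (b c : R) (xi : euclidean R n) (th : R) : 0 < c -> n%:R / 2 < b ->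
  \int[lambda]_x (jpow b c x * cos (dotn x xi + th)) =
  Num.sqrt (pi * c) ^+ n / Gam b * bessel (b - n%:R / 2) (c * dotn xi xi / 4) * cos th.
Proof.
move=> c0 bn; have b0 : 0 < b by rewrite (le_lt_trans _ bn)// divr_ge0.
have mcos : measurable_fun setT (fun x : euclidean R n => cos (dotn x xi + th)).
  apply: (measurableT_comp (@measurable_cosR R)); apply: measurable_funD => //.
  exact: measurable_dotn.
have cos1 (x : R) : `|cos x| <= 1 by rewrite ler_norml cos_geN1 cos_le1.
pose H (z : euclidean R n * measurableTypeR R) : R := P b c z * cos (dotn z.1 xi + th).
have inH : (lambda \x mu)%E.-integrable setT (EFin \o H).
  apply: (@integrable_le _ _ R (lambda \x mu)%E setT H (P b c)) => //.
  - by apply: measurable_funM; [exact: measurable_P|exact: measurableT_comp mcos measurable_fst].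
  - by move=> z _; rewrite normrM (ger0_norm (ltW (P_gt0 _ _ _))) ler_piMr// ltW ?P_gt0.
  - exact: integrable_P.
have [|_ H1] := Rintegral_fubini1 inH.
  move=> x; have := integrable_scale (cos (dotn x xi + th)) measurableT (integrable_Px x c0 b0).
  by congr (_.-integrable _ _); apply/funext => y /=; rewrite mulrC.
have G0 := Gam_gt0 b0.
transitivity ((Gam b)^-1 * \int[(lambda \x mu)%E]_z H z).
  have ijc : lambda.-integrable setT (EFin \o (fun x => jpow b c x * cos (dotn x xi + th))).
    apply: (@integrable_le _ _ R lambda setT _ (jpow b c)) => //.
    - apply: measurable_funM => //; apply/measurable_EFinP.
      by apply: measurable_int (integrable_jpow c0 bn).
    - by move=> z _; rewrite normrM (ger0_norm (powR_ge0 _ _)) ler_piMr// powR_ge0.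
    - exact: integrable_jpow.
  rewrite H1;
    transitivity ((Gam b)^-1 * (\int[lambda]_x (Gam b * (jpow b c x * cos (dotn x xi + th))))).
    by rewrite RintegralZl// mulKf// gt_eqF.
  congr (_ * _); apply: eq_Rintegral => x _; rewrite mulrA -GamE//.
  by rewrite -RintegralZr//; exact: integrable_Px.
have sec y : lambda.-integrable setT (fun x => (H (x, y))%:E).
  have ey : 0 < expR y / c by rewrite divr_gt0 ?expR_gt0.
  have := integrable_scale (expR (b * y - expR y)) measurableT (integrable_gaussn_cos xi th ey).
  by congr (_.-integrable _ _); apply/funext => x; rewrite /H/= PE// mulrA.
rewrite (Rintegral_fubini2 inH sec).
transitivity ((Gam b)^-1 * \int[mu]_y ((Num.sqrt (pi * c) ^+ n * cos th) *
   bkern (b - n%:R / 2) (c * dotn xi xi / 4) y)).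
  congr (_ * _); apply: eq_Rintegral => y _; rewrite /H/=.
  have ey : 0 < expR y / c by rewrite divr_gt0 ?expR_gt0.
  transitivity (\int[lambda]_x (expR (b * y - expR y) *
      (expR (- (expR y / c) * dotn x x) * cos (dotn x xi + th)))).
    by apply: eq_Rintegral => x _; rewrite PE// mulrA.
  rewrite RintegralZl//; last exact: integrable_gaussn_cos.
  rewrite Rintegral_gaussn_cos// sqrt_gauss// -bkernE.
  have -> : - dotn xi xi / (4 * (expR y / c)) = - (c * dotn xi xi / 4) * expR (- y).
    by rewrite expRN; field; rewrite !gt_eqF ?expR_gt0.
  ring.
rewrite RintegralZl//; last first.
  apply: integrable_bkern; last by left; rewrite subr_gt0.
  by rewrite divr_ge0// mulr_ge0 ?dotn_ge0 ?ltW.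
rewrite -/(bessel _ _); ring.
Qed.

Lemma ftre_jpow (b c : R) (xi : euclidean R n) : 0 < c -> n%:R / 2 < b ->
  ftre (jpow b c) xi = Num.sqrt (pi * c) ^+ n / Gam b * bessel (b - n%:R / 2) (c * dotn xi xi / 4).
Proof.
move=> c0 bn; have := Rintegral_jpow_cos xi 0 c0 bn; rewrite cos0 mulr1 => <-.
by apply: eq_Rintegral => x _; rewrite addr0.
Qed.

Lemma ftim_jpow (b c : R) (xi : euclidean R n) : 0 < c -> n%:R / 2 < b -> ftim (jpow b c) xi = 0.
Proof.
move=> c0 bn; rewrite /ftim (_ : \int[lambda]_x _ = 0) ?oppr0//.
(* The phase - pi/2 turns the cosine into a sine, and the cosine of the phase itself, a factor of
   the result, vanishes. *)
transitivity (\int[lambda]_x (jpow b c x * cos (dotn x xi + - (pi / 2)))).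
  by apply: eq_Rintegral => x _; rewrite cosD cosN sinN cos_pihalf sin_pihalf; ring.
by rewrite Rintegral_jpow_cos// cosN cos_pihalf mulr0.
Qed.

Lemma jpow_le1 (b c : R) x : 0 < c -> 0 <= b -> jpow b c x <= 1.
Proof.
move=> c0 b0; have h : 1 <= 1 + dotn x x / c by rewrite lerDl divr_ge0 ?dotn_ge0 ?ltW.
rewrite /jpow powRN invf_le1 ?powR_gt0 ?(lt_le_trans ltr01)//.
apply: (@le_trans _ _ (1 `^ b)); first by rewrite powR1.
by rewrite ge0_ler_powR// nnegrE// (le_trans ler01).
Qed.

End bessel_function.

(** * The fractional Laplacian *)

Section fractional_laplacian.
Context (R : realType) (n : nat).
Local Notation lambda := (lebesgue_measure_n R n).
Implicit Types (f : euclidean R n -> R).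

Lemma measurable_enorm_powR (r : R) : measurable_fun setT (fun xi : euclidean R n => enorm xi `^ r).
Proof.
have ms : measurable_fun [set: R] (@Num.sqrt R).
  by apply: continuous_measurable_fun; exact: sqrt_continuous.
apply: (measurableT_comp (measurable_powR r)); apply: (measurableT_comp ms).
exact: measurable_dotn.
Qed.

Lemma enorm_powR (xi : euclidean R n) (r : R) : enorm xi `^ (2 * r) = dotn xi xi `^ r.
Proof. by rewrite powRrM -[2]/(2%:R) powR_mulrn ?sqrtr_ge0// enorm_sqr. Qed.

(** The origin is the box with all sides {0}. In dimension 0 it would be the whole space, with mass
    1. *)
Lemma negligible_dotn0 : (0 < n)%N -> lambda.-negligible [set xi : euclidean R n | dotn xi xi = 0].
Proof.
move=> n0; exists [set x | forall i, (fun=> [set (0 : measurableTypeR R)]) i (tnth x i)]; split.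
- rewrite (_ : [set _ | _] = \bigcap_(i in [set: 'I_n]) ((@tnth _ _)^~ i @^-1` [set (0:R)])).
    apply: fin_bigcap_measurable => // i _; rewrite -[X in measurable X]setTI.
    by apply: measurable_tnth => //; exact: measurable_set1.
  by apply/seteqP; split => x /=; [move=> h i _; exact: h|move=> h i; exact: h].
- rewrite [LHS](@lebesgue_measure_n_box R n (fun=> [set (0 : R)])); last first.
    by move=> i; exact: measurable_set1.
  under eq_bigr do rewrite lebesgue_measure_set1.
  by rewrite big_const card_ord; case: n n0 => // k _; rewrite iterS mul0e.
- move=> x /= /eqP; rewrite psumr_eq0; last by move=> i _; rewrite -expr2 sqr_ge0.
  by move=> /allP h i; have := h i; rewrite mem_index_enum => /(_ isT); rewrite -expr2 sqrf_eq0 => /eqP.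
Qed.

Lemma Lnorm2_ae (g h : euclidean R n -> R) : measurable_fun setT g -> measurable_fun setT h ->
  {ae lambda, forall xi, g xi = h xi} ->
  Lnorm lambda 2%:E (EFin \o g) = Lnorm lambda 2%:E (EFin \o h).
Proof.
move=> mg mh gh; rewrite !Lnorm2E; congr (_ `^ _)%E.
apply: ge0_ae_eq_integral => //.
- by apply/measurable_EFinP; exact: measurable_funX.
- by apply/measurable_EFinP; exact: measurable_funX.
- by move=> xi _; rewrite lee_fin sqr_ge0.
- by move=> xi _; rewrite lee_fin sqr_ge0.
- by apply: filterS gh => xi + _ => ->.
Qed.

Lemma Lfun2_measurable (g : euclidean R n -> R) : g \in Lfun lambda 2%:E -> measurable_fun setT g.
Proof. by rewrite inE => /andP[]; rewrite inE. Qed.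

Lemma measurable_ball_trig f (g : R -> R) (N : nat) : lambda.-integrable setT (EFin \o f) ->
  measurable_fun [set: R] g -> (forall x, `|g x| <= 1) ->
  measurable_fun setT (fun xi : euclidean R n =>
    \int[lambda]_(x in [set x | enorm x <= N%:R]) (f x * g (dotn x xi))).
Proof.
move=> intf mg g1; pose B := [set x : euclidean R n | enorm x <= N%:R].
have mB : measurable B by exact: measurable_enorm_ball.
have intfB : lambda.-integrable setT (EFin \o (f \_ B)).
  rewrite -restrict_EFin; apply/integrable_restrict => //.
  by rewrite setTI; apply: integrableS intf.
have := measurable_Rintegral_trig mg g1 intfB; congr (measurable_fun _ _).
apply/funext => xi; rewrite [RHS]Rintegral_mkcond; apply: eq_Rintegral => x _.
by rewrite !patchE; case: ifP => //; rewrite mul0r.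
Qed.

(** Lets the symbol identity for (-Delta)^sigma be checked off the origin only. *)
Lemma is_fourier_ae f (A B A' B' : euclidean R n -> R) : lambda.-integrable setT (EFin \o f) ->
  is_fourier f A B -> measurable_fun setT A' -> measurable_fun setT B' ->
  {ae lambda, forall xi, A xi = A' xi} -> {ae lambda, forall xi, B xi = B' xi} ->
  is_fourier f A' B'.
Proof.
move=> intf [fL2 [AL2 BL2] fA fB] mA' mB' AA' BB'.
have mA := Lfun2_measurable AL2; have mB := Lfun2_measurable BL2.
have sub (g h : euclidean R n -> R) : measurable_fun setT g -> g \in Lfun lambda 2%:E ->
    measurable_fun setT h -> {ae lambda, forall xi, g xi = h xi} -> h \in Lfun lambda 2%:E.
  move=> mg; rewrite !inE => /andP[_ gf] mh gh; apply/andP; split; rewrite inE//=.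
  by move: gf; rewrite inE/= /finite_norm (Lnorm2_ae mg mh gh).
have cos1 (x : R) : `|cos x| <= 1 by rewrite ler_norml cos_geN1 cos_le1.
have sin1 (x : R) : `|sin x| <= 1 by rewrite ler_norml sin_geN1 sin_le1.
have mre N : measurable_fun setT (fourier_re N f).
  by apply: measurable_ball_trig => //; exact: measurable_cosR.
have mim N : measurable_fun setT (fourier_im N f).
  by apply: measurableT_comp => //; apply: measurable_ball_trig => //; exact: measurable_sinR.
split=> //.
- by split; [exact: sub AL2 mA' AA'|exact: sub BL2 mB' BB'].
- rewrite (_ : (fun N => _) = (fun N => Lnorm lambda 2%:E (EFin \o (fourier_re N f \- A))))//.
  apply/funext => N; apply: Lnorm2_ae; [exact: measurable_funB|exact: measurable_funB|].
  by apply: filterS AA' => xi /= ->.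
- rewrite (_ : (fun N => _) = (fun N => Lnorm lambda 2%:E (EFin \o (fourier_im N f \- B))))//.
  apply/funext => N; apply: Lnorm2_ae; [exact: measurable_funB|exact: measurable_funB|].
  by apply: filterS BB' => xi /= ->.
Qed.

(** For functions in L^1 and L^2 the Fourier integrals represent the transform, so an identity
    between them off the origin suffices. Membership in H^(2 sigma) follows from it: |xi|^(2 sigma)
    times the transform of phi is the transform of psi, hence in L^2, and together with the
    transform itself it controls the Bessel weight. *)
Lemma frac_laplacian_ft (sigma : R) (phi psi : euclidean R n -> R) : (0 < n)%N -> 0 < sigma ->
  lambda.-integrable setT (EFin \o phi) -> lambda.-integrable setT (EFin \o psi) ->
  (\int[lambda]_x (phi x ^+ 2)%:E < +oo)%E -> (\int[lambda]_x (psi x ^+ 2)%:E < +oo)%E ->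
  (forall xi, 0 < dotn xi xi -> ftre psi xi = dotn xi xi `^ sigma * ftre phi xi) ->
  (forall xi, 0 < dotn xi xi -> ftim psi xi = dotn xi xi `^ sigma * ftim phi xi) ->
  is_frac_laplacian sigma phi psi /\ in_bessel (2 * sigma) phi.
Proof.
move=> n0 s0 iphi ipsi phi2 psi2 reE imE.
have Fphi := is_fourier_ft iphi phi2; have Fpsi := is_fourier_ft ipsi psi2.
have [_ [L1 L2] _ _] := Fphi.
have m1 := Lfun2_measurable L1; have m2 := Lfun2_measurable L2.
have mpow := measurable_enorm_powR (2 * sigma).
have ae (g h : euclidean R n -> R) :
    (forall xi, 0 < dotn xi xi -> g xi = dotn xi xi `^ sigma * h xi) ->
    {ae lambda, forall xi, g xi = enorm xi `^ (2 * sigma) * h xi}.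
  move=> gh; have := negligible_dotn0 n0; apply: negligibleS => xi /= /eqP.
  have := dotn_ge0 xi; rewrite le_eqVlt => /predU1P[<- //|xi0].
  by rewrite enorm_powR gh// eqxx.
have Fpsi' : is_fourier psi (fun xi => enorm xi `^ (2 * sigma) * ftre phi xi)
    (fun xi => enorm xi `^ (2 * sigma) * ftim phi xi).
  by apply: (is_fourier_ae ipsi Fpsi);
    [exact: measurable_funM|exact: measurable_funM|exact: ae|exact: ae].
split; first by exists (ftre phi), (ftim phi).
exists (ftre phi), (ftim phi).
have [_ [L3 L4] _ _] := Fpsi'.
have key (g : euclidean R n -> R) : g \in Lfun lambda 2%:E ->
    (fun xi => enorm xi `^ (2 * sigma) * g xi) \in Lfun lambda 2%:E ->
    (fun xi => (1 + enorm xi ^+ 2) `^ (2 * sigma / 2) * g xi) \in Lfun lambda 2%:E.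
  move=> Lg Lg'.
  have mg := Lfun2_measurable Lg; have mg' := Lfun2_measurable Lg'.
  have i1 := Lfun2_integrable_sqr Lg; have i2 := Lfun2_integrable_sqr Lg'.
  have mq : measurable_fun setT (fun xi : euclidean R n => (1 + enorm xi ^+ 2) `^ (2 * sigma / 2)).
    apply: (measurableT_comp (measurable_powR _)); apply: measurable_funD => //.
    by under eq_fun do rewrite enorm_sqr; exact: measurable_dotn.
  have mqg : measurable_fun setT (fun xi : euclidean R n =>
      (1 + enorm xi ^+ 2) `^ (2 * sigma / 2) * g xi).
    exact: measurable_funM.
  apply: Lfun2P => //.
  have := @integrable_le _ _ R lambda setT
    (fun xi => ((1 + enorm xi ^+ 2) `^ (2 * sigma / 2) * g xi) ^+ 2)
    (fun xi => (2 * (2 `^ sigma) ^+ 2) * (g xi ^+ 2 +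
      (enorm xi `^ (2 * sigma) * g xi) ^+ 2)) measurableT.
  case/(_ _ _ _)/integrableP.
  - exact: measurable_funX.
  - move=> xi _; rewrite ger0_norm ?sqr_ge0// enorm_sqr enorm_powR.
    rewrite (_ : 2 * sigma / 2 = sigma); last by field.
    set z := dotn xi xi; have z0 : 0 <= z := dotn_ge0 xi.
    (* 1 + z is at most 2 or at most 2 z, according to whether z <= 1 or not. *)
    have hz : (1 + z) `^ sigma <= 2 `^ sigma * (1 + z `^ sigma).
      have [z1|z1] := leP z 1.
        apply: (@le_trans _ _ (2 `^ sigma)).
          by apply: ge0_ler_powR; rewrite ?nnegrE ?(ltW s0)//; lra.
        by rewrite ler_peMr ?powR_ge0// lerDl powR_ge0.
      apply: (@le_trans _ _ ((2 * z) `^ sigma)).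
        by apply: ge0_ler_powR; rewrite ?nnegrE ?(ltW s0)//; lra.
      by rewrite powRM// ler_wpM2l ?powR_ge0// lerDr.
    have h1 : 0 <= (1 + z) `^ sigma := powR_ge0 _ _.
    have h2 : ((1 + z) `^ sigma) ^+ 2 <= (2 `^ sigma * (1 + z `^ sigma)) ^+ 2.
      by rewrite lerXn2r// nnegrE// (le_trans h1).
    rewrite exprMn; apply: le_trans (ler_wpM2r (sqr_ge0 _) h2) _.
    rewrite !exprMn; set w := z `^ sigma; have := sqr_ge0 (1 - w) => hw.
    have hw' : (1 + w) ^+ 2 <= 2 * (1 + w ^+ 2) by move: hw; lra.
    have := ler_wpM2l (sqr_ge0 (2 `^ sigma)) (ler_wpM2r (sqr_ge0 (g xi)) hw').
    by set T := 2 `^ sigma; set v := g xi; lra.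
  - by apply: integrable_scale => //; exact: integrable_addr.
  by move=> _; under eq_integral do rewrite /= ger0_norm ?sqr_ge0//.
by split => //; exact: key.
Qed.

End fractional_laplacian.

(** * Test functions with an explicit fractional Laplacian *)

Section test_function.
Context (R : realType) (n : nat).
Local Notation lambda := (lebesgue_measure_n R n).
Implicit Types (f g : euclidean R n -> R).

Lemma ftre_lin (a b : R) f g xi :
  lambda.-integrable setT (EFin \o f) -> lambda.-integrable setT (EFin \o g) ->
  ftre (fun x => a * f x + b * g x) xi = a * ftre f xi + b * ftre g xi.
Proof.
move=> /(integrable_mul_cos xi) i1 /(integrable_mul_cos xi) i2.
rewrite /ftre -!RintegralZl// -RintegralD//; last 2 first.
- exact: integrable_scale.
- exact: integrable_scale.
by apply: eq_Rintegral => x _; ring.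
Qed.

Lemma ftim_lin (a b : R) f g xi :
  lambda.-integrable setT (EFin \o f) -> lambda.-integrable setT (EFin \o g) ->
  ftim (fun x => a * f x + b * g x) xi = a * ftim f xi + b * ftim g xi.
Proof.
move=> /(integrable_mul_sin xi) i1 /(integrable_mul_sin xi) i2.
rewrite /ftim !mulrN -opprD -!RintegralZl// -RintegralD//; last 2 first.
- exact: integrable_scale.
- exact: integrable_scale.
by congr (- _); apply: eq_Rintegral => x _; ring.
Qed.

(** [s] lists pairs of a coefficient and an exponent. It is separate from the scale [c], so that one
    and the same combination can be taken at all scales. *)
Definition jcomb (s : seq (R * R)) (c : R) (x : euclidean R n) : R :=
  \sum_(w <- s) w.1 * jpow w.2 c x.

Lemma jcomb_cons w s c : jcomb (w :: s) c = (fun x => w.1 * jpow w.2 c x + 1 * jcomb s c x).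
Proof. by apply/funext => x; rewrite /jcomb big_cons mul1r. Qed.

Lemma integrable_jcomb s c : 0 < c -> (forall w, w \in s -> n%:R / 2 < w.2) ->
  lambda.-integrable setT (EFin \o jcomb s c).
Proof.
move=> c0; elim: s => [|w s IHs] hs.
  rewrite (_ : EFin \o _ = cst 0%E); first exact: integrable0.
  by apply/funext => x; rewrite /= /jcomb big_nil.
rewrite jcomb_cons; apply: integrable_addr => //.
  apply: integrable_scale => //; apply: integrable_jpow => //.
  by apply: hs; rewrite mem_head.
apply: integrable_scale => //; apply: IHs => v vs; apply: hs.
by rewrite in_cons vs orbT.
Qed.

Lemma ftre_jcomb s c xi : 0 < c -> (forall w, w \in s -> n%:R / 2 < w.2) ->
  ftre (jcomb s c) xi = \sum_(w <- s) w.1 * ftre (jpow w.2 c) xi.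
Proof.
move=> c0; elim: s => [|w s IHs] hs.
  rewrite big_nil /ftre; under eq_Rintegral do rewrite /jcomb big_nil mul0r.
  by rewrite Rintegral_cst// mul0r.
have hs' v : v \in s -> n%:R / 2 < v.2 by move=> vs; apply: hs; rewrite in_cons vs orbT.
rewrite jcomb_cons ftre_lin.
- by rewrite big_cons IHs// mul1r.
- by apply: integrable_jpow => //; apply: hs; rewrite mem_head.
- exact: integrable_jcomb.
Qed.

Lemma ftim_jcomb s c xi : 0 < c -> (forall w, w \in s -> n%:R / 2 < w.2) ->
  ftim (jcomb s c) xi = 0.
Proof.
move=> c0; elim: s => [|w s IHs] hs.
  rewrite /ftim; under eq_Rintegral do rewrite /jcomb big_nil mul0r.
  by rewrite Rintegral_cst// mul0r oppr0.
have hs' v : v \in s -> n%:R / 2 < v.2 by move=> vs; apply: hs; rewrite in_cons vs orbT.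
have w2 : n%:R / 2 < w.2 by apply: hs; rewrite mem_head.
rewrite jcomb_cons ftim_lin; [|exact: integrable_jpow|exact: integrable_jcomb].
by rewrite ftim_jpow// IHs// !mulr0 addr0.
Qed.

Lemma jcomb_bounded s c : 0 < c -> (forall w, w \in s -> n%:R / 2 < w.2) ->
  exists M, forall x, `|jcomb s c x| <= M.
Proof.
move=> c0 hs; exists (\sum_(w <- s) `|w.1|) => x.
apply: le_trans (ler_norm_sum _ _ _) _; rewrite big_seq [leRHS]big_seq.
apply: ler_sum => w ws; rewrite normrM ler_piMr// ger0_norm ?powR_ge0//.
by apply: jpow_le1 => //; apply: ltW; apply: le_lt_trans (hs _ ws); rewrite divr_ge0.
Qed.

Lemma sqr_integrable_bounded f M : lambda.-integrable setT (EFin \o f) ->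
  (forall x, `|f x| <= M) -> (\int[lambda]_x (f x ^+ 2)%:E < +oo)%E.
Proof.
move=> intf fM.
have mf : measurable_fun setT f by apply/measurable_EFinP; exact: measurable_int intf.
have := @integrable_le _ _ R lambda setT (fun x => f x ^+ 2) (fun x => M * `|f x|) measurableT.
case/(_ _ _ _)/integrableP.
- exact: measurable_funX.
- by move=> x _; rewrite normrX expr2 ler_wpM2r.
- by apply: integrable_scale => //; exact: integrable_norm.
by move=> _; under eq_integral do rewrite /= ger0_norm ?sqr_ge0//.
Qed.

(** The transform of the power b is a multiple of [bessel (m%:R - sigma) d] with d = c |xi|^2 / 4.
    Reflection turns this into d^(m - sigma) times [bessel (sigma - m%:R) d]; the symbol supplies
    d^sigma, and the recurrence absorbs the integer power d^m so obtained. The remaining orders are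
    sigma + i with i >= 0, which belong to powers above n/2. The scale enters only through |xi|^(2
    sigma) = 4^sigma c^(- sigma) d^sigma. *)
Lemma ftre_jpow_frac (sigma : R) (m : nat) : 0 < sigma -> sigma < m%:R ->
  exists s : seq (R * R), (forall w, w \in s -> n%:R / 2 < w.2) /\
  forall c (xi : euclidean R n), 0 < c -> 0 < dotn xi xi ->
    dotn xi xi `^ sigma * ftre (jpow (n%:R / 2 + (m%:R - sigma)) c) xi =
    c `^ (- sigma) * \sum_(w <- s) w.1 * ftre (jpow w.2 c) xi.
Proof.
move=> s0 sm; set b := n%:R / 2 + (m%:R - sigma).
have bn : n%:R / 2 < b by rewrite ltrDl subr_gt0.
have n20 : 0 <= n%:R / 2 :> R by rewrite divr_ge0.
have b0 : 0 < b := le_lt_trans n20 bn.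
have [s hs] := bessel_shift m sigma.
pose e (w : R * nat) : R := n%:R / 2 + (sigma + w.2%:R).
have en w : n%:R / 2 < e w by rewrite ltrDl ltr_wpDr.
(* The quotient of Gamma values trades the normalisation of the exponent b for that of [e w]; the
   factor 4^sigma comes from the 4 in d. *)
exists [seq (w.1 * 4 `^ sigma * Gam (e w) / Gam b, e w) | w <- s]; split.
  by move=> w /mapP[v _ ->]; exact: en.
move=> c xi c0 xi0; set z := dotn xi xi; pose d := c * z / 4.
have d0 : 0 < d by rewrite divr_gt0// mulr_gt0.
rewrite ftre_jpow// -/z -/d big_map/=.
have -> : b - n%:R / 2 = - (sigma - m%:R) by rewrite /b; ring.
rewrite bessel_opp// opprB.
have -> : z `^ sigma = 4 `^ sigma * c `^ (- sigma) * d `^ sigma.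
  rewrite /d powRM ?mulr_ge0 ?(ltW c0) ?(ltW xi0) ?invr_ge0//.
  rewrite powRM ?(ltW c0) ?(ltW xi0)// -[4^-1]powR_inv1// -powRrM mulN1r !powRN.
  by field; rewrite !gt_eqF ?powR_gt0.
have dm : d `^ sigma * d `^ (m%:R - sigma) = d ^+ m.
  rewrite -powRD; last by apply/implyP => _; rewrite gt_eqF.
  by rewrite addrC subrK powR_mulrn ?ltW.
set S := Num.sqrt (pi * c) ^+ n.
transitivity (4 `^ sigma * c `^ (- sigma) * S / Gam b * (d ^+ m * bessel (sigma - m%:R) d)).
  by rewrite -dm; ring.
rewrite hs// !mulr_sumr; apply: eq_bigr => w _.
rewrite ftre_jpow// -/z -/d -/S.
have -> : e w - n%:R / 2 = sigma + w.2%:R by rewrite /e; ring.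
field; rewrite !gt_eqF ?Gam_gt0//.
exact: le_lt_trans n20 (en w).
Qed.

Lemma fractional_test_function (sigma : R) : (0 < n)%N -> 0 < sigma ->
  exists b (s : seq (R * R)), [/\ n%:R / 2 < b, (forall w, w \in s -> n%:R / 2 < w.2) &
  forall c, 0 < c ->
   let phi (x : euclidean R n) := 4 `^ sigma * jpow b (4 * c) x + (- 1) * jpow b c x in
   let psi (x : euclidean R n) :=
     c `^ (- sigma) * jcomb s (4 * c) x + (- c `^ (- sigma)) * jcomb s c x in
   is_frac_laplacian sigma phi psi /\ in_bessel (2 * sigma) phi].
Proof.
(* The least integer strictly above sigma, so that b > n/2 also when sigma is an integer. *)
move=> n0 s0; pose m := (Num.Def.truncn sigma).+1.
have sm : sigma < m%:R by rewrite truncnS_gt.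
have [s [hs1 hs2]] := ftre_jpow_frac s0 sm.
set b := n%:R / 2 + (m%:R - sigma) in hs2 *.
have bn : n%:R / 2 < b by rewrite ltrDl subr_gt0.
have b0 : 0 <= b by apply: ltW; apply: le_lt_trans bn; rewrite divr_ge0.
exists b, s; split=> // c c0 phi psi.
have c40 : 0 < 4 * c by rewrite mulr_gt0.
have ij e : 0 < e -> lambda.-integrable setT (EFin \o jpow b e) by move=> ?; exact: integrable_jpow.
have ic e : 0 < e -> lambda.-integrable setT (EFin \o jcomb s e) by move=> ?; exact: integrable_jcomb.
have iphi : lambda.-integrable setT (EFin \o phi).
  by apply: integrable_addr => //; apply: integrable_scale => //; exact: ij.
have ipsi : lambda.-integrable setT (EFin \o psi).
  by apply: integrable_addr => //; apply: integrable_scale => //; exact: ic.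
have [M1 hM1] := jcomb_bounded c40 hs1; have [M2 hM2] := jcomb_bounded c0 hs1.
have j1 e (x : euclidean R n) : 0 < e -> `|jpow b e x| <= 1.
  by move=> ?; rewrite ger0_norm ?powR_ge0// jpow_le1.
apply: frac_laplacian_ft => //.
- apply: (@sqr_integrable_bounded _ (4 `^ sigma * 1 + 1 * 1)) => // x.
  rewrite (le_trans (ler_normD _ _))// !normrM normrN1 (ger0_norm (powR_ge0 _ _)).
  by rewrite lerD// ler_wpM2l ?powR_ge0// j1.
- apply: (@sqr_integrable_bounded _ (c `^ (- sigma) * M1 + c `^ (- sigma) * M2)) => // x.
  rewrite (le_trans (ler_normD _ _))// !normrM normrN (ger0_norm (powR_ge0 _ _)).
  by rewrite lerD// ler_wpM2l ?powR_ge0.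
- move=> xi xi0; rewrite ftre_lin; [|exact: ic|exact: ic].
  rewrite [in RHS]ftre_lin; [|exact: ij|exact: ij].
  rewrite !ftre_jcomb// mulrDr [_ * (- 1 * _)]mulrCA hs2// [_ * (4 `^ sigma * _)]mulrCA hs2//.
  rewrite powRM ?ltW// !powRN; set X := \sum_(w <- s) _; set Y := \sum_(w <- s) _.
  by field; rewrite !gt_eqF ?powR_gt0.
- move=> xi xi0; rewrite ftim_lin; [|exact: ic|exact: ic].
  rewrite [in RHS]ftim_lin; [|exact: ij|exact: ij].
  by rewrite !ftim_jcomb// !ftim_jpow// !mulr0 addr0 mulr0.
Qed.

End test_function.

(** * A smooth cutoff *)

Section cutoff.
Context (R : realType).
Local Notation mu := (@lebesgue_measure R).

(** Settles the one point where the rules of calculus do not apply to [flat]. *)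
Lemma is_derive_flat (f : R -> R) (a C : R) : (forall x, `|f x| <= C * (x - a) ^+ 2) ->
  is_derive a 1 f 0.
Proof.
move=> fC; have fa : f a = 0.
  by apply/eqP; rewrite -normr_le0; have := fC a; rewrite subrr expr0n/= mulr0.
have C0 : 0 <= C.
  by have := fC (a + 1); rewrite addrAC subrr add0r expr1n mulr1; apply: le_trans.
have h : h^-1 *: (f (h *: (1 : R) + a) - f a) @[h --> 0^'] --> (0 : R).
  apply/cvgrPdist_le => e e0; near=> h; rewrite sub0r normrN fa subr0 /GRing.scale/= mulr1 normrM.
  have h0 : h != 0 by near: h; exact: nbhs_dnbhs_neq.
  rewrite normfV ler_pdivrMl ?normr_gt0//; apply: le_trans (fC _) _.
  rewrite addrK -(real_normK (num_real h)) expr2 mulrCA ler_wpM2l//.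
  have he : `|h| <= e / (C + 1).
    by near: h; apply: dnbhs0_le; rewrite divr_gt0// ltr_wpDl.
  apply: (@le_trans _ _ (C * (e / (C + 1)))); first exact: ler_wpM2l.
  by rewrite mulrA ler_pdivrMr ?ltr_wpDl// mulrC ler_wpM2l ?(ltW e0)// lerDl.
apply: DeriveDef; first by apply/cvg_ex; exists 0; exact: h.
by apply/cvg_lim => //; exact: h.
Unshelve. all: by end_near. Qed.

(** x^(-j) e^(-1/x) extended by 0. The derivative of a member of this family is a combination of
    members, so first derivatives give smoothness at 0. *)
Definition flat (j : nat) (x : R) : R := if 0 < x then x^-1 ^+ j * expR (- x^-1) else 0.

Lemma flat_ge0 j x : 0 <= flat j x.
Proof.
by rewrite /flat; case: ifP => // x0; rewrite mulr_ge0 ?expR_ge0// exprn_ge0// invr_ge0 ltW.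
Qed.

Lemma flat_eq0 j x : x <= 0 -> flat j x = 0.
Proof. by move=> x0; rewrite /flat ltNge x0. Qed.

Lemma flat_gt0 j x : 0 < x -> 0 < flat j x.
Proof. by move=> x0; rewrite /flat x0 mulr_gt0 ?expR_gt0// exprn_gt0// invr_gt0. Qed.

(** The j-th power of u / j <= e^(u / j). With u = 1/x it bounds [flat]. *)
Lemma exprn_le_expR (u : R) j : 0 <= u -> u ^+ j <= j%:R ^+ j * expR u.
Proof.
move=> u0; case: j => [|j]; first by rewrite !expr0 mul1r -expR0 ler_expR.
have j0 : 0 < j.+1%:R :> R by rewrite ltr0n.
have h : u / j.+1%:R <= expR (u / j.+1%:R).
  by apply: le_trans (expR_ge1Dx _); rewrite lerDr.
have := lerXn2r j.+1 _ _ h; rewrite !nnegrE divr_ge0 ?ler0n// expR_ge0 => /(_ isT isT).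
rewrite -expRM_natl mulrCA divff ?gt_eqF// mulr1 expr_div_n ler_pdivrMr ?exprn_gt0//.
by rewrite mulrC.
Qed.

Lemma flat_le j x : flat j x <= j%:R ^+ j.
Proof.
rewrite /flat; case: ifP => x0; last by rewrite exprn_ge0.
by rewrite expRN ler_pdivrMr ?expR_gt0// exprn_le_expR// invr_ge0 ltW.
Qed.

Lemma flat_sqr j x : `|flat j x| <= j.+2%:R ^+ j.+2 * (x - 0) ^+ 2.
Proof.
rewrite ger0_norm ?flat_ge0// subr0; have [x0|x0] := ltP 0 x; last first.
  by rewrite flat_eq0// mulr_ge0 ?sqr_ge0// exprn_ge0.
have -> : flat j x = flat j.+2 x * x ^+ 2.
  by rewrite /flat x0 !exprS; field; rewrite gt_eqF.
by rewrite ler_wpM2r ?sqr_ge0// flat_le.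
Qed.

Lemma is_derive_flatfun j (x : R) : is_derive x 1 (flat j) (- j%:R * flat j.+1 x + flat j.+2 x).
Proof.
have [x0|x0|->] := ltgtP x 0.
- rewrite !flat_eq0 ?ltW// mulr0 addr0.
  apply: (@near_eq_is_derive _ _ _ (cst 0)).
    by near=> y; rewrite flat_eq0// ltW//; near: y; exact: lt_nbhsl.
- have d1 : is_derive x 1 (fun y : R => y^-1) (- x ^- 2).
    have := is_deriveV (lt0r_neq0 x0) (is_derive_id x (1 : R)).
    by rewrite /GRing.scale/= mulr1.
  have d2 : is_derive (x^-1) 1 (fun u : R => u ^+ j * expR (- u))
     ((j%:R * x^-1 ^+ j.-1 - x^-1 ^+ j) * expR (- x^-1)).
    have d2a : is_derive (x^-1) 1 (fun u : R => u ^+ j) (j%:R * x^-1 ^+ j.-1).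
      have := is_deriveX j (is_derive_id (x^-1) (1 : R)).
      rewrite /GRing.scale/= mulr1; congr (is_derive _ _ _ _).
      by apply/funext => u; rewrite exprfctE.
    have d2b : is_derive (x^-1) 1 (fun u : R => expR (- u)) (- expR (- x^-1)).
      by apply: is_derive_eq; rewrite /GRing.scale/=; ring.
    have := is_deriveM d2a d2b; rewrite /GRing.scale/=.
    by congr (is_derive _ _ _ _); ring.
  apply: (@near_eq_is_derive _ _ _ ((fun u : R => u ^+ j * expR (- u)) \o (fun y : R => y^-1))).
    by near=> y; rewrite /flat/= ifT//; near: y; exact: lt_nbhsr.
  apply: is_derive_eq; rewrite /flat x0.
  case: j d2 => [|j] _ /=; rewrite ?expr0 !exprS; field; by rewrite gt_eqF.
- rewrite !flat_eq0// mulr0 addr0; apply: is_derive_flat; exact: flat_sqr.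
Unshelve. all: by end_near. Qed.

Lemma is_derive_bigsum (I : Type) (s : seq I) (f df : I -> R -> R) (x : R) :
  (forall i, is_derive x 1 (f i) (df i x)) ->
  is_derive x 1 (fun y : R => \sum_(i <- s) f i y) (\sum_(i <- s) df i x).
Proof.
move=> h; elim: s => [|i s IHs].
  rewrite big_nil (_ : (fun _ => _) = cst 0); first exact: is_derive_cst.
  by apply/funext => y; rewrite big_nil.
rewrite big_cons (_ : (fun _ => _) = f i \+ (fun y => \sum_(i <- s) f i y)).
  exact: is_deriveD.
by apply/funext => y; rewrite big_cons.
Qed.

(** Combinations of the products of [flat i] at x - 1/2 and [flat j] at 1 - x, which vanish outside
    ]1/2, 1[. Encoded as lists, they are differentiated by an operation on lists, which can be
    iterated. *)
Definition bump (s : seq (R * (nat * nat))) (x : R) : R :=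
  \sum_(w <- s) w.1 * (flat w.2.1 (x - 2^-1) * flat w.2.2 (1 - x)).

Definition bump_derive (s : seq (R * (nat * nat))) : seq (R * (nat * nat)) :=
  [seq (- w.2.1%:R * w.1, (w.2.1.+1, w.2.2)) | w <- s] ++ [seq (w.1, (w.2.1.+2, w.2.2)) | w <- s] ++
  [seq (w.2.2%:R * w.1, (w.2.1, w.2.2.+1)) | w <- s] ++ [seq (- w.1, (w.2.1, w.2.2.+2)) | w <- s].

Lemma is_derive_bump s (x : R) : is_derive x 1 (bump s) (bump (bump_derive s) x).
Proof.
have -> : bump (bump_derive s) x = \sum_(w <- s) w.1 *
   ((- w.2.1%:R * flat w.2.1.+1 (x - 2^-1) + flat w.2.1.+2 (x - 2^-1)) * flat w.2.2 (1 - x) +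
   flat w.2.1 (x - 2^-1) * (w.2.2%:R * flat w.2.2.+1 (1 - x) - flat w.2.2.+2 (1 - x))).
  rewrite /bump /bump_derive !big_cat !big_map/= -!big_split/=.
  by apply: eq_bigr => w _; ring.
apply: (is_derive_bigsum s (df := fun w x => w.1 *
   ((- w.2.1%:R * flat w.2.1.+1 (x - 2^-1) + flat w.2.1.+2 (x - 2^-1)) * flat w.2.2 (1 - x) +
   flat w.2.1 (x - 2^-1) * (w.2.2%:R * flat w.2.2.+1 (1 - x) - flat w.2.2.+2 (1 - x))))) => w.
have d1 : is_derive x 1 (fun x : R => flat w.2.1 (x - 2^-1))
    (- w.2.1%:R * flat w.2.1.+1 (x - 2^-1) + flat w.2.1.+2 (x - 2^-1)).
  have h : is_derive x 1 (fun y : R => y - 2^-1) 1.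
    by apply: is_derive_eq; rewrite scaler0 subr0.
  have := @is_derive1_comp R (flat w.2.1) (fun y : R => y - 2^-1) x _ _
    (is_derive_flatfun w.2.1 (x - 2^-1)) h.
  by rewrite mulr1.
have d2 : is_derive x 1 (fun x : R => flat w.2.2 (1 - x))
    (w.2.2%:R * flat w.2.2.+1 (1 - x) - flat w.2.2.+2 (1 - x)).
  have h : is_derive x 1 (fun y : R => 1 - y) (- 1).
    by apply: is_derive_eq; rewrite add0r mul1r.
  have := @is_derive1_comp R (flat w.2.2) (fun y : R => 1 - y) x _ _
    (is_derive_flatfun w.2.2 (1 - x)) h.
  by congr (is_derive _ _ _ _); ring.
have := is_deriveZ w.1 (is_deriveM d1 d2); rewrite /GRing.scale/=.
by congr (is_derive _ _ _ _); ring.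
Qed.

Lemma continuous_bump s : continuous (bump s).
Proof.
move=> x; apply/differentiable_continuous/derivable1_diffP.
by case: (is_derive_bump s x).
Qed.

Lemma bump_eq0 s x : x <= 2^-1 \/ 1 <= x -> bump s x = 0.
Proof.
move=> hx; apply: big1 => w _; case: hx => hx.
  by rewrite [flat _ (x - _)]flat_eq0 ?mul0r ?mulr0// subr_le0.
by rewrite [flat _ (1 - _)]flat_eq0 ?mulr0// subr_le0.
Qed.

Lemma bump_bounded s : exists C, forall x, `|bump s x| <= C.
Proof.
exists (\sum_(w <- s) `|w.1| * (w.2.1%:R ^+ w.2.1 * w.2.2%:R ^+ w.2.2)) => x.
apply: le_trans (ler_norm_sum _ _ _) _; apply: ler_sum => w _.
rewrite normrM ler_wpM2l// ger0_norm ?mulr_ge0 ?flat_ge0//.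
by apply: ler_pM; rewrite ?flat_ge0 ?flat_le.
Qed.

Let s0 : seq (R * (nat * nat)) := [:: (1, (0%N, 0%N))].
Let b := bump s0.
Let mb : measurable_fun [set: measurableTypeR R] b.
Proof. by apply: continuous_measurable_fun; exact: continuous_bump. Qed.

Let b_ge0 x : 0 <= b x.
Proof. by rewrite /b /bump big_seq1 mul1r mulr_ge0 ?flat_ge0. Qed.

Let b_gt0 x : 2^-1 < x < 1 -> 0 < b x.
Proof.
move=> /andP[x1 x2]; rewrite /b /bump big_seq1 mul1r.
by apply: mulr_gt0; apply: flat_gt0; rewrite subr_gt0.
Qed.

Let integrable_b : mu.-integrable setT (EFin \o b).
Proof.
have [C hC] := bump_bounded s0.
have -> : b = b \_ [set` `[(0 : R), 1]].
  apply/funext => x; rewrite patchE; case: ifPn => // /negP h; apply: bump_eq0.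
  have [x0|x0] := leP x 2^-1; [by left|right].
  rewrite leNgt; apply/negP => x1; apply: h; rewrite inE/= in_itv/= (ltW x1) andbT.
  by apply: ltW; apply: le_lt_trans x0; rewrite invr_ge0.
rewrite -restrict_EFin; apply/integrable_restrict => //; rewrite setTI.
apply: continuous_compact_integrable; first exact: segment_compact.
by apply: continuous_subspaceT; exact: continuous_bump.
Qed.

Let E (t : R) : R := \int[mu]_(x in [set` `]-oo, t]]) b x.

Let dE (t : R) : is_derive t 1 E (b t).
Proof.
have tu : t < t + 1 by rewrite ltrDl.
have ib : mu.-integrable [set` `]-oo, t + 1]] (EFin \o b).
  by apply: integrableS integrable_b.
have cb : {for t, continuous b} by exact: continuous_bump.
have [|h1 h2] := continuous_FTC1 tu ib _ cb; first by rewrite ltNyr.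
by apply: DeriveDef => //; rewrite -derive1E h2.
Qed.

Let E_homo : {homo E : s t / s <= t}.
Proof.
move=> s t st; apply: fine_le.
- by apply: integrable_fin_num => //; apply: integrableS integrable_b.
- by apply: integrable_fin_num => //; apply: integrableS integrable_b.
apply: ge0_subset_integral => //.
- by apply/measurable_EFinP; exact: measurable_funTS.
- by move=> x _; rewrite lee_fin.
- by move=> x /=; rewrite !in_itv/= => /le_trans; apply.
Qed.

Let E_ge0 t : 0 <= E t. Proof. by apply: Rintegral_ge0 => x _. Qed.

Let E_eq0 t : t <= 2^-1 -> E t = 0.
Proof.
move=> t2; rewrite /E; under eq_Rintegral.
  move=> x; rewrite inE/= in_itv/= => xt; rewrite /b bump_eq0; last by left; exact: le_trans t2.
  over.
by rewrite Rintegral_cst// mul0r.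
Qed.

Let E_cst t : 1 <= t -> E t = E 1.
Proof.
move=> t1; rewrite /E Rintegral_mkcond [RHS]Rintegral_mkcond.
apply: eq_Rintegral => x _; rewrite !patchE !mem_setE !in_itv/=.
have [x1|x1] := leP x 1; first by rewrite (le_trans x1 t1).
by case: ifP => // _; rewrite /b bump_eq0//; right; exact: ltW.
Qed.

(** If [E 1] were 0, monotonicity would make E vanish identically, against E' = b > 0 at 3/4. *)
Let E1_gt0 : 0 < E 1.
Proof.
rewrite lt_neqAle E_ge0 andbT; apply/negP => /eqP E10.
have Ez : E = cst 0.
  apply/funext => t; have [t1|t1] := leP t 1; last by rewrite E_cst ?ltW// -E10.
  by apply/eqP; rewrite eq_le E_ge0 andbT E10 E_homo.
have h34 : 2^-1 < (3 / 4 : R) < 1 by apply/andP; split; lra.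
have := b_gt0 h34; have [_ <-] := dE (3 / 4).
by rewrite Ez derive_cst ltxx.
Qed.

(** One minus the normalised primitive of a bump on [1/2, 1]. The ratio 2 between the ends of the
    transition makes the transitions at the times X^k disjoint as soon as X >= 2. *)
Lemma smooth_cutoff : exists (eta : R -> R) (C : R),
  [/\ forall k t, derivable (derive1n k eta) t 1,
      forall t, 0 <= eta t <= 1,
      forall t, t <= 2^-1 -> eta t = 1,
      forall t, 1 <= t -> eta t = 0 &
      forall k t, (1 <= k <= 2)%N -> `|derive1n k eta t| <= C /\
        (t <= 2^-1 \/ 1 <= t -> derive1n k eta t = 0)].
Proof.
pose eta (t : R) : R := 1 - E t / E 1.
have etaE : eta = cst 1 \+ (fun t => - (E 1)^-1 * E t).
  by apply/funext => u; rewrite /eta fctE/=; ring.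
have d0 (t : R) : is_derive t 1 eta (- (E 1)^-1 * b t).
  have h1 := is_deriveZ (- (E 1)^-1) (dE t).
  have h2 := is_deriveD (is_derive_cst (1 : R) t (1 : R)) h1.
  by rewrite etaE; move: h2; rewrite add0r.
have deta k : derive1n k.+1 eta = (fun t => - (E 1)^-1 * bump (iter k bump_derive s0) t).
  elim: k => [|k IHk].
    by apply/funext => t; rewrite derive1n1 derive1E; exact: derive_val.
  apply/funext => t; rewrite derive1nS derive1E IHk.
  have h := is_deriveZ (- (E 1)^-1) (is_derive_bump (iter k bump_derive s0) t).
  by case: h => _; rewrite /GRing.scale/=.
have deta0 (t : R) : derivable eta t 1 by case: (d0 t).
have i0 : 0 <= (E 1)^-1 by rewrite invr_ge0.
have [C1 h1] := bump_bounded s0; have [C2 h2] := bump_bounded (bump_derive s0).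
exists eta, ((E 1)^-1 * (C1 + C2)); split.
- move=> [|k] t; first exact: deta0.
  rewrite deta.
  by have [] := is_deriveZ (- (E 1)^-1) (is_derive_bump (iter k bump_derive s0) t).
- move=> t; rewrite /eta subr_ge0 lerBlDr lerDl divr_ge0 ?E_ge0// andbT.
  rewrite ler_pdivrMr// mul1r; have [t1|t1] := leP t 1; first exact: E_homo.
  by rewrite E_cst// ltW.
- by move=> t t2; rewrite /eta E_eq0// mul0r subr0.
- by move=> t t1; rewrite /eta E_cst// divff ?subrr// gt_eqF.
- move=> [|[|[|k]]] t // _; rewrite deta; split.
  + rewrite normrM normrN (ger0_norm i0) ler_wpM2l// (le_trans (h1 t))// lerDl.
    exact: le_trans (h2 0).
  + by move=> /bump_eq0 ->; rewrite mulr0.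
  + rewrite normrM normrN (ger0_norm i0) ler_wpM2l// (le_trans (h2 t))// lerDr.
    exact: le_trans (h1 0).
  + by move=> /bump_eq0 ->; rewrite mulr0.
Qed.

Lemma derive1n_scale (f : R -> R) (a : R) : (forall k t, derivable (derive1n k f) t 1) ->
  forall k, derive1n k (fun t => f (a * t)) = (fun t => a ^+ k * derive1n k f (a * t)).
Proof.
move=> df; elim=> [|k IHk].
  by rewrite !derive1n0; apply/funext => t; rewrite expr0 mul1r.
rewrite derive1nS IHk; apply/funext => t; rewrite derive1E.
have h1 : is_derive t 1 (fun t : R => a * t) a.
  by apply: is_derive_eq; rewrite /GRing.scale/= mulr1.
have h2 : is_derive (a * t) 1 (derive1n k f) (derive1n k.+1 f (a * t)).
  by apply: DeriveDef => //; rewrite -derive1E.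
have [_] := is_deriveZ (a ^+ k) (@is_derive1_comp R (derive1n k f) (fun t : R => a * t) t _ _ h2 h1).
by rewrite /GRing.scale/= => ->; rewrite exprS; ring.
Qed.

Lemma derivable_scale (f : R -> R) (a : R) : (forall k t, derivable (derive1n k f) t 1) ->
  forall k t, derivable (derive1n k (fun t => f (a * t))) t 1.
Proof.
move=> df k t; rewrite derive1n_scale//.
have h1 : is_derive t 1 (fun t : R => a * t) a.
  by apply: is_derive_eq; rewrite /GRing.scale/= mulr1.
have h2 : is_derive (a * t) 1 (derive1n k f) (derive1n k.+1 f (a * t)).
  by apply: DeriveDef => //; rewrite -derive1E.
by have [] := is_deriveZ (a ^+ k) (@is_derive1_comp R (derive1n k f) (fun t : R => a * t) t _ _ h2 h1).
Qed.

End cutoff.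

(** * Weighted lower bounds and Dini integrals *)

Section lower_bound.
Context d (T : measurableType d) (R : realType).
Variables (m : {measure set T -> \bar R}) (D : set T) (mD : measurable D).
Variables (p : R) (mu : R -> R) (w : T -> R).
Hypotheses (p1 : 1 < p) (hmu : modulus_of_continuity mu).
Hypothesis mw : measurable_fun D w.
Hypothesis intPhi : m.-integrable D (fun z => (Phi p mu `|w z|)%:E).

Let mPhi : measurable_fun D (fun z => Phi p mu `|w z|).
Proof. by apply/measurable_EFinP; exact: measurable_int intPhi. Qed.

Lemma Phi_ge0 s : 0 <= s -> 0 <= Phi p mu s.
Proof. by move=> s0; rewrite mulr_ge0 ?powR_ge0//; case: hmu => h _ _ _; exact: h. Qed.

(** Phi(s) / s for s > 0; nondecreasing because p > 1 and mu is nondecreasing. *)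
Let q s : R := s `^ (p - 1) * mu s.

Let q_ge0 s : 0 <= s -> 0 <= q s.
Proof. by move=> s0; rewrite mulr_ge0 ?powR_ge0//; case: hmu => h _ _ _; exact: h. Qed.

(** For x <= s the first term on the right suffices; for x > s the second does, as Phi(x) / x is
    nondecreasing. Phi thus gets affine minorants with a free level s, as in the proof of Jensen's
    inequality. *)
Lemma mul_le_Phi (s x : R) : 0 <= s -> 0 <= x -> x * q s <= s * q s + Phi p mu x.
Proof.
move=> s0 x0; have [xs|sx] := leP x s.
  by rewrite (le_trans (ler_wpM2r (q_ge0 s0) xs))// lerDl Phi_ge0.
apply: (@le_trans _ _ (Phi p mu x)); last by rewrite lerDr mulr_ge0 ?q_ge0.
have x1 : 0 < x by exact: le_lt_trans sx.
rewrite /Phi (_ : x `^ p = x * x `^ (p - 1)); last first.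
  rewrite -{2}[x]powRr1// -powRD; last by apply/implyP => _; rewrite gt_eqF.
  by rewrite addrCA subrr addr0.
rewrite -mulrA ler_wpM2l//.
case: hmu => mu0 _ _ muh; apply: ler_pM; [exact: powR_ge0|exact: mu0| |exact/muh/ltW].
by apply: ge0_ler_powR; rewrite ?nnegrE ?subr_ge0 ?(ltW p1) ?(ltW sx).
Qed.

(** Integrates [mul_le_Phi] against the weight. The level s is chosen later so that s V is half of
    A. *)
Lemma weighted_lower_bound (W : T -> R) (s A V : R) : 0 <= s ->
  measurable_fun D W -> (forall z, D z -> 0 <= W z) ->
  (\int[m]_(z in D) (W z)%:E <= V%:E)%E ->
  (A%:E <= \int[m]_(z in D) (`|w z| * W z)%:E)%E ->
  ((s `^ (p - 1) * mu s * (A - s * V))%:E <= \int[m]_(z in D) (Phi p mu `|w z| * W z)%:E)%E.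
Proof.
move=> s0 mW W0 WV AwW; rewrite -/(q s).
have mwW : measurable_fun D (fun z => `|w z| * W z).
  by apply: measurable_funM => //; exact: measurableT_comp.
have mPW : measurable_fun D (fun z => Phi p mu `|w z| * W z) by exact: measurable_funM.
have q0 := q_ge0 s0.
have PW0 z : D z -> 0 <= Phi p mu `|w z| * W z.
  by move=> Dz; rewrite mulr_ge0 ?Phi_ge0 ?W0.
have h : ((q s * A)%:E <= (s * q s * V)%:E + \int[m]_(z in D) (Phi p mu `|w z| * W z)%:E)%E.
  apply: (@le_trans _ _ (\int[m]_(z in D) ((s * q s)%:E * (W z)%:E + (Phi p mu `|w z| * W z)%:E))%E).
    apply: (@le_trans _ _ (\int[m]_(z in D) ((q s)%:E * (`|w z| * W z)%:E))%E).
      rewrite ge0_integralZl//.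
      - by rewrite [leLHS]EFinM lee_wpmul2l.
      - exact/measurable_EFinP.
      - by move=> z Dz; rewrite lee_fin mulr_ge0 ?W0.
    apply: ge0_le_integral => //.
    - by move=> z Dz; rewrite -EFinM lee_fin mulr_ge0// mulr_ge0 ?W0.
    - by under eq_fun do rewrite -EFinM; apply/measurable_EFinP; exact: measurable_funM.
    - apply: emeasurable_funD; last exact/measurable_EFinP.
      by under eq_fun do rewrite -EFinM; apply/measurable_EFinP; exact: measurable_funM.
    - move=> z Dz; rewrite -!EFinM -EFinD lee_fin.
      have := ler_wpM2r (W0 _ Dz) (mul_le_Phi s0 (normr_ge0 (w z))).
      by lra.
  rewrite ge0_integralD//; first last.
  - exact/measurable_EFinP.
  - by under eq_fun do rewrite -EFinM; apply/measurable_EFinP; exact: measurable_funM.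
  - by move=> z Dz; rewrite -EFinM lee_fin mulr_ge0 ?W0// mulr_ge0.
  rewrite leeD2r// ge0_integralZl//.
  - by rewrite [leRHS]EFinM lee_wpmul2l// lee_fin mulr_ge0.
  - exact/measurable_EFinP.
  - by rewrite lee_fin mulr_ge0.
have -> : q s * (A - s * V) = q s * A - s * q s * V by ring.
by rewrite EFinB leeBlDl.
Qed.

Lemma weighted_sum_bound (W : nat -> T -> R) (C : R) (N : nat) :
  (forall k, measurable_fun D (W k)) -> (forall k z, D z -> 0 <= W k z) ->
  (forall z, D z -> \sum_(k < N) W k z <= C) ->
  (\sum_(k < N) \int[m]_(z in D) (Phi p mu `|w z| * W k z)%:E <=
   (C * \int[m]_(z in D) Phi p mu `|w z|)%:E)%E.
Proof.
move=> mW W0 WC.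
have mPW k : measurable_fun D (fun z => (Phi p mu `|w z| * W k z)%:E).
  by apply/measurable_EFinP; exact: measurable_funM.
rewrite -ge0_integral_sum//; last by move=> k z Dz; rewrite lee_fin mulr_ge0 ?Phi_ge0 ?W0.
rewrite EFinM /Rintegral fineK; last exact: integrable_fin_num.
(* A negative [C] forces [D] to be empty, since the weights are nonnegative on it. *)
have [C0|C0] := leP 0 C.
  rewrite -ge0_integralZl//; last first.
  - by move=> z _; rewrite lee_fin Phi_ge0.
  - exact/measurable_EFinP.
  apply: ge0_le_integral => //.
  - by move=> z Dz; apply: sume_ge0 => k _; rewrite lee_fin mulr_ge0 ?Phi_ge0 ?W0.
  - by apply: emeasurable_sum.
  - by under eq_fun do rewrite -EFinM; apply/measurable_EFinP; exact: measurable_funM.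
  - move=> z Dz; rewrite sumEFin -EFinM lee_fin -mulr_sumr mulrC ler_wpM2r ?Phi_ge0//.
    exact: WC.
have -> : D = set0.
  rewrite -subset0 => z Dz; have := WC z Dz; apply/negP; rewrite -ltNge.
  by apply: lt_le_trans C0 _; apply: sumr_ge0 => k _; exact: W0.
by rewrite !integral_set0 mule0.
Qed.

End lower_bound.

(** * Dini integrals and geometric scales *)

Section dyadic.
Context (R : realType).
Local Notation leb := (@lebesgue_measure R).
Implicit Types (mu : R -> R).

(** Only the behaviour at 0 counts: by [dini_extend] finiteness for one upper limit gives it for
    all. *)
Definition dini (d : R) mu : Prop := forall c, 0 < c ->
  (\int[leb]_(s in `]0%R, c[) (s `^ (- 1 - d) * mu s)%:E < +oo)%E.

Lemma modulus_ge0 mu s : modulus_of_continuity mu -> 0 <= s -> 0 <= mu s.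
Proof. by move=> [h _ _ _]; exact: h. Qed.

Lemma modulus_le mu s t : modulus_of_continuity mu -> 0 <= s -> s <= t -> mu s <= mu t.
Proof. by move=> [_ _ _ h]; exact: h. Qed.

Lemma measurable_modulus mu (D : set (measurableTypeR R)) : modulus_of_continuity mu ->
  measurable D -> D `<=` `[0, +oo[ -> measurable_fun D mu.
Proof.
move=> [_ cmu _ _] mD D0.
apply: (measurable_funS _ D0); first exact: measurable_itv.
exact: subspace_continuous_measurable_fun.
Qed.

Lemma measurable_powR_modulus (r : R) mu (D : set (measurableTypeR R)) :
  modulus_of_continuity mu -> measurable D -> D `<=` `[0, +oo[ ->
  measurable_fun D (fun s : R => s `^ r * mu s).
Proof.
move=> hmu mD D0; apply: measurable_funM; last exact: measurable_modulus.
by apply: measurable_funTS; exact: measurable_powR.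
Qed.

Lemma powR_mulexpn (s0 rho r : R) (k : nat) : 0 < s0 -> 0 < rho ->
  (s0 * rho ^+ k) `^ r = s0 `^ r * (rho `^ r) ^+ k.
Proof.
move=> s00 rho0; rewrite powRM ?exprn_ge0 ?(ltW rho0) ?(ltW s00)//; congr (_ * _).
by rewrite -powR_mulrn ?(ltW rho0)// -powRrM mulrC powRrM powR_mulrn ?powR_ge0.
Qed.

(** The sum of both end values serves both signs of r. *)
Lemma powR_itv_le (a b x r : R) : 0 < a -> a <= x -> x <= b -> x `^ r <= a `^ r + b `^ r.
Proof.
move=> a0 ax xb; have x0 := lt_le_trans a0 ax; have b0 := lt_le_trans x0 xb.
have [r0|r0] := leP 0 r.
  apply: (@le_trans _ _ (b `^ r)); last by rewrite lerDr powR_ge0.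
  by apply: ge0_ler_powR; rewrite ?nnegrE ?(ltW x0) ?(ltW b0).
apply: (@le_trans _ _ (a `^ r)); last by rewrite lerDl powR_ge0.
rewrite -[r]opprK powRN [leRHS]powRN lef_pV2 ?posrE ?powR_gt0//.
by apply: ge0_ler_powR; rewrite ?nnegrE ?(ltW x0) ?(ltW a0)// oppr_ge0 ltW.
Qed.

Lemma integral_powR_modulus_le (a b r : R) mu : modulus_of_continuity mu -> 0 < a -> a <= b ->
  (\int[leb]_(s in `[a, b[) (s `^ r * mu s)%:E <= ((a `^ r + b `^ r) * mu b * (b - a))%:E)%E.
Proof.
move=> hmu a0 ab; have b0 := lt_le_trans a0 ab.
have -> : (((a `^ r + b `^ r) * mu b * (b - a))%:E =
    \int[leb]_(s in `[a, b[) ((a `^ r + b `^ r) * mu b)%:E)%E.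
  rewrite integral_cst//= lebesgue_measure_itv/= lte_fin EFinM.
  by case: ltgtP ab => // -> _; rewrite subrr.
apply: ge0_le_integral => //.
- move=> s /=; rewrite in_itv/= => /andP[as_ _]; rewrite lee_fin mulr_ge0 ?powR_ge0//.
  by apply: modulus_ge0 => //; exact: le_trans (ltW a0) as_.
- apply/measurable_EFinP; apply: measurable_powR_modulus => //.
  by move=> s /=; rewrite !in_itv/= => /andP[/(le_trans (ltW a0)) ->].
- move=> s /=; rewrite in_itv/= => /andP[as_ sb]; rewrite lee_fin.
  have s0 := le_trans (ltW a0) as_.
  apply: ler_pM; rewrite ?powR_ge0 ?(modulus_ge0 hmu)//.
    by apply: powR_itv_le => //; exact: ltW.
  by apply: (modulus_le hmu) => //; exact: ltW.
Qed.

Lemma powR_modulus_ge0 (r s : R) mu : modulus_of_continuity mu -> 0 <= s ->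
  (0 <= (s `^ r * mu s)%:E)%E.
Proof. by move=> hmu s0; rewrite lee_fin mulr_ge0 ?powR_ge0 ?(modulus_ge0 hmu). Qed.

Lemma dini_extend (d a : R) mu : modulus_of_continuity mu -> 0 < a ->
  (\int[leb]_(s in `]0%R, a[) (s `^ (- 1 - d) * mu s)%:E < +oo)%E -> dini d mu.
Proof.
move=> hmu a0 fa c c0; set f := fun s : R => (s `^ (- 1 - d) * mu s)%:E.
have mf (D : set (measurableTypeR R)) : measurable D -> D `<=` `[0, +oo[ -> measurable_fun D f.
  by move=> mD D0; apply/measurable_EFinP; exact: measurable_powR_modulus.
have [ca|ac] := leP c a.
  apply: le_lt_trans fa; apply: ge0_subset_integral => //.
  - by apply: mf => // s /=; rewrite !in_itv/= andbT => /andP[/ltW].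
  - by move=> s /=; rewrite in_itv/= => /andP[/ltW s0 _]; exact: powR_modulus_ge0.
  - by move=> s /=; rewrite !in_itv/= => /andP[-> /=]; move=> /lt_le_trans; apply.
have U : `]0, c[%classic = `]0, a[%classic `|` `[a, c[%classic.
  by rewrite -itv_bndbnd_setU ?bnd_simp// ltW.
rewrite U ge0_integral_setU//.
- apply: lte_add_pinfty => //.
  by apply: le_lt_trans (integral_powR_modulus_le _ hmu a0 (ltW ac)) _; exact: ltry.
- rewrite -U; apply: mf => //.
  by move=> s /=; rewrite !in_itv/= andbT => /andP[/ltW].
- rewrite -U => s /=; rewrite in_itv/= => /andP[/ltW s0 _]; exact: powR_modulus_ge0.
- apply/disj_setPS => s [/=]; rewrite !in_itv/= => /andP[_ h1] /andP[h2 _].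
  by move: h1; rewrite ltNge h2.
Qed.

(** On [s_(k+1), s_k[ the monotonicity of mu and the fixed ratio rho of the ends bound the integral
    by a constant times the k-th term. *)
Lemma dini_dyadic (d rho s0 B : R) mu : modulus_of_continuity mu ->
  0 < rho < 1 -> 0 < s0 ->
  (forall N, \sum_(k < N) (s0 * rho ^+ k) `^ (- d) * mu (s0 * rho ^+ k) <= B) ->
  dini d mu.
Proof.
move=> hmu /andP[rho0 rho1] s00 hB; apply: (dini_extend hmu s00).
pose s k := s0 * rho ^+ k; pose r := - 1 - d.
have sk k : 0 < s k by rewrite mulr_gt0// exprn_gt0.
have sS k : s k.+1 = rho * s k by rewrite /s exprS; ring.
have sle k : s k.+1 <= s k by rewrite sS ler_piMl ?(ltW (sk k)) ?(ltW rho1).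
have sle0 k : s k <= s0.
  elim: k => [|k IHk]; first by rewrite /s expr0 mulr1.
  exact: le_trans (sle k) IHk.
pose f (x : R) := (x `^ r * mu x)%:E.
have mf (D : set (measurableTypeR R)) : measurable D -> D `<=` `[0, +oo[ -> measurable_fun D f.
  by move=> mD D0; apply/measurable_EFinP; exact: measurable_powR_modulus.
have step k : (\int[leb]_(x in `[s k.+1, s k[) f x <=
    ((rho `^ r + 1) * (s k `^ (- d) * mu (s k)))%:E)%E.
  apply: le_trans (integral_powR_modulus_le r hmu (sk _) (sle k)) _; rewrite lee_fin.
  have m0 := modulus_ge0 hmu (ltW (sk k)).
  rewrite {1}sS powRM ?(ltW rho0) ?(ltW (sk k))//.
  have -> : s k `^ (- d) = s k `^ r * s k.
    rewrite -{3}[s k]powRr1 ?(ltW (sk k))// -powRD; last by apply/implyP => _; rewrite gt_eqF.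
    by congr (_ `^ _); rewrite /r; ring.
  have h : s k - s k.+1 <= s k by rewrite lerBlDr lerDl ltW.
  apply: le_trans (ler_wpM2l _ h) _.
    by rewrite mulr_ge0// addr_ge0 ?mulr_ge0 ?powR_ge0.
  by rewrite le_eqVlt; apply/orP; left; apply/eqP; ring.
have bound N : (\int[leb]_(x in `[s N, s0[) f x <= ((rho `^ r + 1) * B)%:E)%E.
  apply: (@le_trans _ _ ((rho `^ r + 1) * \sum_(k < N) (s k `^ (- d) * mu (s k)))%:E); last first.
    by rewrite lee_fin ler_wpM2l ?addr_ge0 ?powR_ge0// hB.
  elim: N => [|N IHN].
    rewrite big_ord0 mulr0 /s expr0 mulr1 set_itv_ge ?integral_set0//.
    by rewrite bnd_simp ltxx.
  rewrite (@itv_bndbnd_setU _ _ _ (BLeft (s N))) ?bnd_simp//.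
  rewrite ge0_integral_setU//.
  - by rewrite big_ord_recr/= mulrDr EFinD addeC; apply: leeD.
  - rewrite -itv_bndbnd_setU ?bnd_simp//; apply: mf => //.
    by move=> x /=; rewrite !in_itv/= andbT => /andP[/(le_trans (ltW (sk _)))].
  - rewrite -itv_bndbnd_setU ?bnd_simp// => x /=; rewrite in_itv/= => /andP[h _].
    by apply: powR_modulus_ge0 => //; exact: le_trans (ltW (sk _)) h.
  - apply/disj_setPS => x [/=]; rewrite !in_itv/= => /andP[_ h1] /andP[h2 _].
    by move: h1; rewrite ltNge h2.
pose F N : set (measurableTypeR R) := `[s N, s0[%classic.
have U : `]0, s0[%classic = \bigcup_N F N.
  apply/seteqP; split=> x; rewrite /F/=.
    rewrite in_itv/= => /andP[x0 xs0].
    have : s N @[N --> \oo] --> (0 : R).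
      rewrite -[X in _ --> X](mulr0 s0); apply: cvgM; first exact: cvg_cst.
      by apply: cvg_expr; rewrite ger0_norm ?(ltW rho0).
    move=> /cvgr0Pnorm_lt /(_ x x0)[N _ /(_ N (leqnn N))] h.
    exists N => //=; rewrite in_itv/= xs0 andbT ltW//.
    by move: h; rewrite ger0_norm// ltW.
  by move=> [N _ /=]; rewrite !in_itv/= => /andP[/(lt_le_trans (sk N)) -> ->].
have h := @ge0_nondecreasing_set_cvg_integral _ (measurableTypeR R) R F f leb.
have cvg_int : (\int[leb]_(x in F N) f x)%E @[N --> \oo] --> (\int[leb]_(x in `]0%R, s0[) f x)%E.
  rewrite U; apply: h.
  - apply/nondecreasing_seqP => N; apply/subsetPset => x; rewrite /F/= !in_itv/= => /andP[h1 ->].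
    by rewrite (le_trans (sle N) h1).
  - by move=> N; exact: measurable_itv.
  - move=> N; apply: mf; first exact: measurable_itv.
    by move=> x; rewrite /F/= !in_itv/= andbT => /andP[/(le_trans (ltW (sk _)))].
  - move=> N x; rewrite /F/= in_itv/= => /andP[h1 _].
    by apply: powR_modulus_ge0 => //; exact: le_trans (ltW (sk _)) h1.
have -> : (\int[leb]_(x in `]0%R, s0[) f x)%E = limn (fun N => \int[leb]_(x in F N) f x)%E.
  by apply/esym/cvg_lim.
apply: (@le_lt_trans _ _ ((rho `^ r + 1) * B)%:E); last exact: ltry.
apply: lime_le; first by apply/cvg_ex; eexists; exact: cvg_int.
exact: nearW.
Qed.

(** On the scales 2^(-k) mu is at most mu(1), so the dyadic sum is dominated by a geometric series
    of ratio 2^d < 1. *)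
Lemma dini_neg (d : R) mu : modulus_of_continuity mu -> d < 0 -> dini d mu.
Proof.
move=> hmu d0; have r2 : 0 < (2^-1 : R) < 1 by apply/andP; split; lra.
have /andP[r20 r21] := r2.
set x : R := 2^-1 `^ (- d).
have x1 : x < 1.
  have := @gt0_ltr_powR R (- d) _ 2^-1 1; rewrite /x powR1; apply; rewrite ?nnegrE ?oppr_gt0//;
    exact: ltW.
apply: (@dini_dyadic d 2^-1 1 (mu 1 / (1 - x))) => // N.
have h N' : (1 - x) * (\sum_(k < N') x ^+ k) <= 1.
  by rewrite -[leLHS]opprK -mulNr opprB -subrX1 opprB lerBlDr lerDl exprn_ge0// powR_ge0.
apply: (@le_trans _ _ (\sum_(k < N) mu 1 * x ^+ k)).
  apply: ler_sum => k _; rewrite powR_mulexpn// powR1 mul1r mulrC.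
  rewrite mul1r ler_wpM2r ?exprn_ge0 ?powR_ge0//.
  by apply: modulus_le => //; rewrite ?exprn_ge0 ?exprn_ile1 ?(ltW r20) ?(ltW r21).
rewrite -mulr_sumr ler_wpM2l ?(modulus_ge0 hmu)//.
by rewrite -[(1 - x)^-1]mul1r ler_pdivlMr ?subr_gt0// mulrC.
Qed.

(** As a1 + a2 = 1 and a1 d1 + a2 d2 = 0, the integrand is the geometric mean, with weights a1 and
    a2, of the two Dini integrands: the extra powers of s cancel. *)
Lemma dini_combine (d1 d2 a1 a2 c : R) mu1 mu2 :
  modulus_of_continuity mu1 -> modulus_of_continuity mu2 ->
  0 < a1 -> 0 < a2 -> a1 + a2 = 1 -> a1 * d1 + a2 * d2 = 0 ->
  dini d1 mu1 -> dini d2 mu2 -> 0 < c ->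
  (\int[leb]_(s in `]0%R, c[) (s^-1 * (mu1 s `^ a1 * mu2 s `^ a2))%:E < +oo)%E.
Proof.
move=> hmu1 hmu2 a10 a20 a12 ad h1 h2 c0.
have sub : `]0, c[%classic `<=` `[(0 : R), +oo[%classic.
  by move=> s /=; rewrite !in_itv/= andbT => /andP[/ltW].
have m1 : measurable_fun (`]0, c[%classic : set (measurableTypeR R)) mu1.
  exact: measurable_modulus.
have m2 : measurable_fun (`]0, c[%classic : set (measurableTypeR R)) mu2.
  exact: measurable_modulus.
apply: (@le_lt_trans _ _ (\int[leb]_(s in `]0%R, c[) ((s `^ (- 1 - d1) * mu1 s)%:E +
    (s `^ (- 1 - d2) * mu2 s)%:E))%E); last first.
  rewrite ge0_integralD//.
  - by apply: lte_add_pinfty; [exact: h1|exact: h2].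
  - by move=> s /sub; rewrite /= in_itv/= andbT => s0; exact: powR_modulus_ge0.
  - by apply/measurable_EFinP; exact: measurable_powR_modulus.
  - by move=> s /sub; rewrite /= in_itv/= andbT => s0; exact: powR_modulus_ge0.
  - by apply/measurable_EFinP; exact: measurable_powR_modulus.
apply: ge0_le_integral => //.
- move=> s /sub; rewrite /= in_itv/= andbT => s0.
  by rewrite lee_fin !mulr_ge0 ?powR_ge0 ?invr_ge0.
- apply/measurable_EFinP; apply: measurable_funM.
    apply: (@eq_measurable_fun _ _ (measurableTypeR R) _ _ (fun s : R => s `^ (- 1))).
      by move=> s /set_mem/sub; rewrite /= in_itv/= andbT => s0; rewrite powR_inv1.
    by apply: measurable_funTS; exact: measurable_powR.
  by apply: measurable_funM; apply: (measurableT_comp (measurable_powR _)).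
- by apply: emeasurable_funD; apply/measurable_EFinP; exact: measurable_powR_modulus.
move=> s /=; rewrite in_itv/= => /andP[s0 _]; rewrite -EFinD lee_fin.
have x0 := modulus_ge0 hmu1 (ltW s0); have y0 := modulus_ge0 hmu2 (ltW s0).
have sd d : s `^ (- 1 - d) = s^-1 * s `^ (- d).
  rewrite powRD; last by apply/implyP => _; rewrite gt_eqF.
  by rewrite powR_inv1 ?ltW.
rewrite !sd -!mulrA -mulrDr ler_wpM2l ?invr_ge0 ?(ltW s0)//.
set x := s `^ (- d1) * mu1 s; set y := s `^ (- d2) * mu2 s.
have xx0 : 0 <= x by rewrite mulr_ge0 ?powR_ge0.
have yy0 : 0 <= y by rewrite mulr_ge0 ?powR_ge0.
have -> : mu1 s `^ a1 * mu2 s `^ a2 = x `^ a1 * y `^ a2.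
  rewrite /x /y !powRM ?powR_ge0// -!powRrM.
  have -> : s `^ (- d1 * a1) * mu1 s `^ a1 * (s `^ (- d2 * a2) * mu2 s `^ a2) =
    (s `^ (- d1 * a1) * s `^ (- d2 * a2)) * (mu1 s `^ a1 * mu2 s `^ a2) by ring.
  rewrite -powRD; last by apply/implyP => _; rewrite gt_eqF.
  have -> : - d1 * a1 + - d2 * a2 = 0 by move: ad; lra.
  by rewrite powRr0 mul1r.
have M0 : 0 <= x + y by rewrite addr_ge0.
apply: (@le_trans _ _ ((x + y) `^ a1 * (x + y) `^ a2)).
  apply: ler_pM; rewrite ?powR_ge0//; apply: ge0_ler_powR; rewrite ?nnegrE ?(ltW a10) ?(ltW a20)//.
    by rewrite lerDl.
  by rewrite lerDr.
have [z0|z0] := eqVneq (x + y) 0; first by rewrite z0 !powR0 ?gt_eqF// mul0r.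
rewrite -powRD; last by rewrite z0 implybT.
by rewrite a12 powRr1.
Qed.

End dyadic.

(** * Space-time weights *)

Section weights.
Context (R : realType) (n : nat).
Local Notation lambda := (lebesgue_measure_n R n).
Local Notation leb := (@lebesgue_measure R).
Implicit Types (x : euclidean R n) (f : euclidean R n -> R).

Lemma jpow_le (b c c' : R) x : 0 <= b -> 0 < c -> c <= c' -> jpow b c x <= jpow b c' x.
Proof.
move=> b0 c0 cc'; have c'0 := lt_le_trans c0 cc'.
have h e : 0 < e -> 0 < 1 + dotn x x / e.
  by move=> e0; apply: ltr_pwDl => //; rewrite divr_ge0 ?dotn_ge0 ?(ltW e0).
rewrite /jpow !powRN lef_pV2 ?posrE ?powR_gt0 ?h//.
have hc := h _ c0; have hc' := h _ c'0.
apply: ge0_ler_powR; rewrite ?nnegrE ?(ltW hc) ?(ltW hc')//.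
by rewrite lerD2l ler_wpM2l ?dotn_ge0// lef_pV2.
Qed.

(** From e^u >= 1 + u and ln(1 + t) <= t. It quantifies the convergence of the dilates to 1 as c
    grows. *)
Lemma jpow_ge (b c : R) x : 0 <= b -> 0 < c -> 1 - b * dotn x x / c <= jpow b c x.
Proof.
move=> b0 c0; have u0 : 0 <= dotn x x / c by rewrite divr_ge0 ?dotn_ge0 ?(ltW c0).
have u1 : 0 < 1 + dotn x x / c by apply: ltr_pwDl.
rewrite /jpow /powR gt_eqF//; apply: le_trans (expR_ge1Dx _).
rewrite lerD2l mulNr lerN2 -mulrA ler_wpM2l// le_ln1Dx//.
exact: lt_le_trans u0.
Qed.

(** The change of variables x -> 2^k x, read off from the Fourier transform at frequency 0. *)
Lemma Rintegral_jpow (b : R) k : n%:R / 2 < b ->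
  \int[lambda]_x jpow b (4 ^+ k) x = (2 ^+ n) ^+ k * \int[lambda]_x jpow b 1 x.
Proof.
move=> bn; pose o : euclidean R n := [tuple (0 : measurableTypeR R) | _ < n].
have o0 x : dotn x o = 0 by rewrite /dotn big1// => i _; rewrite tnth_mktuple mulr0.
have E c : 0 < c -> \int[lambda]_x jpow b c x =
    Num.sqrt c ^+ n * (Num.sqrt pi ^+ n / Gam b * bessel (b - n%:R / 2) 0).
  move=> c0; transitivity (ftre (jpow b c) o).
    by apply: eq_Rintegral => x _; rewrite o0 cos0 mulr1.
  rewrite ftre_jpow// o0 mulr0 mul0r sqrtrM ?pi_ge0// exprMn; ring.
rewrite !E// ?exprn_gt0// sqrtr1 expr1n mul1r; congr (_ * _).
rewrite (_ : 4 = 2 ^+ 2); last by rewrite -natrX.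
by rewrite exprAC sqrtr_sqr ger0_norm ?exprn_ge0// exprAC.
Qed.

Definition abscoef (s : seq (R * R)) : seq (R * R) := [seq (`|w.1|, w.2) | w <- s].

(** Up to the factor c^(- sigma) a nonnegative majorant of |psi|, which still telescopes along c =
    4^k. *)
Definition jdiff s (c : R) x : R := jcomb (abscoef s) (4 * c) x - jcomb (abscoef s) c x.

Variables (sigma b : R) (s : seq (R * R)).
Hypotheses (sigma0 : 0 < sigma) (bn : n%:R / 2 < b).
Hypothesis hs : forall w, w \in s -> n%:R / 2 < w.2.

Definition tphi (c : R) x := 4 `^ sigma * jpow b (4 * c) x + (- 1) * jpow b c x.
Definition tpsi (c : R) x := c `^ (- sigma) * jcomb s (4 * c) x + (- c `^ (- sigma)) * jcomb s c x.

Let b0 : 0 <= b.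
Proof. by apply: ltW; apply: le_lt_trans bn; rewrite divr_ge0. Qed.

Let hs0 w : w \in s -> 0 <= w.2.
Proof. by move=> ws; apply: ltW; apply: le_lt_trans (hs ws); rewrite divr_ge0. Qed.

Let le4 (c : R) : 0 < c -> c <= 4 * c.
Proof. by move=> c0; rewrite ler_peMl ?(ltW c0)// ler1n. Qed.

Lemma jdiff_ge0 (c : R) x : 0 < c -> 0 <= jdiff s c x.
Proof.
move=> c0; rewrite subr_ge0 /jcomb !big_map big_seq [leRHS]big_seq; apply: ler_sum => w ws /=.
by rewrite ler_wpM2l// jpow_le ?hs0 ?le4.
Qed.

Lemma tpsi_le (c : R) x : 0 < c -> `|tpsi c x| <= c `^ (- sigma) * jdiff s c x.
Proof.
move=> c0; rewrite /tpsi mulNr -mulrBr normrM (ger0_norm (powR_ge0 _ _)) ler_wpM2l ?powR_ge0//.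
rewrite /jdiff /jcomb !big_map -!sumrB (le_trans (ler_norm_sum _ _ _))//.
rewrite big_seq [leRHS]big_seq; apply: ler_sum => w ws /=.
rewrite -!mulrBr normrM ler_wpM2l// ger0_norm// subr_ge0.
by rewrite jpow_le ?hs0 ?le4.
Qed.

Lemma four_powR_ge1 : 1 <= 4 `^ sigma :> R.
Proof. have h : (1 : R) <= 4 by rewrite ler1n.
by have := ler_powR h (ltW sigma0); rewrite powRr0. Qed.

Lemma tphi_ge0 (c : R) x : 0 < c -> 0 <= tphi c x.
Proof.
move=> c0; rewrite /tphi mulN1r subr_ge0 (le_trans (jpow_le x b0 c0 (le4 c0)))//.
by rewrite ler_peMl ?powR_ge0// four_powR_ge1.
Qed.

Lemma tphi_le (c : R) x : 0 < c -> tphi c x <= 4 `^ sigma * jpow b (4 * c) x.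
Proof. by move=> c0; rewrite /tphi mulN1r gerBl powR_ge0. Qed.

Lemma sum_jdiff_le x N : \sum_(k < N) jdiff s (4 ^+ k) x <= \sum_(w <- s) `|w.1|.
Proof.
have -> : \sum_(k < N) jdiff s (4 ^+ k) x = jcomb (abscoef s) (4 ^+ N) x - jcomb (abscoef s) 1 x.
  elim: N => [|N IHN]; first by rewrite big_ord0 expr0 subrr.
  by rewrite big_ord_recr/= IHN /jdiff -exprS addrC addrA subrK.
rewrite (@le_trans _ _ (jcomb (abscoef s) (4 ^+ N) x))//.
  rewrite gerBl /jcomb big_map sumr_ge0// => w _.
  by rewrite /= mulr_ge0 ?powR_ge0.
rewrite /jcomb big_map big_seq [leRHS]big_seq; apply: ler_sum => w ws /=.
by rewrite ler_piMr// jpow_le1 ?exprn_gt0// hs0.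
Qed.

Lemma measurable_jpow (e c : R) : measurable_fun setT (@jpow R n e c).
Proof.
apply: (measurableT_comp (measurable_powR _)); apply: measurable_funD => //.
by apply: measurable_funM => //; exact: measurable_dotn.
Qed.

Lemma measurable_jcomb (l : seq (R * R)) (c : R) : measurable_fun setT (@jcomb R n l c).
Proof.
apply: measurable_sum => w; apply: measurable_funM => //; exact: measurable_jpow.
Qed.

Lemma measurable_tphi (c : R) : measurable_fun setT (tphi c).
Proof. by apply: measurable_funD; apply: measurable_funM => //; exact: measurable_jpow. Qed.

Lemma measurable_jdiff l (c : R) : measurable_fun setT (jdiff l c).
Proof. by apply: measurable_funB; exact: measurable_jcomb. Qed.

Variable X : R.
Hypothesis X2 : 2 <= X.

Let X0 k : 0 < X ^+ k.
Proof. by rewrite exprn_gt0// (lt_le_trans _ X2). Qed.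

Let c0 k : 0 < 4 ^+ k :> R.
Proof. by rewrite exprn_gt0. Qed.

(** X^k is the time scale T_k. The first summand majorises the products of phi with a derivative of
    eta, the second one all products with psi. *)
Definition weight (k : nat) (z : measurableTypeR R * euclidean R n) : R :=
  \1_(`]2^-1 * X ^+ k, X ^+ k]%classic : set R) z.1 * tphi (4 ^+ k) z.2 +
  \1_(`]0, X ^+ k]%classic : set R) z.1 * jdiff s (4 ^+ k) z.2.

Lemma measurable_weight k : measurable_fun setT (weight k).
Proof.
have mI (i : interval R) :
    measurable_fun setT (fun z : measurableTypeR R * euclidean R n => \1_([set` i]) z.1 : R).
  apply: (measurableT_comp _ measurable_fst).
  by apply: measurable_indic; exact: measurable_itv.
by apply: measurable_funD; apply: measurable_funM; rewrite ?mI//;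
  apply: (measurableT_comp _ measurable_snd); [exact: measurable_tphi|exact: measurable_jdiff].
Qed.

Lemma weight_ge0 k z : 0 <= weight k z.
Proof. by rewrite addr_ge0// mulr_ge0 ?tphi_ge0 ?jdiff_ge0. Qed.

Lemma sum_weight_le N z : \sum_(k < N) weight k z <= 4 `^ sigma + \sum_(w <- s) `|w.1|.
Proof.
rewrite big_split/= lerD//; last first.
  apply: le_trans (sum_jdiff_le z.2 N); apply: ler_sum => k _.
  by rewrite ler_piMl ?jdiff_ge0// indicE lern1 leq_b1.
apply: (@le_trans _ _ (\sum_(k < N) \1_(`]2^-1 * X ^+ k, X ^+ k]%classic : set R) z.1 * 4 `^ sigma)).
  apply: ler_sum => k _; rewrite ler_wpM2l//.
  apply: le_trans (tphi_le _ (c0 k)) _; rewrite ler_piMr ?powR_ge0//.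
  by rewrite jpow_le1 ?mulr_gt0.
rewrite -mulr_suml ler_piMl ?powR_ge0//.
(* Strengthened for the induction: at most one of the intervals contains the time, and none does
   unless it is at most X^N / 2, the left end of the next interval. *)
apply: (@le_trans _ _ (((z.1 : R) <= 2^-1 * X ^+ N)%R%:R : R)); last by rewrite lern1 leq_b1.
elim: N => [|N IHN]; first by rewrite big_ord0.
rewrite big_ord_recr/=; apply: le_trans (lerD IHN (lexx _)) _.
have h : X ^+ N <= 2^-1 * X ^+ N.+1.
  by rewrite exprS mulrA ler_peMl ?(ltW (X0 N))//; move: X2; lra.
have h' : 2^-1 * X ^+ N <= X ^+ N by move: (X0 N); lra.
rewrite indicE mem_setE in_itv/=.
have [t1|t1] /= := leP z.1 (2^-1 * X ^+ N).
  by rewrite addr0 (le_trans t1 (le_trans h' h)).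
rewrite add0r; have [t2|t2] /= := leP z.1 (X ^+ N); last by [].
by rewrite (le_trans t2 h).
Qed.

Lemma sum_weight_shift_le k0 N z :
  \sum_(k < N) weight (k0 + k) z <= 4 `^ sigma + \sum_(w <- s) `|w.1|.
Proof.
apply: le_trans (sum_weight_le (k0 + N) z); rewrite big_split_ord/= lerDr sumr_ge0// => k _.
exact: weight_ge0.
Qed.

Lemma integral_weight_le : exists2 C, 0 < C & forall k,
  (\int[@spacetime_measure R n]_(z in @spacetime R n) (weight k z)%:E <= (C * (X * 2 ^+ n) ^+ k)%:E)%E.
Proof.
(* At scale 4^(k+1) this combination dominates both [tphi] and [jdiff] at c = 4^k, whose positive
   parts sit at the scale 4 c. *)
pose l := (4 `^ sigma, b) :: abscoef s.
have hl w : w \in l -> n%:R / 2 < w.2.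
  by rewrite in_cons => /orP[/eqP->//|/mapP[v /hs vs ->]].
pose J := \sum_(w <- l) w.1 * \int[lambda]_x jpow w.2 1 x.
have J0 : 0 <= J.
  have Jw (e : R) : 0 <= \int[lambda]_x jpow e 1 x.
    by apply: Rintegral_ge0 => x _; exact: powR_ge0.
  rewrite /J big_cons; apply: addr_ge0; first by rewrite /= mulr_ge0 ?powR_ge0.
  by rewrite big_map; apply: sumr_ge0 => w _; rewrite /= mulr_ge0.
(* [J] is only known to be nonnegative; the summand 1 makes the constant positive. *)
exists (2 ^+ n * J + 1); first by rewrite ltr_wpDl// mulr_ge0// exprn_ge0.
move=> k; pose I : set R := `]0, X ^+ k]%classic.
have iI : leb.-integrable setT (EFin \o (\1_I : R -> R)).
  exact: integrable_indic_itv.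
have ij : lambda.-integrable setT (EFin \o jcomb l (4 ^+ k.+1)) by exact: integrable_jcomb.
have iP := integrable_prod iI ij.
have P0 z : 0 <= (\1_I z.1 : R) * jcomb l (4 ^+ k.+1) (z.2 : euclidean R n).
  rewrite mulr_ge0// /jcomb big_cons addr_ge0 ?mulr_ge0 ?powR_ge0//.
  by rewrite big_map sumr_ge0// => w _; rewrite /= mulr_ge0 ?powR_ge0.
have mspace : measurable (@spacetime R n).
  by apply: measurableX; [exact: measurable_itv|exact: measurableT].
apply: (@le_trans _ _ (\int[@spacetime_measure R n]_z
    (\1_I z.1 * jcomb l (4 ^+ k.+1) z.2)%:E)%E).
  apply: (@le_trans _ _ (\int[@spacetime_measure R n]_(z in @spacetime R n)
    (\1_I z.1 * jcomb l (4 ^+ k.+1) z.2)%:E)%E).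
    apply: ge0_le_integral => //.
    - by move=> z _; rewrite lee_fin weight_ge0.
    - by apply/measurable_EFinP; apply: measurable_funTS; exact: measurable_weight.
    - by apply: measurable_funTS; exact: measurable_int iP.
    move=> z _; rewrite lee_fin /weight /jcomb big_cons [leRHS]mulrDr/= exprS; apply: lerD.
      apply: ler_pM; rewrite ?tphi_ge0 ?tphi_le//.
      rewrite ler_nat /I !mem_setE !in_itv/=; case: (leP z.1 (X ^+ k)); rewrite ?andbF//=.
      move=> _; rewrite !andbT; case: ltP => //= h; rewrite (lt_trans _ h)//.
      by rewrite mulr_gt0.
    rewrite ler_wpM2l// /jdiff gerBl /jcomb big_map sumr_ge0// => w _.
    by rewrite /= mulr_ge0 ?powR_ge0.
  apply: ge0_subset_integral => //; first exact: measurable_int iP.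
  by move=> z _; rewrite lee_fin.
have E : \int[@spacetime_measure R n]_z (\1_I z.1 * jcomb l (4 ^+ k.+1) z.2) =
    X ^+ k * ((2 ^+ n) ^+ k.+1 * J).
  have [|_ ->] := @Rintegral_fubini1 _ _ _ _ _ leb lambda _ iP.
    by move=> t; exact: (integrable_scale (\1_I t) measurableT ij).
  transitivity (\int[leb]_t ((2 ^+ n) ^+ k.+1 * J * \1_I t)).
    apply: eq_Rintegral => t _; rewrite /= RintegralZl// mulrC; congr (_ * _).
    transitivity (ftre (jcomb l (4 ^+ k.+1)) [tuple (0 : measurableTypeR R) | _ < n]).
      apply: eq_Rintegral => x _.
      by rewrite /dotn big1 ?cos0 ?mulr1// => i _; rewrite tnth_mktuple mulr0.
    rewrite ftre_jcomb// mulr_sumr big_seq [RHS]big_seq; apply: eq_bigr => w wl.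
    rewrite mulrCA -Rintegral_jpow ?hl//; congr (_ * _); apply: eq_Rintegral => x _.
    by rewrite /dotn big1 ?cos0 ?mulr1// => i _; rewrite tnth_mktuple mulr0.
  rewrite RintegralZl// mulrC; congr (_ * _).
  rewrite /Rintegral integral_indic//; last exact: measurable_itv.
  by rewrite setIT /I/= lebesgue_measure_itv/= lte_fin X0 -EFinB/= subr0.
have := integrable_fin_num measurableT iP; move=> /fineK <-; rewrite lee_fin.
move: E; rewrite /Rintegral => ->.
have -> : X ^+ k * ((2 ^+ n) ^+ k.+1 * J) = (2 ^+ n * J) * (X * 2 ^+ n) ^+ k.
  by rewrite exprMn exprS; ring.
by rewrite ler_wpM2r ?lerDl// exprn_ge0// mulr_ge0 ?exprn_ge0// (le_trans _ X2).
Qed.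

End weights.

(** * Bounds for the adjoint operators *)

Section adjoint_bounds.
Context (R : realType) (n : nat).
Variables (sigma b : R) (s : seq (R * R)).
Hypotheses (sigma0 : 0 < sigma) (bn : n%:R / 2 < b).
Hypothesis hs : forall w, w \in s -> n%:R / 2 < w.2.
Variables (eta : R -> R) (C : R).
Hypothesis deta : forall k t, derivable (derive1n k eta) t 1.
Hypothesis eta01 : forall t, 0 <= eta t <= 1.
Hypothesis eta1 : forall t, t <= 2^-1 -> eta t = 1.
Hypothesis eta0 : forall t, 1 <= t -> eta t = 0.
Hypothesis etaC : forall k t, (1 <= k <= 2)%N ->
  `|derive1n k eta t| <= C /\ (t <= 2^-1 \/ 1 <= t -> derive1n k eta t = 0).

Lemma time_test_scale (T : R) : 0 < T -> time_test (fun t => eta (T^-1 * t)).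
Proof.
move=> T0; split.
- by move=> k t _; exact: derivable_scale.
- exists (2^-1 * T); first by rewrite mulr_gt0.
  by move=> t /andP[_ tT]; rewrite eta1// mulrC ler_pdivrMr// ltW.
- by exists T => t Tt; rewrite eta0// mulrC ler_pdivlMr ?mul1r.
Qed.

Lemma cutoff_scale_ge0 (T t : R) : 0 <= eta (T^-1 * t).
Proof. by have /andP[] := eta01 (T^-1 * t). Qed.

Lemma cutoff_scale_le (T t : R) : 0 < T -> 0 < t ->
  eta (T^-1 * t) <= \1_(`]0, T]%classic : set R) t.
Proof.
move=> T0 t0; rewrite indicE mem_setE in_itv/= t0/=.
have [tT|Tt] := leP t T; first by have /andP[] := eta01 (T^-1 * t).
by rewrite eta0// mulrC ler_pdivlMr ?mul1r ?ltW.
Qed.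

Lemma derive_cutoff_scale_le (T t : R) (j : nat) : 0 < T -> (1 <= j <= 2)%N ->
  `|derive1n j (fun t => eta (T^-1 * t)) t| <=
  C * T^-1 ^+ j * \1_(`]2^-1 * T, T]%classic : set R) t.
Proof.
move=> T0 hj; rewrite derive1n_scale// normrM ger0_norm ?exprn_ge0 ?invr_ge0 ?(ltW T0)//.
have [h1 h2] := etaC (T^-1 * t) hj.
rewrite [C * _]mulrC -mulrA ler_wpM2l ?exprn_ge0 ?invr_ge0 ?(ltW T0)//.
rewrite indicE mem_setE in_itv/=.
have [t1|t1] /= := leP t (2^-1 * T).
  by rewrite mulr0 h2 ?normr0//; left; rewrite mulrC ler_pdivrMr.
have [t2|t2] /= := leP t T; first by rewrite mulr1.
by rewrite mulr0 h2 ?normr0//; right; rewrite mulrC ler_pdivlMr ?mul1r ?ltW.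
Qed.

Let C_ge0 : 0 <= C.
Proof. by apply: le_trans (proj1 (@etaC 1 0 isT)). Qed.

Let ind_le (T t : R) : 0 < T ->
  \1_(`]2^-1 * T, T]%classic : set R) t <= \1_(`]0, T]%classic : set R) t :> R.
Proof.
move=> T0; rewrite !indicE !mem_setE !in_itv/= ler_nat.
case: (leP t T); rewrite ?andbF//= => _; rewrite !andbT.
by case: ltP => //= h; rewrite (lt_trans _ h)// mulr_gt0.
Qed.

Variable X : R.
Hypothesis X2 : 2 <= X.

Let X0 k : 0 < X ^+ k.
Proof. by rewrite exprn_gt0// (lt_le_trans _ X2). Qed.

Let XV_le1 k : (X ^+ k)^-1 <= 1.
Proof. by rewrite invf_le1// exprn_ege1// (le_trans _ X2)// ler1n. Qed.

Let XV_ge0 k : 0 <= (X ^+ k)^-1. Proof. by rewrite invr_ge0 ltW. Qed.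

Let c0 k : 0 < 4 ^+ k :> R. Proof. by rewrite exprn_gt0. Qed.

Definition cutoff k (t : R) := eta ((X ^+ k)^-1 * t).

Let phi k := @tphi R n sigma b (4 ^+ k).
Let psi k := @tpsi R n sigma s (4 ^+ k).
Let W := @weight R n sigma b s X.

Let eta_psi_le k (t : R) x : 0 < t ->
  `|cutoff k t * psi k x| <=
  (4 ^+ k) `^ (- sigma) * (\1_(`]0, X ^+ k]%classic : set R) t * jdiff s (4 ^+ k) x).
Proof.
move=> t0; rewrite normrM (ger0_norm (cutoff_scale_ge0 _ _)) mulrCA.
apply: ler_pM => //; first exact: cutoff_scale_ge0.
- exact: cutoff_scale_le.
- exact: tpsi_le.
Qed.

(** With T = X^k and T^-1 = 4^(- k sigma), eta' scales exactly like the fractional Laplacian and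
    eta'' gains a further factor T^-1 <= 1. Two terms with constant C and one with constant 1 make 2
    C + 1. *)
Lemma damped_adjoint_le k (z : measurableTypeR R * euclidean R n) :
  (X ^+ k)^-1 = (4 ^+ k) `^ (- sigma) -> spacetime z ->
  `|derive1n 2 (cutoff k) z.1 * phi k z.2 - derive1n 1 (cutoff k) z.1 * phi k z.2
    + cutoff k z.1 * psi k z.2| <= (2 * C + 1) * (4 ^+ k) `^ (- sigma) * W k z.
Proof.
case: z => t x hX [tpos _]; have t0 : 0 < t by move: tpos; rewrite /= in_itv/= andbT.
have h2 := @derive_cutoff_scale_le _ t 2 (X0 k) isT.
have h1 := @derive_cutoff_scale_le _ t 1 (X0 k) isT.
have h0 := eta_psi_le k x t0.
have p0 : 0 <= phi k x by exact: tphi_ge0.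
have j0 : 0 <= jdiff s (4 ^+ k) x by exact: jdiff_ge0.
rewrite -hX; move: h0 h1 h2; rewrite -/(cutoff k) -hX; set e := (X ^+ k)^-1.
set i1 : R := \1_(`]2^-1 * X ^+ k, X ^+ k]%classic : set R) t.
set i0 : R := \1_(`]0, X ^+ k]%classic : set R) t => h0 h1 h2.
rewrite -[(t, x).1]/t -[(t, x).2]/x (_ : W k (t, x) = i1 * phi k x + i0 * jdiff s (4 ^+ k) x)//.
set d2 := derive1n 2 _ t in h2 *; set d1 := derive1n 1 _ t in h1 *.
have i10 : 0 <= i1 by rewrite /i1.
have i00 : 0 <= i0 by rewrite /i0.
rewrite (le_trans (ler_normD _ _))//.
have h2' : `|d2 * phi k x| <= C * e * (i1 * phi k x).
  rewrite normrM (ger0_norm p0) mulrA ler_wpM2r// (le_trans h2)// ler_wpM2r// ler_wpM2l//.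
  by rewrite expr2 ler_piMl// ?XV_ge0 ?XV_le1.
have h1' : `|d1 * phi k x| <= C * e * (i1 * phi k x).
  by rewrite normrM (ger0_norm p0) mulrA ler_wpM2r// (le_trans h1).
have := ler_normB (d2 * phi k x) (d1 * phi k x).
have a1 : 0 <= e * (i1 * phi k x) by rewrite mulr_ge0 ?XV_ge0 ?mulr_ge0.
have a2 : 0 <= C * (e * (i0 * jdiff s (4 ^+ k) x)) by rewrite !mulr_ge0 ?XV_ge0.
move: h0 h1' h2' a1 a2; nra.
Qed.

(** Now eta'' scales like the fractional Laplacian, T^-2 = 4^(- k sigma). In eta' psi this factor
    already comes from psi, so T^-1 <= 1 is enough there; the time interval of eta' is enlarged to
    ]0, T] to fit the second summand of the weight. *)
Lemma strongly_damped_adjoint_le k (z : measurableTypeR R * euclidean R n) :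
  (X ^+ k)^-1 ^+ 2 = (4 ^+ k) `^ (- sigma) -> spacetime z ->
  `|derive1n 2 (cutoff k) z.1 * phi k z.2 - derive1n 1 (cutoff k) z.1 * psi k z.2
    + cutoff k z.1 * psi k z.2| <= (2 * C + 1) * (4 ^+ k) `^ (- sigma) * W k z.
Proof.
case: z => t x hX [tpos _]; have t0 : 0 < t by move: tpos; rewrite /= in_itv/= andbT.
have h2 := @derive_cutoff_scale_le _ t 2 (X0 k) isT.
have h1 := @derive_cutoff_scale_le _ t 1 (X0 k) isT.
have h0 := eta_psi_le k x t0.
have p0 : 0 <= phi k x by exact: tphi_ge0.
have j0 : 0 <= jdiff s (4 ^+ k) x by exact: jdiff_ge0.
have q0 : `|psi k x| <= (4 ^+ k) `^ (- sigma) * jdiff s (4 ^+ k) x by exact: tpsi_le.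
have i01 := ind_le t (X0 k).
move: i01 h0 h1 h2 q0; rewrite -/(cutoff k); set e := (4 ^+ k) `^ (- sigma).
have e0 : 0 <= e by exact: powR_ge0.
set i1 : R := \1_(`]2^-1 * X ^+ k, X ^+ k]%classic : set R) t.
set i0 : R := \1_(`]0, X ^+ k]%classic : set R) t => i01 h0 h1 h2 q0.
rewrite -[(t, x).1]/t -[(t, x).2]/x (_ : W k (t, x) = i1 * phi k x + i0 * jdiff s (4 ^+ k) x)//.
set d2 := derive1n 2 _ t in h2 *; set d1 := derive1n 1 _ t in h1 *.
have i10 : 0 <= i1 by rewrite /i1.
have i00 : 0 <= i0 by rewrite /i0.
rewrite (le_trans (ler_normD _ _))//.
have h2' : `|d2 * phi k x| <= C * (e * (i1 * phi k x)).
  by rewrite normrM (ger0_norm p0) !mulrA ler_wpM2r// (le_trans h2)// hX.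
have h1' : `|d1 * psi k x| <= C * (e * (i0 * jdiff s (4 ^+ k) x)).
  rewrite normrM (_ : C * _ = (C * i0) * (e * jdiff s (4 ^+ k) x)); last by ring.
  apply: ler_pM => //; rewrite (le_trans h1)// expr1; apply: ler_pM => //.
    by rewrite mulr_ge0 ?XV_ge0.
  by rewrite ler_piMr ?XV_le1.
have := ler_normB (d2 * phi k x) (d1 * psi k x).
have a1 : 0 <= e * (i1 * phi k x) by rewrite mulr_ge0 ?mulr_ge0.
have a2 : 0 <= C * (e * (i0 * jdiff s (4 ^+ k) x)) by rewrite !mulr_ge0.
have a3 : 0 <= C * (e * (i1 * phi k x)) by rewrite mulr_ge0.
move: h0 h1' h2' a1 a2 a3; nra.
Qed.

End adjoint_bounds.

(** * From one weak identity to one Dini integral *)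

Section single_equation.
Context (R : realType) (n : nat).
Local Notation lambda := (lebesgue_measure_n R n).
Local Notation stm := (@spacetime_measure R n).
Variables (sigma b : R) (s : seq (R * R)).
Hypotheses (sigma0 : 0 < sigma) (bn : n%:R / 2 < b).
Hypothesis hs : forall w, w \in s -> n%:R / 2 < w.2.

Let phi k := @tphi R n sigma b (4 ^+ k).

Let b0 : 0 <= b.
Proof. by apply: ltW; apply: le_lt_trans bn; rewrite divr_ge0. Qed.

Let c0 k : 0 < 4 ^+ k :> R. Proof. by rewrite exprn_gt0. Qed.

Lemma four_powR_gt1 : 1 < 4 `^ sigma :> R.
Proof.
rewrite /powR gt_eqF// expR_gt1 mulr_gt0// ln_gt0//.
by rewrite (_ : 1 = 1%:R)// ltr_nat.
Qed.

(** Both dilates tend to 1 with error O(4^(-k)) at each point, which leaves the difference of their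
    coefficients. It is positive, so the data term keeps the sign of the mean. *)
Lemma cvg_tphi x : phi k x @[k --> \oo] --> 4 `^ sigma - 1.
Proof.
pose M := 4 `^ sigma * (b * dotn x x).
have s1 : 1 <= 4 `^ sigma by exact/ltW/four_powR_gt1.
have d0 : 0 <= b * dotn x x by rewrite mulr_ge0 ?dotn_ge0.
have q0 : M * 4^-1 ^+ k @[k --> \oo] --> (0 : R).
  rewrite -[X in _ --> X](mulr0 M); apply: cvgM; first exact: cvg_cst.
  by apply: cvg_expr; rewrite ger0_norm// invf_lt1// (_ : 1 = 1%:R)// ltr_nat.
apply: (@squeeze_cvgr _ _ _ _ (fun k => (4 `^ sigma - 1) - M * 4^-1 ^+ k)
    (fun k => (4 `^ sigma - 1) + M * 4^-1 ^+ k)).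
- apply: nearW => k.
  have h1 := jpow_le1 x (c0 k) b0; have h2 := jpow_ge x b0 (c0 k).
  have c40 : 0 < 4 * 4 ^+ k :> R by rewrite mulr_gt0.
  have h3 := jpow_le1 x c40 b0; have h4 := jpow_ge x b0 c40.
  have -> : M * 4^-1 ^+ k = 4 `^ sigma * (b * dotn x x / 4 ^+ k) by rewrite /M exprVn -mulrA.
  have e0 : 0 <= b * dotn x x / 4 ^+ k by rewrite divr_ge0// ltW.
  have e4 : b * dotn x x / (4 * 4 ^+ k) = b * dotn x x / 4 ^+ k / 4.
    by rewrite invfM [4^-1 * _]mulrC mulrA.
  rewrite e4 in h4; rewrite /phi /tphi.
  move: h1 h2 h3 h4 e0; set u := b * _ / _; set j4 := jpow b (4 * _) x; set j := jpow b _ x.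
  move=> h1 h2 h3 h4 e0; apply/andP; split; nra.
- by rewrite -[X in _ --> X]subr0; apply: cvgB => //; exact: cvg_cst.
- by rewrite -[X in _ --> X]addr0; apply: cvgD => //; exact: cvg_cst.
Qed.

Lemma cvg_Rintegral_tphi (f : euclidean R n -> R) : lambda.-integrable setT (EFin \o f) ->
  \int[lambda]_x (f x * phi k x) @[k --> \oo] --> (4 `^ sigma - 1) * \int[lambda]_x f x.
Proof.
move=> intf; have mf : measurable_fun setT f by apply/measurable_EFinP; exact: measurable_int intf.
have ig : lambda.-integrable setT (EFin \o (fun x => 4 `^ sigma * `|f x|)).
  by apply: integrable_scale => //; exact: integrable_norm.
have [||||ilim _ h] := @dominated_convergence _ _ R lambda setT measurableT
    (fun k x => (f x * phi k x)%:E) (fun x => ((4 `^ sigma - 1) * f x)%:E) _ _ _ _ ig.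
- move=> k; apply/measurable_EFinP; apply: measurable_funM => //; exact: measurable_tphi.
- by apply/measurable_EFinP; exact: measurable_funM.
- apply: aeW => x _; apply: cvg_EFin; first exact: nearW.
  by rewrite mulrC; apply: cvgM; [exact: cvg_cst|exact: cvg_tphi].
- apply: aeW => x k _; rewrite lee_fin normrM mulrC ler_wpM2r// ger0_norm ?tphi_ge0//.
  apply: le_trans (tphi_le _ _ _ (c0 k)) _; rewrite ler_piMr ?powR_ge0//.
  by rewrite jpow_le1 ?mulr_gt0.
rewrite -RintegralZl//; apply: fine_cvg; rewrite fineK//.
exact: integrable_fin_num ilim.
Qed.

Lemma Rintegral_tphi_lower (f : euclidean R n -> R) : lambda.-integrable setT (EFin \o f) ->
  0 < \int[lambda]_x f x ->
  exists2 e, 0 < e & exists k0, forall k, (k0 <= k)%N -> e <= \int[lambda]_x (f x * phi k x).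
Proof.
move=> intf f0; set l := (4 `^ sigma - 1) * \int[lambda]_x f x.
have l0 : 0 < l by rewrite mulr_gt0// subr_gt0 four_powR_gt1.
exists (l / 2); first by rewrite divr_gt0.
have l2 : l / 2 < l by rewrite ltr_pdivrMr// ltr_pMr// (_ : 1 = 1%:R)// ltr_nat.
have [k0 _ h] := cvgr_ge _ (cvg_Rintegral_tphi intf) _ l2.
by exists k0 => k; exact: h.
Qed.

Variables (X p d K : R) (mu : R -> R) (w : R -> euclidean R n -> R).
Variables (w1 : euclidean R n -> R) (F : R -> euclidean R n -> R).
Variables (eta : nat -> R -> R) (Lphi : nat -> R -> euclidean R n -> R).
Hypotheses (X2 : 2 <= X) (p1 : 1 < p) (hmu : modulus_of_continuity mu).
Hypothesis mw : measurable_fun (@spacetime R n) (fun z => w z.1 z.2).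
Hypothesis intPhi : stm.-integrable (@spacetime R n) (fun z => (Phi p mu `|w z.1 z.2|)%:E).
Hypotheses (intw1 : lambda.-integrable setT (EFin \o w1)) (w10 : 0 < \int[lambda]_x w1 x).
Hypotheses (F0 : forall t x, 0 <= F t x) (eta0 : forall k t, 0 <= eta k t).
Hypothesis etak0 : forall k, eta k 0 = 1.
Hypotheses (K0 : 0 < K).
Let W := @weight R n sigma b s X.
Hypothesis LphiK : forall k z, spacetime z ->
  `|Lphi k z.1 z.2| <= K * (4 ^+ k) `^ (- sigma) * W k z.
Hypothesis weakid : forall k, weak_identity w w1 F (eta k) (phi k) (Lphi k).

Let mspace : measurable (@spacetime R n).
Proof. by apply: measurableX; [exact: measurable_itv|exact: measurableT]. Qed.

Let mWD k : measurable_fun (@spacetime R n) (W k).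
Proof. by apply: measurable_funTS; exact: measurable_weight. Qed.

Let W0 k z : 0 <= W k z. Proof. exact: weight_ge0. Qed.

Lemma weighted_integral_lower : exists2 e, 0 < e & exists k0, forall k, (k0 <= k)%N ->
  ((e * (4 `^ sigma) ^+ k)%:E <= \int[stm]_(z in @spacetime R n) (`|w z.1 z.2| * W k z)%:E)%E.
Proof.
have [e e0 [k0 he]] := Rintegral_tphi_lower intw1 w10.
exists (e / K); first by rewrite divr_gt0.
exists k0 => k /he; have [iL] := weakid k; rewrite etak0 => hid ek.
have rhs0 : 0 <= \int[stm]_(z in @spacetime R n) (F z.1 z.2 * (eta k z.1 * phi k z.2)).
  by apply: Rintegral_ge0 => z _; rewrite mulr_ge0// mulr_ge0// tphi_ge0.
have E : \int[lambda]_x (w1 x * (1 * phi k x)) = \int[lambda]_x (w1 x * phi k x).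
  by apply: eq_Rintegral => x _; rewrite mul1r.
have h : e <= \int[stm]_(z in @spacetime R n) (w z.1 z.2 * Lphi k z.1 z.2).
  by move: hid rhs0 ek; rewrite E; lra.
pose q : R := (4 ^+ k) `^ (- sigma).
have q0 : 0 < q by rewrite powR_gt0.
have qE : q^-1 = (4 `^ sigma) ^+ k.
  rewrite /q powRN invrK -powR_mulrn// -powRrM mulrC powRrM powR_mulrn ?powR_ge0//.
have mwW : measurable_fun (@spacetime R n) (fun z => (`|w z.1 z.2| * W k z)%:E).
  by apply/measurable_EFinP; apply: measurable_funM => //; exact: measurableT_comp.
have step : (e%:E <= (K * q)%:E * \int[stm]_(z in @spacetime R n) (`|w z.1 z.2| * W k z)%:E)%E.
  have fi := integrable_fin_num mspace iL.
  apply: (@le_trans _ _ (\int[stm]_(z in @spacetime R n) (w z.1 z.2 * Lphi k z.1 z.2)%:E)%E).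
    by rewrite -(fineK fi) lee_fin.
  apply: le_trans (lee_abs _) _; apply: le_trans (le_abse_integral _ mspace (measurable_int _ iL)) _.
  rewrite -ge0_integralZl//.
  - apply: ge0_le_integral => //.
    + by apply: measurableT_comp => //; exact: measurable_int iL.
    + by under eq_fun do rewrite -EFinM; apply/measurable_EFinP;
        apply: measurable_funM => //; exact/measurable_EFinP.
    + move=> z Dz; rewrite -EFinM lee_fin normrM mulrCA ler_wpM2l//.
      exact: LphiK.
  - by move=> z _; rewrite lee_fin mulr_ge0.
  - by rewrite lee_fin mulr_ge0 ?(ltW K0) ?(ltW q0).
have Kq : 0 < K * q by rewrite mulr_gt0.
have -> : e / K * (4 `^ sigma) ^+ k = (K * q)^-1 * e by rewrite -qE; field; rewrite !gt_eqF.
rewrite EFinM; apply: le_trans (lee_wpmul2l _ step) _; first by rewrite lee_fin invr_ge0 ltW.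
by rewrite muleA -EFinM mulVf ?gt_eqF// mul1e.
Qed.

Hypothesis hX : 4 `^ sigma < X * 2 ^+ n.
(* 4^sigma / (X 2^n) is the ratio of the scales s_k: this makes 4^(k sigma) s_k^(p - 1)
   proportional to s_k^(- d). *)
Hypothesis hd : 4 `^ sigma * (4 `^ sigma / (X * 2 ^+ n)) `^ (p - 1 + d) = 1.

Lemma dini_of_weak_identity : dini d mu.
Proof.
have [e e0 [k0 he]] := weighted_integral_lower.
have [C C0 hC] := integral_weight_le sigma0 bn hs X2.
(* e G^k is the lower bound for the integral of |w| W_k, and C H^k the upper bound for that of
   W_k. *)
move: hX hd he hC; set G := 4 `^ sigma; set H := X * 2 ^+ n.
set rho := G / H => GH rhod he hC.
have G0 : 0 < G by rewrite powR_gt0.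
have H0 : 0 < H by exact: lt_trans GH.
have rho0 : 0 < rho by rewrite divr_gt0.
have rho1 : rho < 1 by rewrite ltr_pdivrMr// mul1r.
(* This makes s_k C H^k equal to e G^k / 2, so that [weighted_lower_bound] retains half of e G^k. *)
pose s0 := e / (2 * C); have s00 : 0 < s0 by rewrite divr_gt0// mulr_gt0.
pose sk k := s0 * rho ^+ k.
have sk0 k : 0 < sk k by rewrite mulr_gt0// exprn_gt0.
pose y k := (sk k) `^ (p - 1) * mu (sk k) * (e / 2 * G ^+ k).
pose Y k := (\int[stm]_(z in @spacetime R n) (Phi p mu `|w z.1 z.2| * W k z)%:E)%E.
have yY k : (k0 <= k)%N -> ((y k)%:E <= Y k)%E.
  move=> kk; have := @weighted_lower_bound _ _ R stm _ mspace p mu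
    (fun z => w z.1 z.2) p1 hmu mw intPhi (W k) (sk k) (e * G ^+ k) (C * H ^+ k)
    (ltW (sk0 k)) (mWD k) (fun z _ => W0 k z) (hC k) (he k kk).
  congr (_ <= _)%E; congr (_ %:E); rewrite /y; congr (_ * _).
  by rewrite /sk /s0 /rho expr_div_n; field; rewrite expf_neq0 ?gt_eqF.
pose M := 4 `^ sigma + \sum_(v <- s) `|v.1|.
pose I := \int[stm]_(z in @spacetime R n) Phi p mu `|w z.1 z.2|.
have ysum N : \sum_(k < N) y (k0 + k)%N <= M * I.
  rewrite -lee_fin -sumEFin.
  apply: (@le_trans _ _ (\sum_(k < N) Y (k0 + k)%N)%E).
    by apply: lee_sum => k _; apply: yY; exact: leq_addr.
  apply: (@weighted_sum_bound _ _ R stm _ mspace p mu (fun z => w z.1 z.2) hmu intPhi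
    (fun k => W (k0 + k)%N)) => //.
  by move=> z _; exact: sum_weight_shift_le.
(* The scales before k0 are discarded. The divisor is the constant ratio of [y (k0 + k)] to the Dini
   term s^(- d) mu(s) at s = [sk (k0 + k)]. *)
apply: (@dini_dyadic R d rho (sk k0) (M * I / (e / 2 * G ^+ k0 * sk k0 `^ (p - 1 + d)))) => //.
  by rewrite rho0.
move=> N; have c0' : 0 < e / 2 * G ^+ k0 * sk k0 `^ (p - 1 + d).
  by rewrite !mulr_gt0 ?powR_gt0 ?exprn_gt0// invr_gt0.
rewrite ler_pdivlMr// mulr_suml; apply: le_trans (ysum N); apply: ler_sum => k _.
have skE : sk k0 * rho ^+ k = sk (k0 + k)%N by rewrite /sk exprD mulrA.
rewrite skE /y le_eqVlt; apply/orP; left; apply/eqP.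
have -> : sk (k0 + k)%N `^ (p - 1) = sk (k0 + k)%N `^ (p - 1 + d) * sk (k0 + k)%N `^ (- d).
  rewrite -powRD; last by apply/implyP => _; rewrite gt_eqF.
  by rewrite addrK.
have -> : sk (k0 + k)%N `^ (p - 1 + d) = sk k0 `^ (p - 1 + d) * (rho `^ (p - 1 + d)) ^+ k.
  by rewrite -skE powR_mulexpn.
rewrite exprD.
have hk : G ^+ k * (rho `^ (p - 1 + d)) ^+ k = 1 by rewrite -exprMn rhod expr1n.
set a := _ `^ (- d); set m := mu _; set t := (rho `^ _) ^+ k in hk *.
transitivity (a * m * (e / 2 * G ^+ k0 * sk k0 `^ (p - 1 + d)) * (G ^+ k * t)).
  by rewrite hk mulr1.
ring.
Qed.

End single_equation.

(** * The two equations *)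

Section system.
Context (R : realType) (n : nat).
Local Notation lambda := (lebesgue_measure_n R n).
Variables (sigma p q : R) (mu1 mu2 : R -> R).
Variables (u1 v1 : euclidean R n -> R) (u v : R -> euclidean R n -> R).
Hypotheses (sigma1 : 1 < sigma) (sigman : sigma < n%:R) (p1 : 1 < p) (q1 : 1 < q).
Hypotheses (hmu1 : modulus_of_continuity mu1) (hmu2 : modulus_of_continuity mu2).
Hypothesis sol : sobolev_solution sigma p q mu1 mu2 u1 v1 u v.

Let sigma0 : 0 < sigma. Proof. exact: lt_trans sigma1. Qed.
Let nR0 : 0 < n%:R :> R. Proof. exact: lt_trans sigman. Qed.
Let n0 : (0 < n)%N. Proof. by rewrite -(ltr_nat R). Qed.

Let four_powR : 4 `^ sigma = 2 `^ sigma * 2 `^ sigma :> R.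
Proof. by rewrite -powRM// (_ : 2 * 2 = 4)// -natrM. Qed.

Let two_powR_ge2 : 2 <= 2 `^ sigma :> R.
Proof.
have h : (1 : R) <= 2 by rewrite ler1n.
by have := ler_powR h (ltW sigma1); rewrite powRr1.
Qed.

Let two_powR_gt0 (r : R) : 0 < 2 `^ r. Proof. by rewrite powR_gt0. Qed.

Let four_powR_opp k : (4 ^+ k) `^ (- sigma) = ((4 `^ sigma) ^+ k)^-1 :> R.
Proof.
rewrite powRN; congr (_^-1).
by rewrite -powR_mulrn// -powRrM mulrC powRrM powR_mulrn ?powR_ge0.
Qed.

Let two_powR_natr : 2 `^ n%:R = 2 ^+ n :> R.
Proof. by rewrite powR_mulrn. Qed.

(** With X = 4^sigma the scales s_k have ratio 2^(- n), and the balance of powers asks for n (p - 1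
    + d) = 2 sigma, whence the critical exponent 1 + 2 sigma / n. *)
Lemma damped_dini : lambda.-integrable setT (EFin \o v1) -> 0 < \int[lambda]_x v1 x ->
  dini (1 + 2 * sigma / n%:R - p) mu1.
Proof.
move=> iv1 v10; have [_ [intPhi _] _ hv] := sol; case: sol => [[_ mv] _ _ _].
have [b [s [bn hs hphi]]] := fractional_test_function n0 sigma0.
have [eta [C [deta eta01 eta1 eta0 etaC]]] := smooth_cutoff R.
have C0 : 0 <= C by apply: le_trans (proj1 (@etaC 1 0 isT)).
have X2 : 2 <= 4 `^ sigma :> R.
  by rewrite four_powR (le_trans two_powR_ge2)// ler_peMr ?(ltW (two_powR_gt0 _))//
    (le_trans _ two_powR_ge2)// ler1n.
have X0 k : 0 < (4 `^ sigma) ^+ k :> R by rewrite exprn_gt0// powR_gt0.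
have c0 k : 0 < 4 ^+ k :> R by rewrite exprn_gt0.
apply: (@dini_of_weak_identity R n sigma b s sigma0 bn hs (4 `^ sigma) p _ (2 * C + 1) mu1 v v1
  (fun t x => Phi q mu2 `|u t x|) (cutoff eta (4 `^ sigma))
  (fun k t x => derive1n 2 (cutoff eta (4 `^ sigma) k) t * tphi sigma b (4 ^+ k) x
     - derive1n 1 (cutoff eta (4 `^ sigma) k) t * tphi sigma b (4 ^+ k) x
     + cutoff eta (4 `^ sigma) k t * tpsi sigma s (4 ^+ k) x)) => //.
- by move=> t x; exact: (Phi_ge0 q hmu2).
- by move=> k t; exact: cutoff_scale_ge0.
- by move=> k; rewrite /cutoff mulr0 eta1.
- by rewrite ltr_wpDl// mulr_ge0.
- by move=> k z; apply: damped_adjoint_le.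
- move=> k; have [h1 h2] := hphi _ (c0 k).
  by apply: hv => //; exact: time_test_scale.
- by rewrite ltr_pMr ?powR_gt0// exprn_egt1 -?lt0n// (_ : 1 = 1%:R)// ltr_nat.
- have -> : 4 `^ sigma / (4 `^ sigma * 2 ^+ n) = 2 `^ (- n%:R) :> R.
    by rewrite powRN two_powR_natr; field; rewrite expf_neq0// gt_eqF// powR_gt0.
  rewrite -powRrM (_ : - n%:R * _ = - (sigma + sigma)); last by field; rewrite gt_eqF.
  rewrite powRN powRD; last by apply/implyP => _; rewrite gt_eqF.
  by rewrite four_powR; field; rewrite gt_eqF.
Qed.

(** With X = 2^sigma the ratio becomes 2^(- (n - sigma)), which is below 1 as sigma < n; accordingly
    n - sigma replaces n in the critical exponent. *)
Lemma strongly_damped_dini : lambda.-integrable setT (EFin \o u1) -> 0 < \int[lambda]_x u1 x ->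
  dini (1 + 2 * sigma / (n%:R - sigma) - q) mu2.
Proof.
move=> iu1 u10; have [_ [_ intPhi] hu _] := sol; case: sol => [[mu_ _] _ _ _].
have [b [s [bn hs hphi]]] := fractional_test_function n0 sigma0.
have [eta [C [deta eta01 eta1 eta0 etaC]]] := smooth_cutoff R.
have C0 : 0 <= C by apply: le_trans (proj1 (@etaC 1 0 isT)).
have X0 k : 0 < (2 `^ sigma) ^+ k :> R by rewrite exprn_gt0// powR_gt0.
have c0 k : 0 < 4 ^+ k :> R by rewrite exprn_gt0.
apply: (@dini_of_weak_identity R n sigma b s sigma0 bn hs (2 `^ sigma) q _ (2 * C + 1) mu2 u u1
  (fun t x => Phi p mu1 `|v t x|) (cutoff eta (2 `^ sigma))
  (fun k t x => derive1n 2 (cutoff eta (2 `^ sigma) k) t * tphi sigma b (4 ^+ k) x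
     - derive1n 1 (cutoff eta (2 `^ sigma) k) t * tpsi sigma s (4 ^+ k) x
     + cutoff eta (2 `^ sigma) k t * tpsi sigma s (4 ^+ k) x)) => //.
- by move=> t x; exact: (Phi_ge0 p hmu1).
- by move=> k t; exact: cutoff_scale_ge0.
- by move=> k; rewrite /cutoff mulr0 eta1.
- by rewrite ltr_wpDl// mulr_ge0.
- move=> k z; apply: strongly_damped_adjoint_le => //.
  by rewrite four_powR_opp exprVn -exprM mulnC exprM expr2 four_powR.
- move=> k; have [h1 h2] := hphi _ (c0 k).
  by apply: hu => //; exact: time_test_scale.
- rewrite four_powR ltr_pM2l// -two_powR_natr /powR gt_eqF// ltr_expR ltr_pM2r//.
  by rewrite ln_gt0// (_ : 1 = 1%:R)// ltr_nat.
- have -> : 4 `^ sigma / (2 `^ sigma * 2 ^+ n) = 2 `^ (- (n%:R - sigma)) :> R.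
    rewrite opprB powRD; last by apply/implyP => _; rewrite gt_eqF.
    rewrite powRN two_powR_natr four_powR; field.
    by rewrite expf_neq0// gt_eqF.
  rewrite -powRrM (_ : - (n%:R - sigma) * _ = - (sigma + sigma)); last first.
    by field; rewrite subr_eq0 gt_eqF.
  rewrite powRN powRD; last by apply/implyP => _; rewrite gt_eqF.
  by rewrite four_powR; field; rewrite gt_eqF.
Qed.

Hypothesis critical : Num.max ((2 * q + 1) / (p * q + q - 2))
  ((p * q + p + 1) / (2 * p * q - p - 1)) = n%:R / (2 * sigma).

(** For p, q > 1 both denominators are positive, so each branch of the maximum can be cleared to a
    polynomial equation. *)
Let critical_cases : n%:R * (p * q + q - 2) = 2 * sigma * (2 * q + 1) \/
  n%:R * (2 * p * q - p - 1) = 2 * sigma * (p * q + p + 1).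
Proof.
have dA : 0 < p * q + q - 2 by move: p1 q1; nra.
have dB : 0 < 2 * p * q - p - 1 by move: p1 q1; nra.
have s20 : 0 < 2 * sigma by rewrite mulr_gt0.
have E (x y : R) : 0 < y -> x / y = n%:R / (2 * sigma) -> n%:R * y = 2 * sigma * x.
  move=> y0 /eqP; rewrite eqr_div ?lt0r_neq0// => /eqP h.
  by rewrite -h mulrC.
by move: critical; rewrite /Num.max; case: ifP => _ h; [right|left]; exact: E h.
Qed.

Let sn0 : 0 < n%:R - sigma. Proof. by rewrite subr_gt0. Qed.

Let critical_qE : q = 1 + 2 * sigma / (n%:R - sigma) <-> (n%:R - sigma) * q = n%:R + sigma.
Proof.
split=> [->|h]; first by field; rewrite gt_eqF.
apply: (mulfI (lt0r_neq0 sn0)); rewrite h; field; by rewrite gt_eqF.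
Qed.

Let critical_pE : p = 1 + 2 * sigma / n%:R <-> n%:R * p = n%:R + 2 * sigma.
Proof.
split=> [->|h]; first by field; rewrite gt_eqF.
apply: (mulfI (lt0r_neq0 nR0)); rewrite h; field; by rewrite gt_eqF.
Qed.

(** Both branches of the critical curve meet the line p = p_c in the same single point. *)
Lemma critical_p : p = 1 + 2 * sigma / n%:R -> q = 1 + 2 * sigma / (n%:R - sigma).
Proof.
move/critical_pE => hp; apply/critical_qE.
have hpq : n%:R * p * q = (n%:R + 2 * sigma) * q by rewrite hp.
case: critical_cases => h; first by move: h hpq; lra.
(* Multiplied by n, the second branch involves p only through n p = n + 2 sigma, and a common factor
   n + 2 sigma cancels. *)
apply: (mulfI (x := n%:R + 2 * sigma)); first by rewrite gt_eqF// addr_gt0// mulr_gt0.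
have hN : n%:R * (n%:R * (2 * p * q - p - 1)) = n%:R * (2 * sigma * (p * q + p + 1)) by rewrite h.
have e1 : n%:R * (n%:R * p * q) = n%:R * ((n%:R + 2 * sigma) * q) by rewrite hpq.
have e2 : sigma * (n%:R * p * q) = sigma * ((n%:R + 2 * sigma) * q) by rewrite hpq.
have e3 : n%:R * (n%:R * p) = n%:R * (n%:R + 2 * sigma) by rewrite hp.
have e4 : sigma * (n%:R * p) = sigma * (n%:R + 2 * sigma) by rewrite hp.
move: hN e1 e2 e3 e4; lra.
Qed.

Lemma critical_q : q = 1 + 2 * sigma / (n%:R - sigma) -> p = 1 + 2 * sigma / n%:R.
Proof.
move/critical_qE => hq; apply/critical_pE.
have hpq : p * ((n%:R - sigma) * q) = p * (n%:R + sigma) by rewrite hq.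
case: critical_cases => h; last by move: h hpq; lra.
(* Eliminating the constants with (n - sigma) q = n + sigma turns the first branch into n p q = (n +
   2 sigma) q, where q cancels. *)
apply: (mulIf (x := q)); first by rewrite gt_eqF// (lt_trans _ q1).
move: h hq; lra.
Qed.

End system.

Theorem theorem1p2 (R : realType) (n : nat) (sigma p q c : R)
    (mu1 mu2 : R -> R) (u1 v1 : euclidean R n -> R)
    (hsigma1 : 1 < sigma) (hsigman : sigma < n%:R) (hn2sigma : n%:R < 2 * sigma)
    (hp : 1 < p) (hq : 1 < q)
    (hcritical : Num.max ((2 * q + 1) / (p * q + q - 2))
                         ((p * q + p + 1) / (2 * p * q - p - 1))
                 = n%:R / (2 * sigma))
    (hu1 : (lebesgue_measure_n R n).-integrable setT (EFin \o u1))
    (hv1 : (lebesgue_measure_n R n).-integrable setT (EFin \o v1))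
    (hu1_gt0 : 0 < \int[lebesgue_measure_n R n]_x u1 x)
    (hv1_gt0 : 0 < \int[lebesgue_measure_n R n]_x v1 x)
    (hmu1 : modulus_of_continuity mu1) (hmu2 : modulus_of_continuity mu2)
    (hdmu1 : forall k, (1 <= k <= 2)%N -> derivative_bound mu1 k)
    (hdmu2 : forall k, (1 <= k <= 2)%N -> derivative_bound mu2 k)
    (hc : 0 < c)
    (hcases :
      [/\ 1 + 2 * sigma / (n%:R - sigma) <= q, p <= 1 + 2 * sigma / n%:R &
          (\int[@lebesgue_measure R]_(s in `]0%R, c[%classic)
             (s^-1 * (mu1 s `^ (q / (q + 1)) * mu2 s `^ (1 / (q + 1))))%:E)%E
           = +oo%E]
      \/
      [/\ q <= 1 + 2 * sigma / (n%:R - sigma), 1 + 2 * sigma / n%:R <= p,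
          (\int[@lebesgue_measure R]_(s in `]0%R, c[%classic)
             (s^-1 * (mu1 s `^ (1 / (p + 1)) * mu2 s `^ (p / (p + 1))))%:E)%E
           = +oo%E &
          sigma \isn't a Num.int -> 2 * Num.floor sigma <= n%:Z]) :
  ~ exists u v : R -> euclidean R n -> R,
      sobolev_solution sigma p q mu1 mu2 u1 v1 u v.
Proof.
move=> [u [v sol]].
have d1 : dini (1 + 2 * sigma / n%:R - p) mu1 by exact: damped_dini sol hv1 hv1_gt0.
have d2 : dini (1 + 2 * sigma / (n%:R - sigma) - q) mu2 by exact: strongly_damped_dini sol hu1 hu1_gt0.
have p0 : 0 < p by exact: lt_trans hp.
have q0 : 0 < q by exact: lt_trans hq.
have p10 : 0 < p + 1 by rewrite addr_gt0.
have q10 : 0 < q + 1 by rewrite addr_gt0.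
case: hcases => [[hqc hpc hinf]|[hqc hpc hinf _]].
  set d := 1 + 2 * sigma / n%:R - p in d1.
  (* - q d is the exponent that balances d under the weights q / (q + 1) and 1 / (q + 1). For d > 0
     it is negative and the integral converges trivially; for d = 0 the critical curve makes the gap
     of q vanish too, and the bound from the strongly damped equation is the one wanted. *)
  have d2' : dini (- (q * d)) mu2.
    have [dp|dp] := ltP 0 d; first by apply: dini_neg => //; rewrite oppr_lt0 mulr_gt0.
    have pE : p = 1 + 2 * sigma / n%:R.
      by apply/eqP; rewrite eq_le hpc/= -subr_le0.
    have d0 : d = 0 by rewrite /d pE subrr.
    by move: d2; rewrite d0 mulr0 oppr0 -(critical_p hsigma1 hsigman hp hq hcritical pE) subrr.
  have q1q0 : 0 < q / (q + 1) by rewrite divr_gt0.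
  have q11 : 0 < 1 / (q + 1) by rewrite divr_gt0.
  have e1 : q / (q + 1) + 1 / (q + 1) = 1 by field; rewrite gt_eqF.
  have e2 : q / (q + 1) * d + 1 / (q + 1) * - (q * d) = 0 by field; rewrite gt_eqF.
  by have := dini_combine hmu1 hmu2 q1q0 q11 e1 e2 d1 d2' hc; rewrite hinf ltxx.
set d := 1 + 2 * sigma / (n%:R - sigma) - q in d2.
(* The same dichotomy with the two equations exchanged: [d] is now the gap of q. *)
have d1' : dini (- (p * d)) mu1.
  have [dp|dp] := ltP 0 d; first by apply: dini_neg => //; rewrite oppr_lt0 mulr_gt0.
  have qE : q = 1 + 2 * sigma / (n%:R - sigma).
    by apply/eqP; rewrite eq_le hqc/= -subr_le0.
  have d0 : d = 0 by rewrite /d qE subrr.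
  by move: d1; rewrite d0 mulr0 oppr0 -(critical_q hsigma1 hsigman hp hq hcritical qE) subrr.
have p1p0 : 0 < p / (p + 1) by rewrite divr_gt0.
have p11 : 0 < 1 / (p + 1) by rewrite divr_gt0.
have e1 : 1 / (p + 1) + p / (p + 1) = 1 by field; rewrite gt_eqF.
have e2 : 1 / (p + 1) * - (p * d) + p / (p + 1) * d = 0 by field; rewrite gt_eqF.
by have := dini_combine hmu1 hmu2 p11 p1p0 e1 e2 d1' d2 hc; rewrite hinf ltxx.
Qed.
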